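(* Assume that (A1) $\operatorname{Com}(Q)\cap\ker(A)\cap\ker(A_0)=\{0\}$, and (A2) $\operatorname{rank}(\Delta(Q)\Phi)=\max\{\operatorname{rank}(\Delta(Q')\Phi) : Q'\in\mathbb R^{N\times N},\ Q'\mathbf 1=\mathbf 1,\ \operatorname{supp}(Q')\subseteq\operatorname{supp}(Q)\}$. Let $\alpha\in(0,1)$, and let $\hat u_{1-\alpha}$ denote the quantile of order $1-\alpha$ of the $\chi^2_G(\hat W)$ distribution. Let $$ S = n\Big(\inf_{m\in\mathcal M_0}\Vert\Delta(\hat Q)m\Vert^2-\inf_{m\in\mathcal M}\Vert\Delta(\hat Q)m\Vert^2\Big),\qquad W=\Pi_F\,\Delta(P)\,\Sigma\,\Delta(P)^\top\,\Pi_F .$$ If $W\neq0$, then under $\mathcal H_0:A_0p=b_0$, $$\lim_{n\to\infty}\mathbb P(S>\hat u_{1-\alpha})=\alpha .$$ Moreover, if $\Delta(Q)p'\neq0$ for all $p'\in\mathcal M_0$, then $\lim_{n\to\infty}\mathbb P(S>\hat u_{1-\alpha})=1$.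
   Context: **Model.** Let $N\ge 3$ and let $X=(X_m)_{m\in\mathbb N}$ be an irreducible, aperiodic, homogeneous Markov chain on $\{1,\dots,N\}$ with transition matrix $P$ and invariant distribution $\pi=(\pi_1,\dots,\pi_N)$ (so all $\pi_i>0$). The chain is observed at random times $T_1,\dots,T_n$ only: $Y_k=X_{T_k}$, $k=1,\dots,n$, where the gaps $\tau_k=T_k-T_{k-1}$ (with $T_0=0$) are i.i.d. random variables with distribution $\mu$ on $\mathbb N=\{0,1,2,\dots\}$, $\mu\neq\delta_0$, independent of $X$. Then $(Y_k)$ is a Markov chain with transition matrix $Q=G_\mu(P)=\sum_{\ell\ge0}\mu(\ell)P^\ell$, which is irreducible and aperiodic with invariant distribution $\pi$. **Notation.** $\operatorname{vec}(M)=(M_{11},\dots,M_{N1},\dots,M_{1N},\dots,M_{NN})^\top$ is the column-stacking vectorization; $p=\operatorname{vec}(P)$, $q=\operatorname{vec}(Q)$; $\mathbf 1=(1,\dots,1)^\top$; $\operatorname{supp}(M)=\{(i,j):M_{ij}\ne0\}$; $\Vert\cdot\Vert$ is the Euclidean norm. For $M\in\mathbb R^{N\times N}$, $\Delta(M)=\mathrm I\otimes M-M^\top\otimes \mathrm I\in\mathbb R^{N^2\times N^2}$, where $\otimes$ is the Kronecker product and $\mathrm I$ the identity. $\operatorname{Com}(Q)$ is the set of matrices commuting with $Q$, identified through $\operatorname{vec}$ with a subspace of $\mathbb R^{N^2}$, i.e. $\operatorname{Com}(Q)=\ker\Delta(Q)$. **Constraints.** $A\in\mathbb R^{r\times N^2}$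 is a known matrix of full rank $r$, $b\in\mathbb R^r$ is known, $\mathcal M=\{m\in\mathbb R^{N^2}:Am=b\}$, $d=\dim\mathcal M=N^2-r$, and it is assumed that $p\in\mathcal M$. Let $k\ge1$, let $A_0\in\mathbb R^{k\times N^2}$ be of full rank, $b_0\in\mathbb R^k$, and $\mathcal M_0=\{m\in\mathbb R^{N^2}:Am=b,\ A_0m=b_0\}$, assumed nonempty and of dimension $d-k$; $p_0$ is a fixed element of $\mathcal M_0$. Let $\phi_1,\dots,\phi_{d-k}$ be a basis of $\ker(A)\cap\ker(A_0)$, extended by $\phi_{d-k+1},\dots,\phi_d$ to a basis of $\ker(A)$; $\Phi=(\phi_1,\dots,\phi_d)\in\mathbb R^{N^2\times d}$ and $\Phi_0=(\phi_1,\dots,\phi_{d-k})\in\mathbb R^{N^2\times(d-k)}$. **Subspaces.** $E=\operatorname{Im}(\Delta(Q)\Phi)$, $E_0=\operatorname{Im}(\Delta(Q)\Phi_0)$, $F=E\cap E_0^\perp$ (orthogonal complement in $\mathbb R^{N^2}$); $\Pi_F$ is the orthogonal projector of $\mathbb R^{N^2}$ onto $F$. **Estimators.** The empirical estimators are $$\hat\pi_i=\frac1n\sum_{k=1}^n\mathbf 1\{Y_k=i\},\qquad \hat Q_{ij}=\frac{\sum_{k=1}^{n-1}\mathbf 1\{Y_k=i,Y_{k+1}=j\}}{\sum_{k=1}^{n-1}\mathbf 1\{Y_k=i\}}$$ (defined when each state $i$ has been observed, an event of probability tending to $1$), and $\hat q=\operatorname{vec}(\hat Q)$. It is a known fact that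 $\sqrt n(\hat q-q)\to\mathcal N(0,\Sigma)$ in distribution, where $\Sigma\in\mathbb R^{N^2\times N^2}$ is the matrix whose entry at the positions of $(i,j)$ and $(k,\ell)$ in the vectorization equals $Q_{ij}(1-Q_{ij})/\pi_i$ if $(i,j)=(k,\ell)$; $-Q_{ij}Q_{i\ell}/\pi_i$ if $i=k$ and $j\neq\ell$; and $0$ otherwise. $\hat\Sigma$ is obtained from $\Sigma$ by replacing $\pi,Q$ by $\hat\pi,\hat Q$. The estimator $\hat P$ of $P$ is defined by $\operatorname{vec}(\hat P)=\hat p$ with $$\hat p=\Big(\mathrm I-\Phi_0\big(\Phi_0^\top\Delta(\hat Q)^\top\Delta(\hat Q)\Phi_0\big)^{-1}\Phi_0^\top\Delta(\hat Q)^\top\Delta(\hat Q)\Big)p_0$$ (the inverse exists with probability tending to $1$ under (A1)). Let $\hat F=\operatorname{Im}(\Delta(\hat Q)\Phi)\cap\operatorname{Im}(\Delta(\hat Q)\Phi_0)^\perp$, let $\Pi_{\hat F}$ be the orthogonal projector onto $\hat F$, and $$\hat W=\Pi_{\hat F}\,\Delta(\hat P)\,\hat\Sigma\,\Delta(\hat P)^\top\,\Pi_{\hat F}.$$ **Generalized chi-squared law.** For $V\in\mathbb R^{N^2\times N^2}$, $\chi^2_G(V)$ denotes the distribution of $\epsilon^\top V\epsilon$, where $\epsilon$ is a standard Gaussian vector in $\mathbb R^{N^2}$ (a Dirac mass at $0$ if $V=0$). For the random matrix $\hat W$, the quantile $\hat u_{1-\alpha}$ is that of $\chi^2_G(V)$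 evaluated at $V=\hat W$ (i.e. conditionally on the observations). *)

(* Defs.v *)
From HB Require Import structures.
From mathcomp Require Import all_boot all_order all_algebra.
From mathcomp Require Import mxtens.
From mathcomp Require Import all_classical all_reals all_analysis.
From mathcomp Require Import measurable_realfun.

Set Implicit Arguments.
Unset Strict Implicit.
Unset Printing Implicit Defensive.

Import Order.TTheory GRing.Theory Num.Theory.
Import numFieldNormedType.Exports.

Local Open Scope classical_set_scope.
Local Open Scope ring_scope.

Section linear_algebra.
Context {R : realType}.

(* Column stacking: entry (i, j) of M goes to position j * N + i, which is
   mxtens_index (j, i); with this ordering *t (tensmx) is the Kronecker
   product. *)
Definition vec (N : nat) (M : 'M[R]_N) : 'cV[R]_(N * N) :=
  \col_a M (mxtens_unindex a).2 (mxtens_unindex a).1.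

Definition unvec (N : nat) (v : 'cV[R]_(N * N)) : 'M[R]_N :=
  \matrix_(i, j) v (mxtens_index (j, i)) 0.

Lemma vecK (N : nat) : cancel (@vec N) (@unvec N).
Proof. by move=> M; apply/matrixP => i j; rewrite !mxE mxtens_indexK. Qed.

Lemma unvecK (N : nat) : cancel (@unvec N) (@vec N).
Proof.
move=> v; apply/colP => a; rewrite !mxE.
by rewrite -[in RHS](mxtens_unindexK a); case: (mxtens_unindex a).
Qed.

Definition Delta (N : nat) (M : 'M[R]_N) : 'M[R]_(N * N) :=
  tensmx 1%:M M - tensmx M^T 1%:M.

Lemma sum_mxtens_index (N : nat) (f : 'I_(N * N) -> R) :
  \sum_a f a = \sum_l \sum_k f (mxtens_index (l, k)).
Proof.
rewrite pair_bigA /= (reindex (fun x : 'I_N * 'I_N => mxtens_index x)) /=.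
  by apply: eq_bigr => -[].
by exists (@mxtens_unindex N N) => x _; rewrite (mxtens_indexK, mxtens_unindexK).
Qed.

Lemma Delta_vec (N : nat) (M P : 'M[R]_N) :
  Delta M *m vec P = vec (M *m P - P *m M).
Proof.
apply/colP => a; case: (mxtens_indexP a) => j i.
rewrite mulmxBl [LHS]mxE [RHS]mxE mxtens_indexK /= [RHS]mxE; congr (_ + _).
  rewrite !mxE sum_mxtens_index (bigD1 j) //= [X in _ + X]big1 ?addr0.
    by apply: eq_bigr => k _; rewrite tensmxE !mxE eqxx mul1r mxtens_indexK.
  move=> l ljN; apply: big1 => k _.
  by rewrite tensmxE !mxE eq_sym (negbTE ljN) !mul0r.
rewrite !mxE sum_mxtens_index; congr (- _); apply: eq_bigr => l _.
rewrite (bigD1 i) //= [X in _ + X]big1 ?addr0.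
  by rewrite tensmxE !mxE eqxx mulr1 mxtens_indexK mulrC.
by move=> k kiN; rewrite tensmxE !mxE eq_sym (negbTE kiN) mulr0 mul0r.
Qed.

Definition supp (N : nat) (M : 'M[R]_N) : set ('I_N * 'I_N) :=
  [set ij | M ij.1 ij.2 != 0].

Definition Com (N : nat) (Q : 'M[R]_N) : set 'cV[R]_(N * N) :=
  [set vec M | M in [set M : 'M[R]_N | comm_mx Q M]].

(* The norm that the library puts on matrices is the sup norm. *)
Definition euclidean_norm (n : nat) (v : 'cV[R]_n) : R :=
  Num.sqrt (\sum_i v i 0 ^+ 2).

(* From here on a subspace of R^n is represented, as in mxalgebra, by a matrix
   whose row space is the set of the transposes of its elements. *)
Definition Im (n d : nat) (M : 'M[R]_(n, d)) : 'M[R]_(d, n) := M^T.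

Definition Ker (r n : nat) (A : 'M[R]_(r, n)) : 'M[R]_n := kermx A^T.

Definition orthogonal_compl (d n : nat) (U : 'M[R]_(d, n)) : 'M[R]_n :=
  kermx U^T.

Definition is_basis (n d e : nat) (Phi : 'M[R]_(n, d)) (U : 'M[R]_(e, n)) :=
  row_free Phi^T && (Phi^T == U)%MS.

(* proj_mx acts on row vectors, on the right; the transposition turns it into
   an operator on columns. *)
Definition orthogonal_proj (n : nat) (F : 'M[R]_n) : 'M[R]_n :=
  (proj_mx F (orthogonal_compl F))^T.

Lemma orthogonal_cap0 (n : nat) (F : 'M[R]_n) :
  (F :&: orthogonal_compl F = 0)%MS.
Proof.
have cap0 (u : 'rV[R]_n) : (u <= F :&: orthogonal_compl F)%MS -> u = 0.
  rewrite sub_capmx => /andP[/submxP[w uE] /sub_kermxP uF0].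
  have /matrixP/(_ 0 0) : u *m u^T = 0.
    by rewrite {2}uE trmx_mul mulmxA uF0 mul0mx.
  rewrite mxE [RHS]mxE => /eqP.
  under eq_bigr do rewrite [X in _ * X]mxE -expr2.
  rewrite psumr_eq0 => [/allP u0|j _]; last exact: sqr_ge0.
  apply/rowP => j; have := u0 j (mem_index_enum j).
  by rewrite sqrf_eq0 [RHS]mxE => /eqP.
by apply/row_matrixP => i; rewrite row0; apply/cap0/row_sub.
Qed.

Lemma orthogonal_proj_sub (n : nat) (F : 'M[R]_n) (v : 'cV[R]_n) :
  ((orthogonal_proj F *m v)^T <= F)%MS.
Proof. by rewrite trmx_mul trmxK proj_mx_sub. Qed.

Lemma orthogonal_proj_compl (n : nat) (F : 'M[R]_n) (v : 'cV[R]_n) :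
  ((v - orthogonal_proj F *m v)^T <= orthogonal_compl F)%MS.
Proof.
rewrite linearB /= trmx_mul trmxK proj_mx_compl_sub //.
have full : row_full (F + orthogonal_compl F)%MS.
  have := mxrank_sum_cap F (orthogonal_compl F).
  rewrite orthogonal_cap0 mxrank0 addn0 mxrank_ker mxrank_tr.
  by rewrite subnKC ?rank_leq_row // => rk; apply/eqP.
by rewrite submx_full.
Qed.

End linear_algebra.

Definition is_max (S : set nat) (m : nat) : Prop := S m /\ ubound S m.

Section generalized_chi2.
Context {R : realType}.
Let RR := measurableTypeR R.

Definition cons_pair (n : nat) (x : RR * n.-tuple RR) : n.+1.-tuple RR :=
  [tuple of x.1 :: x.2].

Lemma measurable_cons_pair (n : nat) : measurable_fun setT (@cons_pair n).
Proof. exact: measurable_cons. Qed.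

HB.instance Definition _ (n : nat) :=
  isMeasurableFun.Build _ _ _ _ (@cons_pair n) (@measurable_cons_pair n).

Fixpoint standard_gaussian (n : nat) : probability (n.-tuple RR) R :=
  match n with
  | 0 => \d_[tuple]
  | m.+1 => distribution (normal_prob 0 1 \x standard_gaussian m)%E
              (@cons_pair m)
  end.

Definition quadratic_form (n : nat) (V : 'M[R]_n) (x : n.-tuple RR) : RR :=
  let e : 'cV[R]_n := \col_i tnth x i in (e^T *m V *m e) 0 0.

Lemma measurable_quadratic_form (n : nat) (V : 'M[R]_n) :
  measurable_fun setT (quadratic_form V).
Proof.
rewrite (_ : quadratic_form V =
  fun x => \sum_i (\sum_j tnth x j * V j i) * tnth x i); last first.
  apply/funext => x; rewrite /quadratic_form mxE; apply: eq_bigr => i _.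
  by rewrite !mxE; congr (_ * _); apply: eq_bigr => j _; rewrite !mxE.
apply: measurable_sum => i; apply: measurable_funM; last exact: measurable_tnth.
apply: measurable_sum => j; apply: measurable_funM => //.
exact: measurable_tnth.
Qed.

HB.instance Definition _ (n : nat) (V : 'M[R]_n) :=
  isMeasurableFun.Build _ _ _ _ (quadratic_form V)
    (measurable_quadratic_form V).

Definition chi2G (n : nat) (V : 'M[R]_n) : probability RR R :=
  distribution (standard_gaussian n) (quadratic_form V).

Definition quantile (nu : probability RR R) (a : R) : R :=
  inf [set x : R | (a%:E <= nu [set` `]-oo, x]%R])%E].

End generalized_chi2.

Section probabilistic_model.
Context {R : realType}.

Definition stochastic (N : nat) (P : 'M[R]_N) : Prop :=
  (forall i j, 0 <= P i j) /\ (forall i, \sum_j P i j = 1).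

Definition irreducible (N : nat) (P : 'M[R]_N) : Prop :=
  forall i j, exists m : nat, 0 < (P ^+ m) i j.

(* For every state i, gcd {m >= 1 | (P ^+ m) i i > 0} = 1. *)
Definition aperiodic (N : nat) (P : 'M[R]_N) : Prop :=
  forall i (g : nat),
    (forall m : nat, (0 < m)%N -> 0 < (P ^+ m) i i -> (g %| m)%N) -> g = 1%N.

Definition invariant_distribution (N : nat) (P : 'M[R]_N) (pi : 'rV[R]_N) :
    Prop :=
  [/\ forall i, 0 <= pi 0 i, \sum_i pi 0 i = 1 & pi *m P = pi].

Context (d : measure_display) (Omega : measurableType d).

(* The initial distribution is not prescribed. *)
Definition markov_chain (Pr : probability Omega R) (N : nat) (P : 'M[R]_N)
    (X : nat -> Omega -> 'I_N) : Prop :=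
  (forall m i, measurable (X m @^-1` [set i])) /\
  forall (m : nat) (x : nat -> 'I_N),
    Pr [set w | forall l, (l <= m.+1)%N -> X l w = x l] =
    (Pr [set w | forall l, (l <= m)%N -> X l w = x l] *
     (P (x m) (x m.+1))%:E)%E.

Definition mutually_independent d' (T : measurableType d')
    (Pr : probability Omega R) (I : choiceType) (Z : I -> {RV Pr >-> T}) :
    Prop :=
  forall (s : seq I) (B : I -> set T), uniq s ->
    (forall i, measurable (B i)) ->
    Pr (\bigcap_(i in [set` s]) (Z i @^-1` B i)) =
    (\prod_(i <- s) Pr (Z i @^-1` B i))%E.

Definition identically_distributed d' (T : measurableType d')
    (Pr : probability Omega R) (I : Type) (Z : I -> {RV Pr >-> T})
    (mu : probability T R) : Prop :=
  forall i (B : set T), measurable B -> distribution Pr (Z i) B = mu B.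

Definition generated_sigma_algebra (T I : Type) (G : set (set T))
    (Z : I -> Omega -> T) : set (set Omega) :=
  <<s [set C | exists i B, G B /\ C = Z i @^-1` B] >>.

Definition independent_sigma_algebras (Pr : probability Omega R)
    (F1 F2 : set (set Omega)) : Prop :=
  forall C1 C2, F1 C1 -> F2 C2 -> Pr (C1 `&` C2) = (Pr C1 * Pr C2)%E.

Definition independent_of_gaps (Pr : probability Omega R) (N : nat)
    (X : nat -> Omega -> 'I_N) (tau : nat -> {RV Pr >-> nat}) : Prop :=
  independent_sigma_algebras Pr
    (generated_sigma_algebra discrete_measurable X)
    (generated_sigma_algebra measurable (fun k => tau k : Omega -> nat)).

(* The gap tau_k is [tau k.-1], so that T_k is the sum of the first k gaps. *)
Definition observation_time (tau : nat -> Omega -> nat) (k : nat) (w : Omega) :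
    nat :=
  (\sum_(j < k) tau j w)%N.

Definition observed (N : nat) (X : nat -> Omega -> 'I_N)
    (tau : nat -> Omega -> nat) (w : Omega) (k : nat) : 'I_N :=
  X (observation_time tau k w) w.

Definition G_ (N : nat) (mu : probability nat R) (P : 'M[R]_N) : 'M[R]_N :=
  \matrix_(i, j) limn (series (fun l => fine (mu [set l]) * (P ^+ l) i j)).

End probabilistic_model.

(* The estimators are functions of the observed path y; y 0 is never used. Off
   the event where every state is visited (resp. where the Gram matrix of hat_p
   is invertible) they take the conventional values x / 0 = 0 (resp.
   invmx M = M). *)
Section estimation.
Context {R : realType} (N : nat).
Implicit Types (y : nat -> 'I_N) (Q P : 'M[R]_N).

Definition hat_pi (n : nat) y : 'rV[R]_N :=
  \row_i (n%:R^-1 * \sum_(1 <= k < n.+1) (y k == i)%:R).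

Definition hat_Q (n : nat) y : 'M[R]_N :=
  \matrix_(i, j) ((\sum_(1 <= k < n) ((y k == i) && (y k.+1 == j))%:R) /
                  (\sum_(1 <= k < n) (y k == i)%:R)).

(* Row a of Sigma is indexed by the pair (i, j) with a = mxtens_index (j, i). *)
Definition Sigma (pi : 'rV[R]_N) Q : 'M[R]_(N * N) :=
  \matrix_(a, c)
    let: (j, i) := mxtens_unindex a in
    let: (l, k) := mxtens_unindex c in
    if (i == k) && (j == l) then Q i j * (1 - Q i j) / pi 0 i
    else if i == k then - (Q i j * Q i l) / pi 0 i
    else 0.

Definition hat_p (d0 : nat) (Phi0 : 'M[R]_(N * N, d0)) (p0 : 'cV[R]_(N * N)) Q :
    'cV[R]_(N * N) :=
  let D := Delta Q in
  (1%:M - Phi0 *m invmx (Phi0^T *m D^T *m D *m Phi0) *m Phi0^T *m D^T *m D)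
    *m p0.

Definition F_space (d1 d0 : nat) (Phi : 'M[R]_(N * N, d1))
    (Phi0 : 'M[R]_(N * N, d0)) Q : 'M[R]_(N * N) :=
  (Im (Delta Q *m Phi) :&: orthogonal_compl (Im (Delta Q *m Phi0)))%MS.

Definition W_ (F : 'M[R]_(N * N)) P (Sig : 'M[R]_(N * N)) : 'M[R]_(N * N) :=
  orthogonal_proj F *m Delta P *m Sig *m (Delta P)^T *m orthogonal_proj F.

Definition hat_W (d1 d0 : nat) (Phi : 'M[R]_(N * N, d1))
    (Phi0 : 'M[R]_(N * N, d0)) (p0 : 'cV[R]_(N * N)) (n : nat) y :
    'M[R]_(N * N) :=
  W_ (F_space Phi Phi0 (hat_Q n y))
     (unvec (hat_p Phi0 p0 (hat_Q n y)))
     (Sigma (hat_pi n y) (hat_Q n y)).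

Definition S_stat (M0 M : set 'cV[R]_(N * N)) (n : nat) y : R :=
  n%:R *
  (inf [set euclidean_norm (Delta (hat_Q n y) *m m) ^+ 2 | m in M0] -
   inf [set euclidean_norm (Delta (hat_Q n y) *m m) ^+ 2 | m in M]).

End estimation.

(* Main.v *)
(** By commutation, [Delta hatQ *m vec P = - Delta P *m vec (hatQ - Q)], so under H0
    the statistic S is the squared norm of
    [sqrt n * Pi_hatF *m Delta P *m vec (hatQ - Q)]. Up to a factor that tends to
    1, [vec (hatQ - Q)] is a sum of bounded martingale differences of the chain
    [(Y_k, Y_k+1)], and [Pi_hatF] is consistent: a family of rows independent at Q
    stays independent nearby, and by (A2) the rank cannot increase, as hatQ
    satisfies the constraints on Q' with high probability.

    The limit law of S is reached through Laplace transforms. As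
    [exp (- la |z|^2)] is the average of [cos (sqrt (2 la) z . e)] over a standard
    Gaussian vector e, it suffices to know the limits of the characteristic
    functions of the martingale; these come from perturbing the test function 1 by
    a solution of a Poisson equation, which makes it an approximate eigenfunction
    of the tilted transition kernel. Convergence of Laplace transforms then gives
    convergence of the tails at continuity points.

    A nonzero quadratic polynomial vanishes on a Gaussian null set, so the
    distribution function of [chi2G W] is continuous for [W != 0] and its values
    move little when W does; since [hat_W] converges to W, the quantile is
    eventually trapped between two points at which the distribution function is as
    close to [1 - alpha] as one wishes.

    Under the alternative, S is at least a constant times n whereas the quantile
    remains bounded, because [hat_W] still converges. *)
Require Import Defs.
From mathcomp Require Import all_boot all_order all_algebra.
From mathcomp Require Import mxtens ring lra.
From mathcomp Require Import all_classical all_reals all_analysis.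
From mathcomp Require Import measurable_realfun.

Set Implicit Arguments.
Unset Strict Implicit.
Unset Printing Implicit Defensive.

Import Order.TTheory GRing.Theory Num.Theory.
Import numFieldNormedType.Exports.

Local Open Scope classical_set_scope.
Local Open Scope ring_scope.

(** * Gaussian vectors and their quadratic forms *)

(** Whatever is computed from [n] observations depends on finitely many states. Once the law of the
    observed chain is known, the analysis takes place on finite weighted sums over paths, and the
    underlying probability space returns only at the very end. Events that involve the random
    quantile are then measurable for free.

    Two difficulties shape the argument. The space [F] is an intersection, and intersections do not
    depend continuously on the matrix; since [E0] is contained in [E], its projector is the
    difference of the projectors onto [E] and [E0], which are given by Gram formulas near [Q].
    Moreover [hat_W] approaches [W] only if [hat_P] is consistent: under H0, [p] lies in [M0] and is
    killed by [Delta Q], and (A1) makes it the only such point, so that least squares recover it.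
    Under the alternative the limit is some other matrix, which still keeps the quantile bounded.

    Irreducibility and aperiodicity enter through the positivity of [pi] and through the fact that
    functions harmonic for [Q] are constant, which makes the Poisson equations solvable. *)

Section normal_characteristic_function.
Context {R : realType}.
Local Notation leb := (@lebesgue_measure R).
Local Notation p := (normal_pdf (0 : R) 1).

Lemma normal_pdf01E (x : R) : p x = normal_peak 1 * expR (- (x ^+ 2) / 2).
Proof. by rewrite /normal_pdf oner_eq0 /normal_fun subr0 expr1n. Qed.

Lemma is_derive_normal_pdf (x : R) : is_derive x 1 p (- (x * p x)).
Proof.
rewrite (_ : (p : R -> R) = fun x => normal_peak 1 * expR (- (x ^+ 2) / 2)); last first.
  by apply/funext => y; rewrite normal_pdf01E.
apply: is_derive_eq.
rewrite /GRing.scale /=; lra.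
Qed.

(** The bound [|x| <= 2 (1 + 3/8 x^2) <= 2 exp (3/8 x^2)] leaves a factor [exp (- x^2 / 8)], so a
    multiple of the normal density of standard deviation 2 dominates the integrand. *)
Lemma integrable_id_normal_pdf :
  leb.-integrable setT (fun x : R => (`|x| * p x)%:E).
Proof.
have mp : measurable_fun setT (fun x : R => `|x| * p x).
  by apply: measurable_funM; [exact: normr_measurable|exact: measurable_normal_pdf].
have sqE (y : R) : `|y| <= 2 * (1 + 3 / 8 * y ^+ 2).
  rewrite -(real_normK (num_real y)); have := sqr_ge0 (`|y| - 1); have := sqr_ge0 (`|y|).
  rewrite !expr2; lra.
pose C : R := 2 * normal_peak 1 / normal_peak 2.
have [k1 k2] : 0 < normal_peak (1 : R) /\ 0 < normal_peak (2 : R).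
  by split; apply: normal_peak_gt0; rewrite ?oner_eq0// -?natr1; lra.
apply: (@le_integrable _ _ _ leb _ measurableT _ (fun x => (C * normal_pdf 0 2 x)%:E)).
- by apply/measurable_EFinP.
- move=> x _ /=; rewrite lee_fin normrM normr_id [`|p x|]ger0_norm ?normal_pdf_ge0//.
  rewrite [leRHS]ger0_norm; last first.
    by rewrite mulr_ge0 ?normal_pdf_ge0 // /C ltW// divr_gt0 ?mulr_gt0.
  rewrite normal_pdf01E /normal_pdf (_ : (2 == 0 :> R) = false) ?pnatr_eq0//.
  rewrite /normal_fun /C subr0 [leRHS]mulrA mulfVK ?gt_eqF//.
  rewrite mulrCA [leRHS]mulrAC mulrC ler_pM2r//.
  have -> : - x ^+ 2 / 2 = - x ^+ 2 / (2 ^+ 2 *+ 2) - 3 / 8 * x ^+ 2 :> R by lra.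
  rewrite expRD mulrCA [leRHS]mulrC ler_pM2l ?expR_gt0// expRN ler_pdivrMr ?expR_gt0//.
  apply: (@le_trans _ _ (2 * (1 + 3 / 8 * x ^+ 2))); last first.
    by rewrite ler_pM2l// expR_ge1Dx.
  exact: sqE.
- by under eq_fun do rewrite EFinM; apply: integrableZl => //; exact: integrable_normal_pdf.
Qed.

(** The phase [c] replaces complex exponentials: when a Gaussian vector is treated one coordinate at
    a time, it absorbs the contribution of the coordinates held fixed. *)
Let f (c a x : R) : R := cos (c + a * x) * p x.

Let derf (c a x : R) : is_derive a 1 (f c ^~ x) (- (x * sin (c + a * x) * p x)).
Proof.
rewrite /f; apply: is_derive_eq.
rewrite /GRing.scale /=; lra.
Qed.

Lemma measurable_trigo_normal (h : R -> R) (c a : R) : continuous h ->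
  measurable_fun setT (fun x => h (c + a * x) * p x).
Proof.
move=> ch; apply: measurable_funM; last exact: measurable_normal_pdf.
apply: (measurableT_comp (f := h)); first exact: continuous_measurable_fun.
by apply: measurable_funD => //; apply: measurable_funM.
Qed.

Lemma integrable_trigo_normal (h : R -> R) (c a : R) : continuous h ->
  (forall x, `|h x| <= 1) ->
  leb.-integrable setT (fun x => (h (c + a * x) * p x)%:E).
Proof.
move=> ch h1.
apply: (@le_integrable _ _ _ leb _ measurableT _ (fun x => (p x)%:E)).
- by apply/measurable_EFinP; apply: measurable_trigo_normal.
- move=> x _ /=; rewrite lee_fin normrM [`|p x|]ger0_norm ?normal_pdf_ge0//.
  by rewrite ler_piMl ?normal_pdf_ge0.
- exact: integrable_normal_pdf.
Qed.

Lemma measurable_cos : measurable_fun setT (@cos R).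
Proof. by apply: continuous_measurable_fun; exact: continuous_cos. Qed.

Lemma cos_norm_le1 (x : R) : `|cos x| <= 1.
Proof. by rewrite ler_norml cos_geN1 cos_le1. Qed.

Lemma sin_norm_le1 (x : R) : `|sin x| <= 1.
Proof. by rewrite ler_norml sin_geN1 sin_le1. Qed.

Let psi (c a : R) : R := (\int[leb]_x f c a x)%R.

Lemma integrable_id_sin_normal (c a : R) :
  leb.-integrable setT (fun x => (x * sin (c + a * x) * p x)%:E).
Proof.
apply: (@le_integrable _ _ _ leb _ measurableT _ (fun x : R => (`|x| * p x)%:E)).
- apply/measurable_EFinP; under eq_fun do rewrite -mulrA.
  by apply: measurable_funM => //; apply: measurable_trigo_normal; exact: continuous_sin.
- move=> x _ /=; rewrite lee_fin !normrM normr_id [`|p x|]ger0_norm ?normal_pdf_ge0//.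
  rewrite ler_wpM2r ?normal_pdf_ge0// ler_piMr// sin_norm_le1 //.
- exact: integrable_id_normal_pdf.
Qed.

Let is_derive_psi (c a : R) :
  is_derive a 1 (psi c) (- \int[leb]_x (x * sin (c + a * x) * p x))%R.
Proof.
have Ia : `]a - 1, a + 1[%classic a by rewrite /= in_itv /=; lra.
have dE x y : partial1of2 (f c) x y = - (y * sin (c + x * y) * p y).
  by rewrite partial1of2E; apply: derive_val.
have intf x : `]a - 1, a + 1[%classic x -> leb.-integrable setT (EFin \o f c x).
  by move=> _; apply: integrable_trigo_normal; [exact: continuous_cos|exact: cos_norm_le1].
have derf1 (x y : R) : `]a - 1, a + 1[%classic x -> [set: R] y -> derivable (f c ^~ y) x 1.
  by move=> _ _; apply: ex_derive.
have G0 (y : R) : 0 <= `|y| * p y by rewrite mulr_ge0// normal_pdf_ge0.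
have Gub (x y : R) : `]a - 1, a + 1[%classic x -> [set: R] y ->
    `|partial1of2 (f c) x y| <= `|y| * p y.
  move=> _ _; rewrite dE normrN !normrM [`|p y|]ger0_norm ?normal_pdf_ge0//.
  by rewrite ler_wpM2r ?normal_pdf_ge0// ler_piMr// sin_norm_le1.
have der := @derivable_under_integral R _ _ leb (f c) setT measurableT a _ _ Ia intf
  derf1 _ G0 integrable_id_normal_pdf Gub.
have derE := @differentiation_under_integral R _ _ leb (f c) setT measurableT a _ _ Ia intf
  derf1 _ G0 integrable_id_normal_pdf Gub.
apply: DeriveDef => //; rewrite -derive1E derE.
under eq_Rintegral do rewrite dE -mulN1r.
by rewrite RintegralZl ?mulN1r//; exact: integrable_id_sin_normal.
Qed.

Lemma cvg_normal_pdf : p n%:R @[n --> \oo] --> (0 : R).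
Proof.
apply: (@squeeze_cvgr _ _ _ _ (cst 0) (fun n => normal_peak 1 * (2 / n%:R))).
- near=> n; rewrite normal_pdf_ge0 /= normal_pdf01E ler_wpM2l ?normal_peak_ge0//.
  have n0 : 0 < n%:R :> R by rewrite ltr0n; near: n; exact: nbhs_infty_gt.
  rewrite mulNr expRN -[leRHS]invrK lef_pV2 ?posrE ?expR_gt0 ?invr_gt0 ?divr_gt0//.
  rewrite invf_div; apply: le_trans (expR_ge1Dx _).
  have : 0 <= (n%:R - 1) ^+ 2 :> R by exact: sqr_ge0.
  rewrite !expr2; lra.
- exact: cvg_cst.
- rewrite -[X in _ --> X](mulr0 (normal_peak 1)); apply: cvgMr.
  rewrite -[X in _ --> X](mulr0 (2:R)); apply: cvgMr.
  by apply/gtr0_cvgV0; [near=> n; rewrite ltr0n; near: n; exact: nbhs_infty_gt|exact: cvgr_idn].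
Unshelve. all: by end_near. Qed.

Let g (c a x : R) : R := a * (cos (c + a * x) * p x) - x * sin (c + a * x) * p x.

Let is_derive_sinp (c a x : R) :
  is_derive x 1 (fun x : R => sin (c + a * x) * p x : R) (g c a x).
Proof.
have ? := is_derive_normal_pdf x.
by apply: is_derive_eq; rewrite /g /GRing.scale /=; lra.
Qed.

Let int_g (c a : R) : leb.-integrable setT (fun x => (g c a x)%:E).
Proof.
under eq_fun do rewrite /g EFinB EFinM.
apply: integrableB => //; last exact: integrable_id_sin_normal.
apply: integrableZl => //.
by apply: integrable_trigo_normal; [exact: continuous_cos|exact: cos_norm_le1].
Qed.

Let symitv (n : nat) : set R := [set` `[- n.+1%:R, n.+1%:R]].

Lemma cvg_integral_symitv (h : R -> R) :
    leb.-integrable setT (fun x => (h x)%:E) ->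
  (\int[leb]_(x in symitv n) (h x)%:E)%E @[n --> \oo] -->
  (\int[leb]_x (h x)%:E)%E.
Proof.
move=> ih; under eq_fun do rewrite integral_mkcond.
have mh := measurable_int _ ih.
pose f_ n := ((fun x => (h x)%:E) \_ (symitv n))%E.
have [] := @dominated_convergence _ _ R leb setT measurableT f_
   (fun x => (h x)%:E) (fun x => `|(h x)%:E|%E).
- move=> n; apply/(measurable_restrictT _ _).1 => //.
  - exact: measurable_itv.
  - exact: measurable_funTS.
- exact: mh.
- apply: aeW => x _; apply: cvg_near_cst; near=> n.
  rewrite /f_ patchE ifT// inE /symitv /mkset /= in_itv /= -ler_norml.
  apply: (@le_trans _ _ n%:R); last by rewrite ler_nat.
  near: n; exact: nbhs_infty_ger.
- exact: integrable_abse.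
- apply: aeW => x n _; rewrite /f_ patchE; case: ifP => // _.
  by rewrite abse0.
- by [].
Unshelve. all: by end_near. Qed.

(** [g c a] is the derivative of [F], whose values at both ends of growing symmetric intervals tend
    to 0 with the density. *)
Let integral_g (c a : R) : (\int[leb]_x g c a x)%R = 0.
Proof.
pose F (x : R) := sin (c + a * x) * p x.
have cg : continuous (g c a).
  move=> x; apply: cvgB.
    apply: cvgMr; apply: cvgM; last exact: continuous_normal_pdf.
    apply: continuous_comp; last exact: continuous_cos.
    by apply: cvgD; [exact: cvg_cst|apply: cvgMr; exact: cvg_id].
  apply: cvgM; last exact: continuous_normal_pdf.
  apply: cvgM; first exact: cvg_id.
  apply: continuous_comp; last exact: continuous_sin.
  by apply: cvgD; [exact: cvg_cst|apply: cvgMr; exact: cvg_id].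
have cF : continuous F.
  by move=> x; apply: differentiable_continuous; apply/derivable1_diffP;
    case: (is_derive_sinp c a x).
have ftc n : (\int[leb]_(x in symitv n) (g c a x)%:E = (F n.+1%:R)%:E - (F (- n.+1%:R))%:E)%E.
  apply: (@continuous_FTC2 R (g c a) F).
  - by rewrite -subr_gt0 opprK addr_gt0.
  - exact: continuous_subspaceT.
  - split.
    + by move=> x _; case: (is_derive_sinp c a x).
    + by apply: cvg_at_right_filter; exact: cF.
    + by apply: cvg_at_left_filter; exact: cF.
  - by move=> x _; rewrite derive1E; case: (is_derive_sinp c a x).
have /cvg_unique := cvg_integral_symitv (int_g c a).
have l0 : (\int[leb]_(x in symitv n) (g c a x)%:E)%E @[n --> \oo] --> (0 : R)%:E.
  under eq_fun do rewrite ftc -EFinB.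
  apply: cvg_EFin; first exact: nearW.
  apply/cvgrPdist_le => e e0; rewrite /= .
  have p2 : 2 * p n.+1%:R @[n --> \oo] --> (0 : R).
    rewrite -[X in _ --> X](mulr0 (2:R)); apply: cvgMr.
    by rewrite (cvg_shiftS (fun n => p n%:R)); exact: cvg_normal_pdf.
  near=> n; rewrite sub0r normrN.
  have pN : p (- n.+1%:R) = p n.+1%:R by rewrite !normal_pdf01E sqrrN.
  apply: (@le_trans _ _ (2 * p n.+1%:R)).
    apply: le_trans (ler_normB _ _) _; rewrite /F pN !normrM.
    rewrite [`|p _|]ger0_norm ?normal_pdf_ge0// -mulrDl ler_wpM2r ?normal_pdf_ge0//.
    have := sin_norm_le1 (c + a * n.+1%:R); have := sin_norm_le1 (c + a * - n.+1%:R); lra.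
  near: n; have /cvgrPdist_le/(_ e e0) := p2; apply: filterS => n.
  by rewrite sub0r normrN; apply: le_trans; exact: ler_norm.
by rewrite /Rintegral => /(_ (@ereal_hausdorff R) _ l0) ->.
Unshelve. all: by end_near. Qed.

(** Differentiation under the integral sign, then the integration by parts contained in
    [integral_g], give [psi' = - a psi] as a function of [a]. Hence [psi a * exp (a^2 / 2)] is
    constant, equal to its value [cos c] at 0. *)
Lemma Rintegral_cos_normal_pdf (c a : R) :
  (\int[leb]_x (cos (c + a * x) * p x))%R = cos c * expR (- a ^+ 2 / 2).
Proof.
have e0 : (\int[leb]_x (p x))%R = 1 by rewrite /Rintegral integral_normal_pdf.
have ibp b : (\int[leb]_x (x * sin (c + b * x) * p x))%R = b * psi c b.
  have := integral_g c b; rewrite /g RintegralB //=; last 2 first.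
  - rewrite (_ : EFin \o _ = fun x => (b%:E * (cos (c + b * x) * p x)%:E)%E) //.
    apply: integrableZl => //.
    by apply: integrable_trigo_normal; [exact: continuous_cos|exact: cos_norm_le1].
  - exact: integrable_id_sin_normal.
  rewrite RintegralZl//; last first.
    by apply: integrable_trigo_normal; [exact: continuous_cos|exact: cos_norm_le1].
  by move/eqP; rewrite subr_eq0 => /eqP <-.
pose h b := psi c b * expR (b ^+ 2 / 2).
have dh (b : R) : is_derive b 1 h 0.
  have := is_derive_psi c b; rewrite ibp => ?.
  rewrite /h; apply: is_derive_eq.
  rewrite /GRing.scale /=; lra.
have h0 : h 0 = cos c.
  rewrite /h expr0n mul0r expR0 mulr1 /psi.
  under eq_Rintegral do rewrite /f mul0r addr0.
  by rewrite RintegralZl// ?e0 ?mulr1//; exact: integrable_normal_pdf.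
rewrite -[LHS]/(psi c a) -h0 -(is_derive_0_is_cst a 0 dh) /h mulNr expRN.
by rewrite mulfK // gt_eqF // expR_gt0.
Qed.

(** A Radon-Nikodym derivative is determined only almost everywhere; it agrees with the density
    because both have the same integral over every measurable set. *)
Lemma integral_normal_prob (h : R -> \bar R) :
    (normal_prob 0 1).-integrable setT h ->
  (\int[normal_prob (0 : R) 1]_x h x = \int[leb]_x (h x * (p x)%:E))%E.
Proof.
move=> inth; have mh := measurable_int _ inth.
rewrite -(Radon_Nikodym_change_of_variables (normal_prob_dominates 0 1))//=.
apply: ae_eq_integral => //.
- apply: emeasurable_funM => //; apply: (measurable_int leb).
  by apply: Radon_Nikodym_integrable; exact: normal_prob_dominates.
- apply: emeasurable_funM => //=; apply/measurable_EFinP.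
  exact: measurable_normal_pdf.
- apply: ae_eqe_mul2l => /=.
  rewrite Radon_NikodymE//=; first exact: normal_prob_dominates.
  move=> dom; case: cid => /= k [h1 h2 h3].
  apply: integral_ae_eq => //=.
  + by apply/measurable_EFinP; exact: measurable_normal_pdf.
  + by move=> E _ mE; rewrite -h3.
Qed.

Lemma integrable_bounded d (T : measurableType d) (mu : probability T R) (h : T -> R) (B : R) :
  measurable_fun setT h -> (forall x, `|h x| <= B) -> mu.-integrable setT (EFin \o h).
Proof.
move=> mh hB; apply: (@le_integrable _ _ _ mu _ measurableT _ (fun=> B%:E)).
- exact/measurable_EFinP.
- move=> x _ /=; rewrite lee_fin; apply: le_trans (hB x) _; exact: ler_norm.
- exact: finite_measure_integrable_cst.
Qed.

Lemma integral_cos_normal_prob (c a : R) :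
  (\int[normal_prob (0 : R) 1]_x (cos (c + a * x))%:E =
    (cos c * expR (- a ^+ 2 / 2))%:E)%E.
Proof.
rewrite integral_normal_prob; last first.
  apply: (@integrable_bounded _ _ (normal_prob (0 : R) 1) (fun x : R => cos (c + a * x)) 1).
    apply: (measurableT_comp (f := @cos R)).
      exact: measurable_cos.
    by apply: measurable_funD => //; apply: measurable_funM.
  by move=> x; exact: cos_norm_le1.
rewrite -Rintegral_cos_normal_pdf /Rintegral fineK //.
  apply: (@integrable_fin_num _ _ _ leb) => //.
apply: integrable_trigo_normal; [exact: continuous_cos|exact: cos_norm_le1].
Qed.

End normal_characteristic_function.

Section gaussian_vectors.
Context {R : realType}.
Let RR := measurableTypeR R.

Lemma measurable_linear_form (n : nat) (a : 'I_n -> R) :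
  measurable_fun setT (fun x : n.-tuple RR => \sum_i a i * tnth x i : R).
Proof.
apply: measurable_sum => i; apply: measurable_funM => //.
exact: measurable_tnth.
Qed.

Lemma integral_standard_gaussianS (n : nat) (f : n.+1.-tuple RR -> R) (B : R) :
    measurable_fun setT f -> (forall x, `|f x| <= B) ->
  (\int[standard_gaussian n.+1]_x (f x)%:E =
   \int[normal_prob (0:R) 1]_x \int[standard_gaussian n]_y (f (cons_pair (x, y)))%:E)%E.
Proof.
move=> mf fB /=; rewrite integral_distribution /=; last 2 first.
- exact/measurable_EFinP.
- apply: (@integrable_bounded _ _ _ _ (f \o @cons_pair R n) B) => [|x]; last exact: fB.
  apply: measurableT_comp => //; exact: measurable_cons_pair.
rewrite -(@integral12_prod_meas1 _ _ _ _ _ _ _ (EFin \o (f \o @cons_pair R n))) //.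
apply: (@integrable_bounded _ _ _ _ (f \o @cons_pair R n) B) => [|x]; last exact: fB.
apply: measurableT_comp => //; exact: measurable_cons_pair.
Qed.

Lemma integral_cos_standard_gaussian (n : nat) (c : R) (a : 'I_n -> R) :
  (\int[standard_gaussian n]_x (cos (c + \sum_i a i * tnth x i))%:E =
   (cos c * expR (- (\sum_i a i ^+ 2) / 2))%:E)%E.
Proof.
have mc m (e : R) (b : 'I_m -> R) : measurable_fun setT
   (fun x : m.-tuple RR => cos (e + \sum_i b i * tnth x i)).
  apply: (measurableT_comp (f := @cos R)).
    exact: measurable_cos.
  by apply: measurable_funD => //; exact: measurable_linear_form.
elim: n c a => [|n IHn] c a.
  under eq_integral do rewrite big_ord0 addr0.
  by rewrite integral_cst//= probability_setT mule1 big_ord0 oppr0 mul0r expR0 mulr1.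
rewrite (@integral_standard_gaussianS _ _ 1) //; last first.
  by move=> x; exact: cos_norm_le1.
transitivity (\int[normal_prob (0:R) 1]_x
  ((expR (- (\sum_(i < n) a (lift ord0 i) ^+ 2) / 2))%:E * (cos (c + a ord0 * x))%:E))%E.
  apply: eq_integral => x _; rewrite -EFinM mulrC.
  rewrite -(IHn (c + a ord0 * x) (fun i => a (lift ord0 i))).
  apply: eq_integral => y _; congr ((cos _)%:E).
  rewrite big_ord_recl addrA; congr (_ + _).
  by apply: eq_bigr => i _; rewrite /cons_pair !(tnth_nth 0).
rewrite integralZl //; last first.
  apply: (@integrable_bounded _ _ _ _ _ 1); last by move=> x; exact: cos_norm_le1.
  apply: (measurableT_comp (f := @cos R)).
    exact: measurable_cos.
  by apply: measurable_funD => //; apply: measurable_funM.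
rewrite integral_cos_normal_prob -EFinM; congr (_%:E).
rewrite big_ord_recl mulrCA -expRD; congr (_ * expR _); lra.
Qed.

End gaussian_vectors.

(** * Zero sets of quadratic polynomials under the Gaussian law *)

Section gaussian_quadratic.
Context {R : realType}.
Let RR := measurableTypeR R.

Lemma normal_prob_set1 (a : R) : normal_prob (0 : R) 1 [set a] = 0%E.
Proof.
apply: (null_content_dominatesP (normal_prob (0:R) 1) (@lebesgue_measure R)).1 => //.
- exact: normal_prob_dominates.
- exact: lebesgue_measure_set1.
Qed.

Lemma normal_prob_set2 (a b : R) : normal_prob (0 : R) 1 [set a; b] = 0%E.
Proof.
apply/eqP; rewrite eq_le measure_ge0 andbT.
apply: le_trans (measureU2 _ _ _) _; [exact: measurable_set1|exact: measurable_set1|].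
have := normal_prob_set1 a; have := normal_prob_set1 b; rewrite /= => -> ->.
by rewrite adde0.
Qed.

(** Linear and constant terms are included because fixing the first coordinate of a quadratic form
    leaves an inhomogeneous polynomial in the others. *)
Definition quadratic_poly n (V : 'I_n -> 'I_n -> R) (b : 'I_n -> R) (c : R)
    (x : n.-tuple RR) : R :=
  \sum_i \sum_j V i j * tnth x i * tnth x j + \sum_i b i * tnth x i + c.

Lemma measurable_quadratic_poly n V b c : measurable_fun setT (@quadratic_poly n V b c).
Proof.
apply: measurable_funD => //; apply: measurable_funD; last exact: measurable_linear_form.
apply: measurable_sum => i; apply: measurable_sum => j.
apply: measurable_funM; last exact: measurable_tnth.
by apply: measurable_funM => //; exact: measurable_tnth.
Qed.

Lemma quadratic_poly_cons n (V : 'I_n.+1 -> 'I_n.+1 -> R) b c (x : RR) (y : n.-tuple RR) :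
  quadratic_poly V b c (cons_pair (x, y)) =
  quadratic_poly (fun i j => V (lift ord0 i) (lift ord0 j))
    (fun i => (V ord0 (lift ord0 i) + V (lift ord0 i) ord0) * x + b (lift ord0 i))
    (V ord0 ord0 * x ^+ 2 + b ord0 * x + c) y.
Proof.
have t0 : tnth (cons_pair (x, y)) ord0 = x by rewrite (tnth_nth 0).
have tS i : tnth (cons_pair (x, y)) (lift ord0 i) = tnth y i.
  by rewrite !(tnth_nth 0).
have E1 : \sum_(i < n) \sum_(j < n.+1) V (lift ord0 i) j *
      tnth (cons_pair (x, y)) (lift ord0 i) * tnth (cons_pair (x, y)) j =
    \sum_(i < n) V (lift ord0 i) ord0 * tnth y i * x +
    \sum_(i < n) \sum_(j < n) V (lift ord0 i) (lift ord0 j) * tnth y i * tnth y j.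
  rewrite -big_split; apply: eq_bigr => i _; rewrite big_ord_recl t0 tS; congr (_ + _).
  by apply: eq_bigr => j _; rewrite tS.
have E2 : \sum_(i < n) ((V ord0 (lift ord0 i) + V (lift ord0 i) ord0) * x +
      b (lift ord0 i)) * tnth y i =
    \sum_(i < n) V ord0 (lift ord0 i) * x * tnth y i +
    \sum_(i < n) V (lift ord0 i) ord0 * tnth y i * x +
    \sum_(i < n) b (lift ord0 i) * tnth y i.
  by rewrite -!big_split; apply: eq_bigr => i _ /=; ring.
have E3 : \sum_(i < n) b (lift ord0 i) * tnth (cons_pair (x, y)) (lift ord0 i) =
    \sum_(i < n) b (lift ord0 i) * tnth y i.
  by apply: eq_bigr => i _; rewrite tS.
rewrite /quadratic_poly [in LHS]big_ord_recl E1 E2 ![in LHS]big_ord_recl !t0.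
under eq_bigr do rewrite tS.
rewrite E3; ring.
Qed.

Lemma quadratic_poly_roots (a b c : R) : (a != 0) || (b != 0) ->
  exists r s : R, forall x, a * x ^+ 2 + b * x + c = 0 -> x = r \/ x = s.
Proof.
have [->|a0] := eqVneq a 0 => /= [b0|_].
  exists (- c / b), (- c / b) => x; rewrite mul0r add0r => /eqP.
  by rewrite addr_eq0 => /eqP bx; left; rewrite -bx mulrAC mulfV// mul1r.
have [[r rE]|nr] := pselect (exists r, a * r ^+ 2 + b * r + c = 0); last first.
  by exists 0, 0 => x xE; case: nr; exists x.
(* The second root comes from the sum [- b / a] of the two roots, so no discriminant is involved. *)
exists r, (- (b / a) - r) => x xE.
have /eqP : a * ((x - r) * (x - (- (b / a) - r))) = 0.
  transitivity ((a * x ^+ 2 + b * x + c) - (a * r ^+ 2 + b * r + c)); first by field.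
  by rewrite xE rE subrr.
rewrite mulf_eq0 (negbTE a0) /= mulf_eq0 !subr_eq0 => /orP[/eqP|/eqP]; by [left|right].
Qed.

(** Induction on the dimension with Fubini's theorem. As [V] need not be symmetric, the quadratic
    part is nonzero exactly when some [V i j + V j i] is. *)
Lemma quadratic_poly_null n V b c :
    (exists i j, V i j + V j i != 0) \/ (exists i, b i != 0) ->
  standard_gaussian n [set x | quadratic_poly V b c x = 0] = 0%E.
Proof.
elim: n V b c => [|n IH] V b c Vb.
  by case: Vb => [[[]]|[[]]].
have mS m W e k : measurable [set x | @quadratic_poly m W e k x = 0].
  rewrite -[X in measurable X]setTI.
  exact: (measurable_quadratic_poly W e k measurableT (measurable_set1 0)).
rewrite /= /distribution /pushforward /product_measure1 /=.
pose W i j := V (lift ord0 i) (lift ord0 j).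
pose e x i : R := (V ord0 (lift ord0 i) + V (lift ord0 i) ord0) * x + b (lift ord0 i).
pose k x : R := V ord0 ord0 * x ^+ 2 + b ord0 * x + c.
have secE (x : RR) : xsection (@cons_pair R n @^-1` [set x | quadratic_poly V b c x = 0]) x =
    [set y | quadratic_poly W (e x) (k x) y = 0].
  apply/seteqP; split => y; rewrite /xsection /= inE /=.
    by rewrite quadratic_poly_cons.
  by rewrite quadratic_poly_cons.
(* Outside two values of the first coordinate, the section is the zero set of a
   nonzero quadratic polynomial or is empty. *)
have [r [s rs]] : exists r s : R, forall x, x <> r -> x <> s ->
    standard_gaussian n [set y | quadratic_poly W (e x) (k x) y = 0] = 0%E.
  have [[i [j Wij]]|nW] := pselect (exists i j, W i j + W j i != 0).
    by exists 0, 0 => x _ _; apply: IH; left; exists i, j.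
  have [[i Vi]|nV] := pselect (exists i, V ord0 (lift ord0 i) + V (lift ord0 i) ord0 != 0).
    exists (- b (lift ord0 i) / (V ord0 (lift ord0 i) + V (lift ord0 i) ord0)), 0 => x xr _.
    apply: IH; right; exists i; apply/eqP => /eqP; rewrite addr_eq0 => /eqP ex.
    by apply: xr; rewrite -ex mulrAC mulfV// mul1r.
  have eE x i : e x i = b (lift ord0 i).
    rewrite /e (_ : V _ _ + V _ _ = 0) ?mul0r ?add0r//.
    by apply: contrapT => /eqP H; apply: nV; exists i.
  have [[i bi]|nb] := pselect (exists i, b (lift ord0 i) != 0).
    by exists 0, 0 => x _ _; apply: IH; right; exists i; rewrite eE.
  have [|r [s rs]] := @quadratic_poly_roots (V ord0 ord0) (b ord0) c.
    case: Vb => [[i [j Vij]]|[i bi]].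
      case: (unliftP ord0 i) Vij => [i' ->|->]; case: (unliftP ord0 j) => [j' ->|->] Vij.
      - by case: nW; exists i', j'.
      - by case: nV; exists i'; rewrite addrC.
      - by case: nV; exists j'.
      - by apply/orP; left; apply: contraNneq Vij => ->; rewrite addr0.
    case: (unliftP ord0 i) bi => [i' ->|->] bi; last by apply/orP; right.
    by case: nb; exists i'.
  exists r, s => x xr xs; rewrite (_ : mkset _ = set0) ?measure0//.
  apply/seteqP; split => // y /=; rewrite /quadratic_poly.
  rewrite [\sum_i e x i * _]big1; last first.
    move=> i _; rewrite eE (_ : b _ = 0) ?mul0r//.
    by apply: contrapT => /eqP H; apply: nb; exists i.
  (* In this case [W] is antisymmetric, so exchanging the indices shows that the double sum is its
     own opposite. *)
  have -> : \sum_i \sum_j W i j * tnth y i * tnth y j = 0.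
    set w := \sum_i _; have : w + w = 0.
      rewrite {2}/w exchange_big -big_split big1// => i _ /=.
      rewrite -big_split big1// => j _ /=.
      rewrite (_ : W j i = - W i j); first ring.
      apply/eqP; rewrite -addr_eq0 addrC; apply/eqP.
      by apply: contrapT => /eqP H; apply: nW; exists i, j.
    lra.
  by rewrite !add0r => /rs[].
rewrite (@ae_eq_integral _ _ _ (normal_prob (0:R) 1) setT (cst 0%E)).
- by rewrite integral_cst// mul0e.
- exact: measurableT.
- apply: measurable_fun_xsection.
  rewrite -[X in measurable X]setTI; exact: (measurable_cons_pair measurableT (mS _ _ _ _)).
- exact: measurable_cst.
- exists [set r; s]; split.
  + by apply: measurableU; exact: measurable_set1.
  + exact: normal_prob_set2.
  + move=> x /= H; apply: contrapT => /not_orP[xr xs]; apply: H => _.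
    by rewrite /= secE rs.
Qed.

End gaussian_quadratic.

(** * Distribution functions and quantiles of Gaussian quadratic forms *)

Section chi2G_cdf.
Context {R : realType} (n : nat).
Let RR := measurableTypeR R.
Local Notation gam := (@standard_gaussian R n).
Implicit Types (V W : 'M[R]_n) (x : n.-tuple RR).

Lemma quadratic_formE V x : quadratic_form V x =
  \sum_i \sum_j V i j * tnth x i * tnth x j.
Proof.
rewrite /quadratic_form mxE.
under eq_bigr do rewrite !mxE mulr_suml.
rewrite exchange_big; apply: eq_bigr => i _; apply: eq_bigr => j _.
by rewrite !mxE; ring.
Qed.

Lemma quadratic_formB V W x : quadratic_form V x - quadratic_form W x = quadratic_form (V - W) x.
Proof.
rewrite !quadratic_formE -sumrB; apply: eq_bigr => i _; rewrite -sumrB.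
by apply: eq_bigr => j _; rewrite !mxE; ring.
Qed.

Definition sqr_norm x : R := \sum_i tnth x i ^+ 2.

Lemma quadratic_form_bound V x (C : R) : (forall i j, `|V i j| <= C) ->
  `|quadratic_form V x| <= C * n%:R * sqr_norm x.
Proof.
move=> VC; rewrite quadratic_formE; apply: le_trans (ler_norm_sum _ _ _) _.
have -> : C * n%:R * sqr_norm x =
    \sum_(i < n) \sum_(j < n) C * (tnth x i ^+ 2 / 2 + tnth x j ^+ 2 / 2).
  under eq_bigr do rewrite -mulr_sumr big_split /= sumr_const card_ord.
  rewrite -mulr_sumr big_split /= sumr_const card_ord -mulr_suml -/(sqr_norm x).
  rewrite sumrMnl -mulr_suml -/(sqr_norm x) -[sqr_norm x / 2 *+ n]mulr_natl.
  by field.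
apply: ler_sum => i _; apply: le_trans (ler_norm_sum _ _ _) _.
apply: ler_sum => j _; rewrite -mulrA normrM ler_pM// normrM.
have := sqr_ge0 (`|tnth x i| - `|tnth x j|).
by rewrite sqrrB !real_normK ?num_real//; lra.
Qed.

Lemma measurable_sqr_norm : measurable_fun setT (sqr_norm : n.-tuple RR -> R).
Proof.
apply: measurable_sum => i; apply: measurable_funX; exact: measurable_tnth.
Qed.

Let measurable_le (f : n.-tuple RR -> R) t : measurable_fun setT f ->
  measurable [set x | f x <= t].
Proof.
move=> mf; have : measurable (setT `&` f @^-1` `]-oo, t]) by apply: mf.
by rewrite setTI; congr measurable; apply/seteqP; split => x /=; rewrite in_itv.
Qed.

Let measurable_lt (f : n.-tuple RR -> R) t : measurable_fun setT f ->
  measurable [set x | t < f x].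
Proof.
move=> mf; have : measurable (setT `&` f @^-1` `]t, +oo[) by apply: mf.
by rewrite setTI; congr measurable; apply/seteqP; split => x /=; rewrite in_itv /= andbT.
Qed.

Lemma sqr_norm_tight (eta : R) : 0 < eta ->
  exists2 K : R, 0 < K & fine (gam [set x | K < sqr_norm x]) <= eta.
Proof.
move=> eta0; pose F k : set (n.-tuple RR) := [set x | k%:R < sqr_norm x].
have mF k : measurable (F k) by apply: measurable_lt; exact: measurable_sqr_norm.
have : gam (F k) @[k --> \oo] --> gam (\bigcap_k F k).
  apply: nonincreasing_cvg_mu => //.
  - by rewrite ltey_eq fin_num_measure.
  - exact: bigcapT_measurable.
  - move=> a b ab; apply/subsetPset => x /=; apply: le_lt_trans.
    by rewrite ler_nat.
rewrite (_ : \bigcap_k F k = set0) ?measure0; last first.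
  apply/seteqP; split => // x H; have := H (Num.truncn (sqr_norm x)).+1 I.
  by rewrite /F /= ltNge ltW// truncnS_gt.
move/fine_cvg => /cvgrPdist_le/(_ eta eta0)[k _ /(_ k (leqnn k))].
rewrite /= sub0r normrN ger0_norm ?fine_ge0// => Hk.
exists k.+1%:R => //; apply: le_trans Hk; apply: fine_le; rewrite ?fin_num_measure//.
  by apply: measurable_lt; exact: measurable_sqr_norm.
apply: le_measure; rewrite ?inE//; first by apply: measurable_lt; exact: measurable_sqr_norm.
by move=> x /=; apply: lt_trans; rewrite ltr_nat.
Qed.

Definition chi2G_cdf V (t : R) : R := fine (gam [set x | quadratic_form V x <= t]).

Lemma chi2G_cdfE V t : chi2G V [set` `]-oo, t]%R] = (chi2G_cdf V t)%:E.
Proof.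
rewrite /chi2G_cdf fineK; last first.
  by apply: fin_num_measure; apply: measurable_le; exact: measurable_quadratic_form.
by rewrite /chi2G /distribution /pushforward; congr (gam _);
  apply/seteqP; split => x /=; rewrite in_itv.
Qed.

Let mq V t : measurable [set x | quadratic_form V x <= t].
Proof. by apply: measurable_le; exact: measurable_quadratic_form. Qed.

Let mtail K : measurable [set x : n.-tuple RR | K < sqr_norm x].
Proof. by apply: measurable_lt; exact: measurable_sqr_norm. Qed.

Let le_fine (A B : set (n.-tuple RR)) : measurable A -> measurable B -> A `<=` B ->
  fine (gam A) <= fine (gam B).
Proof.
move=> mA mB AB; apply: fine_le; rewrite ?fin_num_measure//.
by apply: le_measure => //; rewrite inE.
Qed.

Let le_fineU (A B C : set (n.-tuple RR)) : measurable A -> measurable B -> measurable C ->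
  A `<=` B `|` C -> fine (gam A) <= fine (gam B) + fine (gam C).
Proof.
move=> mA mB mC ABC; apply: le_trans (le_fine mA (measurableU _ _ mB mC) ABC) _.
rewrite -lee_fin EFinD !fineK ?fin_num_measure//; last exact: measurableU.
exact: measureU2.
Qed.

Let cvg_fine (A : (set (n.-tuple RR))^nat) (B : set (n.-tuple RR)) : measurable B ->
  gam (A k) @[k --> \oo] --> gam B -> fine (gam (A k)) @[k --> \oo] --> fine (gam B).
Proof. by move=> mB H; apply: fine_cvg; rewrite fineK ?fin_num_measure. Qed.

Lemma chi2G_cdf_mono V t u : t <= u -> chi2G_cdf V t <= chi2G_cdf V u.
Proof.
move=> tu; apply: le_fine => // x /= /le_trans; exact.
Qed.

(** On a ball that carries all but [eta] of the Gaussian mass, close matrices have quadratic forms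
    within [u - t] of each other. The gap between the two thresholds absorbs this difference, and
    [eta] absorbs the tail. *)
Lemma chi2G_cdf_perturb W t u (eta : R) : t < u -> 0 < eta ->
  exists2 dl : R, 0 < dl & forall V, (forall i j, `|V i j - W i j| <= dl) ->
    chi2G_cdf W t - eta <= chi2G_cdf V u /\ chi2G_cdf V t <= chi2G_cdf W u + eta.
Proof.
move=> tu eta0; have [K K0 hK] := sqr_norm_tight eta0.
(* [n.+1] rather than [n], so that [D] is positive also in dimension 0. *)
pose D := n.+1%:R * K.
have D0 : 0 < D by rewrite mulr_gt0.
exists ((u - t) / D) => [|V VW]; first by rewrite divr_gt0// subr_gt0.
have close x : sqr_norm x <= K -> `|quadratic_form V x - quadratic_form W x| <= u - t.
  move=> xK; rewrite quadratic_formB.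
  have := @quadratic_form_bound (V - W) x ((u - t) / D); rewrite -mulrA => H.
  apply: le_trans (H _) _; first by move=> i j; rewrite !mxE.
  rewrite mulrAC ler_pdivrMr// ler_wpM2l//; first by rewrite subr_ge0 ltW.
  by rewrite /D ler_pM// ?ler_nat// sumr_ge0// => i _; exact: sqr_ge0.
split.
  rewrite lerBlDr; apply: le_trans (_ : _ <= chi2G_cdf V u + fine (gam [set x | K < sqr_norm x])) _.
    apply: le_fineU => // x /= xt; have [xK|xK] := leP (sqr_norm x) K; last by right.
    by left; have := close x xK; rewrite ler_norml => /andP[_]; lra.
  by rewrite lerD2l.
apply: le_trans (_ : _ <= chi2G_cdf W u + fine (gam [set x | K < sqr_norm x])) _.
  apply: le_fineU => // x /= xt; have [xK|xK] := leP (sqr_norm x) K; last by right.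
  by left; have := close x xK; rewrite ler_norml => /andP[+ _]; lra.
by rewrite lerD2l.
Qed.

(** The bound [B] is uniform over all matrices with entries at most [C], which is what bounds a
    quantile computed from a random matrix. The shift in [- B - 1] excludes equality with [- B], so
    that the lower event lies entirely in the tail. *)
Lemma chi2G_cdf_bounded (C eta : R) : 0 < eta -> 0 <= C ->
  exists2 B : R, 0 <= B & forall V, (forall i j, `|V i j| <= C) ->
    1 - eta <= chi2G_cdf V B /\ chi2G_cdf V (- B - 1) <= eta.
Proof.
move=> eta0 C0; have [K K0 hK] := sqr_norm_tight eta0.
exists (C * n%:R * K) => [|V VC]; first by rewrite !mulr_ge0// ltW.
have bd x : sqr_norm x <= K -> `|quadratic_form V x| <= C * n%:R * K.
  move=> xK; apply: le_trans (quadratic_form_bound x VC) _.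
  by rewrite ler_wpM2l// mulr_ge0.
split.
  rewrite lerBlDr; apply: (@le_trans _ _ (fine (gam setT))); first by rewrite probability_setT.
  apply: le_trans (_ : _ <= chi2G_cdf V (C * n%:R * K) + fine (gam [set x | K < sqr_norm x])) _.
    apply: le_fineU => // x /= _; have [xK|xK] := leP (sqr_norm x) K; last by right.
    by left; apply: le_trans (bd x xK); exact: ler_norm.
  by rewrite lerD2l.
apply: le_trans hK; apply: le_fine => // x /= xt; rewrite ltNge; apply/negP => xK.
have := bd x xK; rewrite ler_norml => /andP[+ _]; lra.
Qed.

Lemma quantile_chi2G_itv V p a b : chi2G_cdf V a < p -> p <= chi2G_cdf V b ->
  a <= quantile (chi2G V) p <= b.
Proof.
move=> ap pb; rewrite /quantile.
set S := mkset _.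
have SE t : S t <-> p <= chi2G_cdf V t by rewrite /S /= chi2G_cdfE lee_fin.
have lbS : lbound S a.
  move=> t /SE pt; rewrite leNgt; apply/negP => ta.
  by have := lt_le_trans ap (le_trans pt (chi2G_cdf_mono V (ltW ta))); rewrite ltxx.
apply/andP; split.
  by apply: lb_le_inf => //; exists b; apply/SE.
by apply: ge_inf; [exists a|apply/SE].
Qed.

Lemma chi2G_no_atom W t : W^T = W -> W != 0 ->
  gam [set x | quadratic_form W x = t] = 0%E.
Proof.
move=> Wsym W0; rewrite (_ : mkset _ =
    [set x | quadratic_poly (fun i j => W i j) (fun=> 0) (- t) x = 0]); last first.
  apply/seteqP; split => x /=; rewrite quadratic_formE /quadratic_poly;
    rewrite [X in _ + X - _]big1 ?addr0; try by move=> i _; rewrite mul0r.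
    by move=> ->; rewrite subrr.
  by move/eqP; rewrite subr_eq0 => /eqP.
apply: quadratic_poly_null; left; apply: contrapT => nW; move/eqP: W0; apply.
apply/matrixP => i j; rewrite mxE; apply: contrapT => /eqP Wij; apply: nW.
exists i, j; have -> : W j i = W i j by rewrite -[in LHS]Wsym mxE.
by rewrite -mulr2n mulrn_eq0.
Qed.

(** The witness is the generalized inverse [t = inf S]. Continuity from below gives mass at most [p]
    to the values strictly less than [t], and the absence of atoms extends this to [t]; continuity
    from above gives the reverse inequality. *)
Lemma chi2G_cdf_surj W p : W^T = W -> W != 0 -> 0 < p < 1 ->
  exists t, chi2G_cdf W t = p.
Proof.
move=> Wsym W0 /andP[p0 p1].
(* The bound [1 - p] puts [B] in the set [S]; the bound [p / 2], strictly below [p], makes [- B - 1]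
   a lower bound of [S]. *)
have [||B B0 HB] := @chi2G_cdf_bounded (\sum_i \sum_j `|W i j|) (Num.min (p / 2) (1 - p)).
- by rewrite lt_min subr_gt0 p1 andbT; lra.
- by apply: sumr_ge0 => i _; exact: sumr_ge0.
have [|b1 b2] := HB W.
  move=> i j; rewrite (bigD1 i)//= (bigD1 j)//= -addrA lerDl addr_ge0 ?sumr_ge0// => k _.
  exact: sumr_ge0.
pose S := [set t | p <= chi2G_cdf W t].
have SB : S B.
  by apply: le_trans b1; rewrite lerBrDl -lerBrDr ge_min lexx orbT.
have lbS : lbound S (- B - 1).
  move=> t /= pt; rewrite leNgt; apply/negP => /ltW/(chi2G_cdf_mono W) H.
  have : p <= p / 2.
    apply: le_trans pt (le_trans H (le_trans b2 _)).
    by rewrite ge_min lexx.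
  lra.
have hinf : has_inf S by split; [exists B|exists (- B - 1)].
pose t := inf S; exists t; apply/eqP; rewrite eq_le; apply/andP; split.
  have : gam [set x | quadratic_form W x <= t - k.+1%:R^-1] @[k --> \oo] -->
     gam (\bigcup_k [set x | quadratic_form W x <= t - k.+1%:R^-1]).
    apply: nondecreasing_cvg_mu => //; first exact: bigcupT_measurable.
    move=> k l kl; apply/subsetPset => x /= /le_trans; apply.
    by rewrite lerD2l lerN2 lef_pV2 ?posrE// ler_nat.
  have -> : \bigcup_k [set x | quadratic_form W x <= t - k.+1%:R^-1] =
      [set x | quadratic_form W x < t].
    apply/seteqP; split => x /=.
      by move=> [k _ /= /le_lt_trans]; apply; rewrite ltrBlDr ltrDl.
    move=> xt; have e0 : 0 < t - quadratic_form W x by rewrite subr_gt0.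
    exists (Num.truncn ((t - quadratic_form W x)^-1)) => //=.
    rewrite lerBrDl -lerBrDr -[leRHS]invrK lef_pV2 ?posrE ?invr_gt0//.
    by rewrite ltW// truncnS_gt.
  have mlt : measurable [set x | quadratic_form W x < t].
    rewrite (_ : mkset _ = ~` [set x | t <= quadratic_form W x]).
      apply: measurableC; rewrite (_ : mkset _ =
        [set x | (fun x => - quadratic_form W x) x <= - t]).
        by apply: measurable_le; apply: measurable_funN; exact: measurable_quadratic_form.
      by apply/seteqP; split => x /=; rewrite lerN2.
    by apply/seteqP; split => x /=; rewrite ltNge => /negP.
  move/(cvg_fine mlt) => cv.
  have Hlt : fine (gam [set x | quadratic_form W x < t]) <= p.
    apply: (@cvgr_to_le _ _ _ _ _ _ _ cv); apply: nearW => k /=.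
    rewrite ltW// ltNge; apply/negP => pS.
    have : t <= t - k.+1%:R^-1 by apply: ge_inf => //; exists (- B - 1).
    by rewrite lerBrDl gerDr leNgt invr_gt0 ltr0n.
  apply: le_trans Hlt; rewrite -[leRHS]addr0 -[X in _ + X](congr1 fine (chi2G_no_atom t Wsym W0)).
  have meq : measurable [set x | quadratic_form W x = t].
    have := @measurable_quadratic_form R n W measurableT _ (measurable_set1 t).
    by rewrite setTI.
  apply: le_fineU => // x /=; rewrite le_eqVlt => /predU1P[->|]; [by right|by left].
have : gam [set x | quadratic_form W x <= t + k.+1%:R^-1] @[k --> \oo] -->
   gam (\bigcap_k [set x | quadratic_form W x <= t + k.+1%:R^-1]).
  apply: nonincreasing_cvg_mu => //.
  - by rewrite ltey_eq fin_num_measure.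
  - exact: bigcapT_measurable.
  - move=> k l kl; apply/subsetPset => x /= /le_trans; apply.
    by rewrite lerD2l lef_pV2 ?posrE// ler_nat.
have -> : \bigcap_k [set x | quadratic_form W x <= t + k.+1%:R^-1] =
    [set x | quadratic_form W x <= t].
  apply/seteqP; split => x /=; last first.
    by move=> xt k _ /=; apply: le_trans xt _; rewrite lerDl.
  move=> H; rewrite leNgt; apply/negP => xt.
  have e0 : 0 < quadratic_form W x - t by rewrite subr_gt0.
  have := H (Num.truncn ((quadratic_form W x - t)^-1)) I.
  rewrite /= -lerBlDl leNgt => /negP; apply.
  by rewrite -[ltRHS]invrK ltf_pV2 ?posrE ?invr_gt0// truncnS_gt.
move/(cvg_fine (mq W t)) => cv; apply: (@cvgr_to_ge _ _ _ _ _ _ _ cv); apply: nearW => k /=.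
have [|s Ss st] := @inf_adherent R S k.+1%:R^-1 _ hinf; first by rewrite invr_gt0.
apply: le_trans Ss _; apply: chi2G_cdf_mono; exact: ltW.
Qed.

End chi2G_cdf.

(** * From Laplace transforms to tail probabilities *)

Section laplace_threshold.
Context {R : realType}.

(* Gumbel approximation of a threshold: [(1 - exp (- K s)) ^ m] with [m] of order
   [exp (K a)] goes to [0] for [s < a] and to [1] for [s > a]. *)
Lemma exp_threshold (t u eta : R) : 0 <= t -> t < u -> 0 < eta ->
  exists K : R, exists m : nat, [/\ 0 < K,
    (forall s, 0 <= s -> 0 <= (1 - expR (- (K * s))) ^+ m <= 1),
    (forall s, u <= s -> 1 - eta <= (1 - expR (- (K * s))) ^+ m) &
    (forall s, 0 <= s -> s <= t -> (1 - expR (- (K * s))) ^+ m <= eta)].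
Proof.
move=> t0 tu eta0; pose a := (t + u) / 2; pose dl := (u - t) / 2.
have dl0 : 0 < dl by rewrite /dl; lra.
have a0 : 0 <= a by rewrite /a; lra.
(* Since [exp (K dl) >= K dl = 2 / eta], one gets [exp (- K dl) <= eta / 2]. Above [u], Bernoulli's
   inequality loses at most [m exp (- K u) <= 2 exp (- K dl) <= eta]. Below [t], the power is at
   most [exp (- exp (K dl)) <= exp (- K dl)]. *)
pose K := 2 / (eta * dl).
have K0 : 0 < K by rewrite /K divr_gt0// mulr_gt0.
pose m := (Num.truncn (expR (K * a))).+1.
have e1 : 1 <= expR (K * a) by rewrite -expR0 ler_expR mulr_ge0// ltW.
have [m1 m2] : expR (K * a) <= m%:R /\ m%:R <= 2 * expR (K * a).
  have /truncn_itv/andP[tr1 tr2] : 0 <= expR (K * a) by exact: expR_ge0.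
  by split; [exact: ltW|rewrite /m -natr1; lra].
have Kdl : expR (- (K * dl)) <= eta / 2.
  rewrite expRN -[leRHS]invrK lef_pV2 ?posrE ?expR_gt0 ?invr_gt0 ?divr_gt0//.
  apply: le_trans (expR_ge1Dx _); rewrite invf_div /K.
  rewrite (_ : 2 / (eta * dl) * dl = 2 / eta); first lra.
  by field; rewrite !gt_eqF.
have q01 s : 0 <= s -> 0 <= 1 - expR (- (K * s)) <= 1.
  move=> s0; rewrite subr_ge0 expR_le1 oppr_le0 mulr_ge0 ?(ltW K0)//=.
exists K, m; split => //.
- by move=> s /q01/andP[q0 q1]; rewrite exprn_ge0//= exprn_ile1.
- move=> s us; have s0 : 0 <= s by lra.
  have /andP[q0 q1] := q01 s s0.
  have bern n (x : R) : 0 <= x <= 1 -> 1 - n%:R * x <= (1 - x) ^+ n.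
    move=> /andP[x0 x1]; elim: n => [|n IH]; first by rewrite mul0r subr0 expr0.
    rewrite exprS -natr1; apply: le_trans (ler_wpM2l _ IH); last by rewrite subr_ge0.
    have : 0 <= n%:R * x * x by rewrite !mulr_ge0.
    lra.
  apply: le_trans (bern _ _ _); last by rewrite expR_ge0/=; lra.
  rewrite lerD2l lerN2.
  apply: (@le_trans _ _ (2 * expR (K * a) * expR (- (K * u)))).
    by rewrite ler_pM// ?expR_ge0// ler_expR lerN2 ler_pM2l.
  rewrite -mulrA -expRD (_ : K * a + - (K * u) = - (K * dl)); last by rewrite /a /dl; lra.
  lra.
- move=> s s0 st; have /andP[q0 q1] := q01 s s0.
  apply: (@le_trans _ _ (expR (- expR (- (K * s))) ^+ m)).
    rewrite lerXn2r ?nnegrE ?expR_ge0//; exact: expR_ge1Dx.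
  rewrite -expRM_natr mulNr.
  apply: (@le_trans _ _ (expR (- expR (K * dl)))).
    rewrite ler_expR lerN2 [leRHS]mulrC.
    apply: (@le_trans _ _ (expR (K * a) * expR (- (K * s)))); last first.
      by rewrite ler_wpM2r ?expR_ge0.
    rewrite -expRD ler_expR -mulrN -mulrDr ler_pM2l// /a /dl; lra.
  apply: (@le_trans _ _ (expR (- (K * dl)))); last lra.
  rewrite ler_expR lerN2; apply: le_trans (expR_ge1Dx _); lra.
Qed.

End laplace_threshold.

(** The functionals [E n] are only assumed monotone, linear and normalized, so they can be finite
    sums over paths, while the limit law is a probability measure on another space. *)
Section laplace_convergence.
Context {R : realType} (T : Type) (E : nat -> (T -> R) -> R).
Hypothesis E_le : forall n f g, (forall x, f x <= g x) -> E n f <= E n g.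
Hypothesis E_lin : forall n f g (a : R), E n (fun x => f x + a * g x) = E n f + a * E n g.
Hypothesis E_cst : forall n a, E n (fun=> a) = a.
Context d (U : measurableType d) (mu : probability U R) (q : U -> R).
Hypothesis mq : measurable_fun setT q.
Hypothesis q_ge0 : forall x, 0 <= q x.
Variable S : nat -> T -> R.
Hypothesis S_ge0 : forall n x, 0 <= S n x.
Hypothesis laplace_cvg : forall la : R, 0 <= la ->
  E n (fun x => expR (- (la * S n x))) @[n --> \oo] -->
  (\int[mu]_x expR (- (la * q x)))%R.

Let integrable_bd (h : U -> R) (B : R) :
  measurable_fun setT h -> (forall x, `|h x| <= B) -> mu.-integrable setT (EFin \o h).
Proof. exact: integrable_bounded. Qed.

Let indic01 (A : set U) x : 0 <= (\1_A x : R) <= 1.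
Proof. by rewrite indicE; case: (_ \in _); rewrite ?lexx ?ler01. Qed.

Let mexp la : measurable_fun setT (fun x => expR (- (la * q x))).
Proof.
apply: measurableT_comp => //; apply: measurableT_comp => //.
by apply: measurable_funM.
Qed.

Let exp01 (la s : R) : 0 <= la -> 0 <= s -> 0 <= expR (- (la * s)) <= 1.
Proof. by move=> la0 s0; rewrite expR_ge0 expR_le1 oppr_le0 mulr_ge0. Qed.

(** Induction on [m], splitting off one factor [1 - exp (- K s)] at a time; the second term so
    produced carries one more exponential, hence the generality in [j]. *)
Let poly_cvg (K : R) m j : 0 <= K ->
  E n (fun x => expR (- (j%:R * K * S n x)) * (1 - expR (- (K * S n x))) ^+ m) @[n --> \oo] -->
  (\int[mu]_x (expR (- (j%:R * K * q x)) * (1 - expR (- (K * q x))) ^+ m))%R.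
Proof.
move=> K0; elim: m j => [|m IH] j.
  under eq_fun do under eq_fun do rewrite expr0 mulr1.
  under eq_Rintegral do rewrite expr0 mulr1.
  by apply: laplace_cvg; rewrite mulr_ge0.
have step (s : R) : expR (- (j%:R * K * s)) * (1 - expR (- (K * s))) ^+ m.+1 =
   expR (- (j%:R * K * s)) * (1 - expR (- (K * s))) ^+ m +
   -1 * (expR (- (j.+1%:R * K * s)) * (1 - expR (- (K * s))) ^+ m).
  have -> : expR (- (j.+1%:R * K * s)) = expR (- (j%:R * K * s)) * expR (- (K * s)).
    by rewrite -expRD -natr1; congr expR; ring.
  rewrite exprS; ring.
rewrite (_ : (fun n => E n _) = fun n =>
    E n (fun x => expR (- (j%:R * K * S n x)) * (1 - expR (- (K * S n x))) ^+ m) +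
    -1 * E n (fun x => expR (- (j.+1%:R * K * S n x)) * (1 - expR (- (K * S n x))) ^+ m));
  last first.
  apply/funext => n; rewrite -E_lin; congr (E n); apply/funext => x; exact: step.
under eq_Rintegral do rewrite step.
have int i : mu.-integrable setT
    (EFin \o (fun x => expR (- (i%:R * K * q x)) * (1 - expR (- (K * q x))) ^+ m)).
  apply: (integrable_bd (B := 1)).
    apply: measurable_funM; first exact: mexp.
    by apply: measurable_funX; apply: measurable_funB.
  move=> x; have /andP[a0 a1] := @exp01 (i%:R * K) (q x) (mulr_ge0 (ler0n _ _) K0) (q_ge0 x).
  have /andP[b0 b1] := @exp01 K (q x) K0 (q_ge0 x).
  rewrite ger0_norm; last by rewrite mulr_ge0// exprn_ge0// subr_ge0.
  by rewrite mulr_ile1// ?exprn_ge0 ?exprn_ile1 ?subr_ge0// gerBl.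
rewrite RintegralD//; last first.
  rewrite (_ : EFin \o _ = fun x =>
    ((-1)%:E * (expR (- (j.+1%:R * K * q x)) * (1 - expR (- (K * q x))) ^+ m)%:E)%E)//.
  by apply: integrableZl => //; exact: int.
rewrite RintegralZl; [|by []|exact: int].
by apply: cvgD => //; apply: cvgMr.
Qed.

Let cvg_pow (K : R) m : 0 <= K ->
  E n (fun x => (1 - expR (- (K * S n x))) ^+ m) @[n --> \oo] -->
  (\int[mu]_x ((1 - expR (- (K * q x))) ^+ m))%R.
Proof.
move=> K0; have := @poly_cvg K m 0 K0.
under eq_fun do under eq_fun do rewrite !mul0r oppr0 expR0 mul1r.
by under eq_Rintegral do rewrite !mul0r oppr0 expR0 mul1r.
Qed.

Let tail (t : R) := fine (mu [set x | t < q x]).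

Let m_tail t : measurable [set x | t < q x].
Proof.
have : measurable (setT `&` q @^-1` `]t, +oo[) by apply: mq.
by rewrite setTI; congr measurable; apply/seteqP; split => x /=; rewrite in_itv /= andbT.
Qed.

Let pow_meas K m : measurable_fun setT (fun x => (1 - expR (- (K * q x))) ^+ m).
Proof. by apply: measurable_funX; apply: measurable_funB. Qed.

Let Rint_indic t : (\int[mu]_x (\1_[set x | t < q x] x : R))%R = tail t.
Proof. by rewrite /Rintegral integral_indic ?setIT//; exact: m_tail. Qed.

(** The power given by [exp_threshold] lies between the indicators of the two tails, up to [eta / 3]
    on each side; the last third is spent on the convergence of its mean. Lowering the threshold
    from [u] to [t] replaces continuity of the limit law. *)
Lemma laplace_tail_le (t u eta : R) : 0 <= t -> t < u -> 0 < eta ->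
  \forall n \near \oo, E n (fun x => (u < S n x)%R%:R) <= tail t + eta.
Proof.
move=> t0 tu eta0.
have [|K [m [K0 p01 pu pt]]] := @exp_threshold R t u (eta / 3) t0 tu; first lra.
have int : mu.-integrable setT (EFin \o (fun x => (1 - expR (- (K * q x))) ^+ m)).
  apply: (integrable_bd (B := 1)) => // x.
  by have /andP[a b] := p01 _ (q_ge0 x); rewrite ger0_norm.
have intI : mu.-integrable setT (EFin \o (fun x => \1_[set x | t < q x] x + cst (eta / 3) x)).
  apply: (integrable_bd (B := 1 + eta / 3)).
    by apply: measurable_funD.
  move=> x; have /andP[i0 i1] := indic01 [set x | t < q x] x.
  by rewrite /cst ler_norml; lra.
have bound : (\int[mu]_x ((1 - expR (- (K * q x))) ^+ m) <= tail t + eta / 3)%R.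
  apply: (@le_trans _ _ (\int[mu]_x (\1_[set x | t < q x] x + cst (eta / 3) x))%R).
    apply: le_Rintegral => // x _ /=; rewrite indicE.
    have [tq|qt] := ltP t (q x).
      by rewrite mem_set//=; have /andP[_] := p01 _ (q_ge0 x); rewrite mulr1n; lra.
    rewrite memNset /=; last by rewrite ltNge qt.
    by rewrite add0r pt.
  rewrite RintegralD//; last 2 first.
  - apply: (integrable_bd (B := 1)) => // x.
    by rewrite indicE; case: (_ \in _); rewrite ?normr0 ?normr1.
  - by apply: (integrable_bd (B := eta / 3)) => // x; rewrite /cst ger0_norm//; lra.
  by rewrite Rint_indic Rintegral_cst// (_ : fine (mu setT) = 1) ?mulr1// probability_setT.
have /cvgrPdist_le/(_ (eta / 3)) := @cvg_pow K m (ltW K0).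
have e3 : 0 < eta / 3 by lra.
move=> /(_ e3); apply: filterS => n; rewrite ler_norml => /andP[H _].
have : E n (fun x => (u < S n x)%R%:R) <=
    E n (fun x => (1 - expR (- (K * S n x))) ^+ m) + eta / 3 * E n (fun=> 1).
  rewrite -E_lin; apply: E_le => x.
  have [us|_] := ltP u (S n x); last first.
    by have /andP[a _] := p01 _ (S_ge0 n x); rewrite mulr1 /= mulr0n; lra.
  by have := pu _ (ltW us); rewrite mulr1 /=; lra.
rewrite E_cst; lra.
Qed.

Lemma laplace_tail_ge (t u eta : R) : 0 <= t -> t < u -> 0 < eta ->
  \forall n \near \oo, tail u - eta <= E n (fun x => (t < S n x)%R%:R).
Proof.
move=> t0 tu eta0.
have [|K [m [K0 p01 pu pt]]] := @exp_threshold R t u (eta / 3) t0 tu; first lra.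
have int : mu.-integrable setT (EFin \o (fun x => (1 - expR (- (K * q x))) ^+ m)).
  apply: (integrable_bd (B := 1)) => // x.
  by have /andP[a b] := p01 _ (q_ge0 x); rewrite ger0_norm.
have intI : mu.-integrable setT (EFin \o (fun x => \1_[set x | u < q x] x - cst (eta / 3) x)).
  apply: (integrable_bd (B := 1 + eta / 3)).
    by apply: measurable_funB.
  move=> x; have /andP[i0 i1] := indic01 [set x | u < q x] x.
  by rewrite /cst ler_norml; lra.
have bound : (tail u - eta / 3 <= \int[mu]_x ((1 - expR (- (K * q x))) ^+ m))%R.
  apply: (@le_trans _ _ (\int[mu]_x (\1_[set x | u < q x] x - cst (eta / 3) x))%R); last first.
    apply: le_Rintegral => // x _ /=; rewrite indicE.
    have [uq|qu] := ltP u (q x).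
      by rewrite mem_set//=; have := pu _ (ltW uq); rewrite mulr1n; lra.
    rewrite memNset /=; last by rewrite ltNge qu.
    by have /andP[a _] := p01 _ (q_ge0 x); lra.
  rewrite RintegralB//; last 2 first.
  - apply: (integrable_bd (B := 1)) => // x.
    by rewrite indicE; case: (_ \in _); rewrite ?normr0 ?normr1.
  - by apply: (integrable_bd (B := eta / 3)) => // x; rewrite /cst ger0_norm//; lra.
  by rewrite Rint_indic Rintegral_cst// (_ : fine (mu setT) = 1) ?mulr1// probability_setT.
have /cvgrPdist_le/(_ (eta / 3)) := @cvg_pow K m (ltW K0).
have e3 : 0 < eta / 3 by lra.
move=> /(_ e3); apply: filterS => n; rewrite ler_norml => /andP[_ H].
have : E n (fun x => (1 - expR (- (K * S n x))) ^+ m) <=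
    E n (fun x => (t < S n x)%R%:R) + eta / 3 * E n (fun=> 1).
  rewrite -E_lin; apply: E_le => x.
  have [ts|st] := ltP t (S n x).
    by have /andP[_ a] := p01 _ (S_ge0 n x); rewrite mulr1 /=; lra.
  by have := pt _ (S_ge0 n x) st; rewrite mulr1 /=; lra.
rewrite E_cst; lra.
Qed.

End laplace_convergence.

(** * A central limit theorem for finite Markov chains *)

Section taylor_bounds.
Context {R : realType}.
Implicit Types x : R.

(** Applied repeatedly, this integrates one Taylor inequality into the next, alternating between
    sine and cosine and starting from [cos x <= 1]. *)
Lemma ge0_from_derive (f f' : R -> R) :
    (forall x, is_derive x 1 f (f' x)) -> (forall x, 0 <= x -> 0 <= f' x) ->
  0 <= f 0 -> forall x, 0 <= x -> 0 <= f x.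
Proof.
move=> df f'0 f0 x; rewrite le_eqVlt => /predU1P[<-//|x0].
have [] := @MVT R f f' 0 x x0.
- apply: continuous_subspaceT => y; apply: differentiable_continuous.
  by apply/derivable1_diffP; case: (df y).
- move=> c; rewrite in_itv /= subr0 => /andP[c0 _] E.
  rewrite -[f x](subrK (f 0)) E addr_ge0// mulr_ge0//; last exact: ltW.
  by apply: f'0; exact: ltW.
Qed.

Lemma sin_le x : 0 <= x -> sin x <= x.
Proof.
move=> x0; rewrite -subr_ge0.
apply: (@ge0_from_derive (fun x => x - sin x) (fun x => 1 - cos x)) => //.
by rewrite sin0 subrr.
Qed.

Lemma cos_ge x : 0 <= x -> 1 - x ^+ 2 / 2 <= cos x.
Proof.
move=> x0; rewrite -subr_ge0.
apply: (@ge0_from_derive (fun x => cos x - (1 - x ^+ 2 / 2)) (fun x => x - sin x)) => //.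
- move=> y; apply: is_derive_eq; rewrite /GRing.scale /=; lra.
- by move=> y y0; rewrite subr_ge0 sin_le.
- rewrite cos0; lra.
Qed.

Lemma sin_ge x : 0 <= x -> x - x ^+ 3 / 6 <= sin x.
Proof.
move=> x0; rewrite -subr_ge0.
apply: (@ge0_from_derive (fun x => sin x - (x - x ^+ 3 / 6))
  (fun x => cos x - (1 - x ^+ 2 / 2))) => //.
- move=> y; apply: is_derive_eq; rewrite /GRing.scale /=; lra.
- by move=> y y0; rewrite subr_ge0 cos_ge.
- rewrite sin0; lra.
Qed.

Lemma cos_le x : 0 <= x -> cos x <= 1 - x ^+ 2 / 2 + x ^+ 4 / 24.
Proof.
move=> x0; rewrite -subr_ge0.
apply: (@ge0_from_derive (fun x => 1 - x ^+ 2 / 2 + x ^+ 4 / 24 - cos x)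
  (fun x => sin x - (x - x ^+ 3 / 6))) => //.
- move=> y; apply: is_derive_eq; rewrite /GRing.scale /=; lra.
- by move=> y y0; rewrite subr_ge0 sin_ge.
- rewrite cos0; lra.
Qed.

Lemma cos_taylor x : `|cos x - (1 - x ^+ 2 / 2)| <= `|x| ^+ 4.
Proof.
wlog x0 : x / 0 <= x.
  move=> H; have [/H//|/ltW x0] := leP 0 x.
  by have := H (- x); rewrite cosN sqrrN normrN; apply; rewrite oppr_ge0.
rewrite (ger0_norm x0) ger0_norm; last by rewrite subr_ge0 cos_ge.
have := cos_le x0; have := exprn_ge0 4 x0; lra.
Qed.

Lemma sin_taylor x : `|sin x - x| <= `|x| ^+ 3.
Proof.
wlog x0 : x / 0 <= x.
  move=> H; have [/H//|/ltW x0] := leP 0 x.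
  have := H (- x); rewrite sinN -opprD !normrN; apply; by rewrite oppr_ge0.
rewrite (ger0_norm x0) distrC ger0_norm; last by rewrite subr_ge0 sin_le.
have := sin_ge x0; have := exprn_ge0 3 x0; lra.
Qed.

Lemma expRN_taylor x : 0 <= x -> `|expR (- x) - (1 - x)| <= x ^+ 2.
Proof.
move=> x0; rewrite ger0_norm; last by rewrite subr_ge0 expR_ge1Dx.
rewrite -subr_ge0 (_ : _ - _ = 1 - x + x ^+ 2 - expR (- x)); last by lra.
apply: (@ge0_from_derive (fun x => 1 - x + x ^+ 2 - expR (- x))
  (fun x => expR (- x) - (1 - x) + x)) => //.
- move=> y; apply: is_derive_eq; rewrite /GRing.scale /=; lra.
- by move=> y y0; rewrite addr_ge0// subr_ge0 expR_ge1Dx.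

Qed.

Lemma cos_norm x : cos `|x| = cos x.
Proof. by case: (ler0P x) => // _; rewrite cosN. Qed.

End taylor_bounds.

(** * Expectations over finite paths and martingale sums *)

Section path_expectation.
Context {R : realType} (N : nat).
Implicit Types (y : nat -> 'I_N) (f : (nat -> 'I_N) -> R).

Definition extend_path y (t : nat) (j : 'I_N) : nat -> 'I_N :=
  fun k => if (k <= t)%N then y k else j.

Variable Q : 'M[R]_N.

(* Conditional expectation of [f] of the path given its first [t.+1] states
   [y 0, ..., y t], the path being frozen after time [t + m]. *)
Fixpoint cond_expectation (m t : nat) y f : R :=
  match m with
  | 0 => f y
  | m'.+1 => \sum_j Q (y t) j * cond_expectation m' t.+1 (extend_path y t j) f
  end.

(** The recursive definition splits off the next transition, whereas martingale arguments and
    inductions on the sample size split off the last one. *)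
Lemma cond_expectation_tower m t y f :
  cond_expectation m.+1 t y f = cond_expectation m t y
    (fun z => \sum_j Q (z (t + m)%N) j * f (extend_path z (t + m) j)).
Proof.
elim: m t y => [|m IH] t y; first by rewrite /= addn0.
rewrite [LHS]/= [RHS]/=; apply: eq_bigr => j _; congr (_ * _).
rewrite -[LHS]/(cond_expectation m.+1 t.+1 (extend_path y t j) f) IH.
by rewrite addSnnS.
Qed.

Variable nu : 'I_N -> R.

Definition path_expectation (n : nat) f : R :=
  \sum_i nu i * cond_expectation n 0 (fun=> i) f.

Lemma path_expectationS n f :
  path_expectation n.+1 f = path_expectation n
    (fun z => \sum_j Q (z n) j * f (extend_path z n j)).
Proof. by apply: eq_bigr => i _; rewrite cond_expectation_tower. Qed.

Lemma eq_path_expectation n f g : f =1 g -> path_expectation n f = path_expectation n g.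
Proof. by move=> fg; congr path_expectation; exact/funext. Qed.

Lemma path_expectationD n f g :
  path_expectation n (fun y => f y + g y) = path_expectation n f + path_expectation n g.
Proof.
rewrite /path_expectation -big_split; apply: eq_bigr => i _; rewrite /= -mulrDr.
congr (_ * _); move: 0%N (fun=> i); elim: n => [//|n IH] t y /=.
by rewrite -big_split; apply: eq_bigr => j _; rewrite IH /= mulrDr.
Qed.

Lemma path_expectationZ n a f :
  path_expectation n (fun y => a * f y) = a * path_expectation n f.
Proof.
rewrite /path_expectation mulr_sumr; apply: eq_bigr => i _; rewrite mulrCA.
congr (_ * _); move: 0%N (fun=> i); elim: n => [//|n IH] t y /=.
by rewrite mulr_sumr; apply: eq_bigr => j _; rewrite IH mulrCA.
Qed.

Lemma path_expectationB n f g :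
  path_expectation n (fun y => f y - g y) = path_expectation n f - path_expectation n g.
Proof.
rewrite path_expectationD; congr (_ + _).
by rewrite -mulN1r -path_expectationZ; apply: eq_path_expectation => y; rewrite mulN1r.
Qed.

Hypothesis Q_ge0 : forall i j, 0 <= Q i j.
Hypothesis Q_sum1 : forall i, \sum_j Q i j = 1.
Hypothesis nu_ge0 : forall i, 0 <= nu i.
Hypothesis nu_sum1 : \sum_i nu i = 1.

Lemma le_path_expectation n f g : (forall y, f y <= g y) ->
  path_expectation n f <= path_expectation n g.
Proof.
move=> fg; apply: ler_sum => i _; rewrite ler_wpM2l//.
move: 0%N (fun=> i); elim: n => [//|n IH] t y /=.
by apply: ler_sum => j _; rewrite ler_wpM2l.
Qed.

Lemma path_expectation_cst n a : path_expectation n (fun=> a) = a.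
Proof.
rewrite /path_expectation -[RHS]mul1r -nu_sum1 mulr_suml; apply: eq_bigr => i _.
congr (_ * _); move: 0%N (fun=> i); elim: n => [//|n IH] t y /=.
by rewrite -[RHS]mul1r -(Q_sum1 (y t)) mulr_suml; apply: eq_bigr => j _; rewrite IH.
Qed.

Lemma norm_path_expectation n f : `|path_expectation n f| <= path_expectation n (fun y => `|f y|).
Proof.
rewrite ler_norml -mulN1r -path_expectationZ.
by rewrite !le_path_expectation// => y; rewrite ?ler_norm// mulN1r lerNl -normrN ler_norm.
Qed.

Lemma path_expectation_indic_markov n f a (P : (nat -> 'I_N) -> bool) : 0 < a ->
    (forall y, 0 <= f y) -> (forall y, P y -> a <= f y) ->
  path_expectation n (fun y => (P y)%:R) <= a^-1 * path_expectation n f.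
Proof.
move=> a0 f0 Pf; rewrite -path_expectationZ; apply: le_path_expectation => y.
case: (boolP (P y)) => [/Pf af|_]; last by rewrite mulr_ge0// invr_ge0 ltW.
by rewrite ler_pdivlMl// mulr1.
Qed.

(* The transitions out of the unrecorded state [y 0] are not counted. *)
Definition path_sum (g : 'I_N -> 'I_N -> R) (n : nat) y : R :=
  \sum_(1 <= k < n) g (y k) (y k.+1).

Lemma path_sumS g n y j : (0 < n)%N ->
  path_sum g n.+1 (extend_path y n j) = path_sum g n y + g (y n) j.
Proof.
move=> n0; rewrite /path_sum big_nat_recr//=; congr (_ + _).
  apply: eq_big_nat => k /andP[_ kn]; rewrite /extend_path (ltnW kn).
  by rewrite kn.
by rewrite /extend_path leqnn ltnn.
Qed.

Lemma path_sum_small g y n : (n <= 1)%N -> path_sum g n y = 0.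
Proof. by move=> n1; rewrite /path_sum big_geq. Qed.

(* The increments of [path_sum g] are bounded martingale differences, hence
   orthogonal. *)
Lemma path_sum_second_moment g B n :
    (forall i, \sum_j Q i j * g i j = 0) -> (forall i j, `|g i j| <= B) ->
  path_expectation n (fun y => path_sum g n y ^+ 2) <= n%:R * B ^+ 2.
Proof.
move=> g0 gB; elim: n => [|n IH].
  under eq_path_expectation do rewrite path_sum_small// expr0n.
  by rewrite path_expectation_cst mul0r.
have [->|n0] := posnP n.
  under eq_path_expectation do rewrite path_sum_small// expr0n.
  by rewrite path_expectation_cst mul1r sqr_ge0.
rewrite path_expectationS -natr1 mulrDl mul1r.
apply: le_trans (lerD IH (lexx _)).
rewrite -[X in _ + X](path_expectation_cst n) -path_expectationD.
apply: le_path_expectation => y.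
under eq_bigr do rewrite path_sumS// sqrrD.
apply: (@le_trans _ _ (path_sum g n y ^+ 2 * (\sum_j Q (y n) j) +
  (path_sum g n y *+ 2) * (\sum_j Q (y n) j * g (y n) j) +
  \sum_j Q (y n) j * g (y n) j ^+ 2)).
  rewrite !mulr_sumr -!big_split le_eqVlt; apply/orP; left; apply/eqP.
  by apply: eq_bigr => j _ /=; ring.
rewrite g0 mulr0 addr0 Q_sum1 mulr1 lerD2l -[leRHS]mul1r -(Q_sum1 (y n)) mulr_suml.
apply: ler_sum => j _; rewrite ler_wpM2l// -[leLHS]real_normK ?num_real//.
by rewrite lerXn2r ?nnegrE ?(le_trans _ (gB (y n) j)).
Qed.

End path_expectation.

Section poisson_equation.
Context {R : realType} (N : nat).

(** Fredholm alternative: the column space of [1 - Q] is contained in the hyperplane orthogonal to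
    [pi], and its dimension is at least [N.-1] because the kernel of [1 - Q] contains only
    constants; hence the two coincide. *)
Lemma poisson_solution (Q : 'M[R]_N) (pi : 'rV[R]_N) (c : 'cV[R]_N) :
    pi != 0 -> pi *m Q = pi ->
    (forall h : 'cV[R]_N, Q *m h = h -> exists a, h = const_mx a) ->
    pi *m c = 0 ->
  exists h : 'cV[R]_N, h - Q *m h = c.
Proof.
move=> pi0 piQ kerQ pic.
have sub : ((1%:M - Q)^T <= kermx pi^T)%MS.
  apply/sub_kermxP; rewrite -trmx_mul mulmxBr mulmx1 piQ subrr.
  exact: trmx0.
have rk : \rank (kermx pi^T) = N.-1.
  rewrite mxrank_ker mxrank_tr -subn1; congr (_ - _)%N.
  by rewrite rank_rV pi0.
have rkQ : (N.-1 <= \rank (1%:M - Q)^T)%N.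
  have : (\rank (kermx (1%:M - Q)^T) <= 1)%N.
    apply: leq_trans (rank_leq_row (const_mx 1 : 'rV[R]_N)).
    apply: mxrankS; apply/rV_subP => v /sub_kermxP vK.
    have [|a va] := kerQ v^T.
      apply: trmx_inj; move: vK; rewrite trmx_mul trmxK linearB /= trmx1 mulmxBr mulmx1.
      by move/eqP; rewrite subr_eq0 => /eqP.
    rewrite -[v]trmxK va; apply/submxP; exists a%:M.
    by rewrite mul_scalar_mx; apply/rowP => j; rewrite !mxE mulr1.
  by rewrite mxrank_ker leq_subLR addnC -leq_subLR subn1.
have eqm : ((1%:M - Q)^T == kermx pi^T)%MS.
  by rewrite -(geq_leqif (mxrank_leqif_eq sub)) rk.
have : (c^T <= (1%:M - Q)^T)%MS.
  rewrite (eqmxP eqm); apply/sub_kermxP; rewrite -trmx_mul pic.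
  exact: trmx0.
case/submxP => D cD; exists D^T.
by apply: trmx_inj; rewrite cD linearB /= trmxK linearB /= trmx_mul trmxK mulmxBr trmx1 mulmx1.
Qed.

End poisson_equation.

Section markov_clt.
Context {R : realType} (N : nat).
Variables (Q : 'M[R]_N) (nu : 'I_N -> R).
Hypothesis Q_ge0 : forall i j, 0 <= Q i j.
Hypothesis Q_sum1 : forall i, \sum_j Q i j = 1.
Hypothesis nu_ge0 : forall i, 0 <= nu i.
Hypothesis nu_sum1 : \sum_i nu i = 1.
Variable (pi : 'rV[R]_N).
Hypothesis pi_sum1 : \sum_i pi 0 i = 1.
Hypothesis pi_ge0 : forall i, 0 <= pi 0 i.
Hypothesis piQ : pi *m Q = pi.
Hypothesis kerQ : forall h : 'cV[R]_N, Q *m h = h -> exists a, h = const_mx a.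

Local Notation E := (path_expectation Q nu).

Lemma poisson_centered (c : 'I_N -> R) : exists h : 'I_N -> R,
  forall i, h i - \sum_j Q i j * h j = c i - \sum_j pi 0 j * c j.
Proof.
pose cbar := \sum_j pi 0 j * c j.
have pi0 : pi != 0.
  apply/eqP => p0; move: pi_sum1; rewrite p0.
  by rewrite big1 => [/eqP|i _]; rewrite ?mxE // eq_sym oner_eq0.
have [|h hE] := @poisson_solution R N Q pi (\col_i (c i - cbar)) pi0 piQ kerQ.
  apply/rowP => j; rewrite !mxE.
  under eq_bigr do rewrite !mxE mulrBr.
  by rewrite sumrB -mulr_suml pi_sum1 mul1r subrr.
exists (fun i => h i 0) => i.
by have /colP/(_ i) := hE; rewrite !mxE.
Qed.

Variable th : 'I_N -> 'I_N -> R.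
Hypothesis th_centered : forall i, \sum_j Q i j * th i j = 0.

Definition asymptotic_variance : R :=
  \sum_i pi 0 i * \sum_j Q i j * th i j ^+ 2.

Lemma asymptotic_variance_ge0 : 0 <= asymptotic_variance.
Proof.
apply: sumr_ge0 => i _; rewrite mulr_ge0//; apply: sumr_ge0 => j _.
by rewrite mulr_ge0// sqr_ge0.
Qed.

Let sumQ_norm (i : 'I_N) (F : 'I_N -> R) K : (forall j, `|F j| <= K) ->
  `|\sum_j Q i j * F j| <= K.
Proof.
move=> FK; apply: le_trans (ler_norm_sum _ _ _) _.
rewrite -[leRHS]mul1r -(Q_sum1 i) mulr_suml; apply: ler_sum => j _.
by rewrite normrM ger0_norm// ler_wpM2l.
Qed.

(* Perturbing the test function [1] by [s ^ 2 * h], with [h] the solution of a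
   Poisson equation, makes it an eigenfunction of the tilted kernel up to
   [O(s ^ 3)]. *)
Lemma tilted_kernel_expansion : exists h : 'I_N -> R, exists2 K : R, 0 <= K &
  forall (s phi : R) (i : 'I_N), 0 <= s <= 1 ->
  `|\sum_j Q i j * (cos (phi + s * th i j) * (1 + s ^+ 2 * h j))
    - expR (- (s ^+ 2 * asymptotic_variance / 2)) * (cos phi * (1 + s ^+ 2 * h i))|
  <= K * s ^+ 3.
Proof.
pose v := asymptotic_variance.
have v0 : 0 <= v := asymptotic_variance_ge0.
(* The second-order term of the cosine brings in the conditional variance of [th], which depends on
   the current state. This right-hand side makes [h] replace it by its stationary mean [v]. *)
have [h hE] := poisson_centered (fun i => - (\sum_j Q i j * th i j ^+ 2) / 2).
have {}hE i : \sum_j Q i j * h j = h i + (\sum_j Q i j * th i j ^+ 2) / 2 - v / 2.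
  have := hE i; rewrite (_ : \sum_j pi 0 j * _ = - v / 2); first lra.
  rewrite /v /asymptotic_variance -sumrN mulr_suml; apply: eq_bigr => j _; lra.
pose B : R := 1 + \sum_i \sum_j `|th i j| + \sum_i `|h i|.
have B1 : 1 <= B.
  rewrite /B -addrA lerDl addr_ge0// sumr_ge0// => i _; exact: sumr_ge0.
have thB i j : `|th i j| <= B.
  rewrite /B (bigD1 i)//= (bigD1 j)//= -!addrA.
  have : 0 <= \sum_(k < N | k != j) `|th i k| by exact: sumr_ge0.
  have : 0 <= \sum_(k < N | k != i) \sum_l `|th k l|.
    by apply: sumr_ge0 => k _; exact: sumr_ge0.
  have : 0 <= \sum_k `|h k| by exact: sumr_ge0.
  lra.
have hB i : `|h i| <= B.
  rewrite /B (bigD1 i (F := fun i => `|h i|))//= -!addrA.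
  have : 0 <= \sum_(k < N | k != i) `|h k| by exact: sumr_ge0.
  have : 0 <= \sum_k \sum_l `|th k l| by apply: sumr_ge0 => k _; exact: sumr_ge0.
  lra.
(* The three estimates below add up to at most [5 B^4 + v^2 B + v B] times [s^3]; the factors 10
   leave slack for the final linear arithmetic. *)
exists h, (B ^+ 4 * 10 + v ^+ 2 * B * 10 + v * B * 10).
  by rewrite !addr_ge0 ?mulr_ge0 ?exprn_ge0//; lra.
move=> s phi i /andP[s0 s1].

have s2 : 0 <= s ^+ 2 by exact: sqr_ge0.
have s3 : 0 <= s ^+ 3 by exact: exprn_ge0.
have s43 : s ^+ 4 <= s ^+ 3 by rewrite (exprS s 3) ler_piMl.
have B0 : 0 <= B by lra.
have B43 : B ^+ 3 <= B ^+ 4 by rewrite (exprS B 3) ler_peMl// exprn_ge0.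
have xB j : `|s * th i j| <= s * B by rewrite normrM ger0_norm// ler_wpM2l.
(* By the addition formula the tilted sum is [cos phi * A - sin phi * D]. The value [A'] is the
   second-order expansion both of [A] and of [exp (- s^2 v / 2) (1 + s^2 h i)], while [D] has no
   first-order term because [th] is centered. *)
pose A := \sum_j Q i j * (cos (s * th i j) * (1 + s ^+ 2 * h j)).
pose A' := 1 + s ^+ 2 * h i - s ^+ 2 * v / 2.
pose D := \sum_j Q i j * (sin (s * th i j) * (1 + s ^+ 2 * h j)).
have AA' : `|A - A'| <= 2 * B ^+ 4 * s ^+ 3.
  have -> : A' = \sum_j Q i j * (1 - (s * th i j) ^+ 2 / 2 + s ^+ 2 * h j).
    rewrite (eq_bigr (fun j => Q i j - s ^+ 2 / 2 * (Q i j * th i j ^+ 2) +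
       s ^+ 2 * (Q i j * h j))); last by move=> j _; field.
    rewrite big_split sumrB /= -!mulr_sumr hE Q_sum1 /A'; lra.
  rewrite -sumrB; under eq_bigr do rewrite -mulrBr.
  apply: sumQ_norm => j; set x := s * th i j.
  have -> : cos x * (1 + s ^+ 2 * h j) - (1 - x ^+ 2 / 2 + s ^+ 2 * h j) =
    (cos x - (1 - x ^+ 2 / 2)) + s ^+ 2 * (h j * (cos x - 1)) by ring.
  have c1 : `|cos x - 1| <= `|x| ^+ 2 / 2.
    have := cos_ge (normr_ge0 x); rewrite cos_norm => c1.
    rewrite ler_norml; apply/andP; split; first lra.
    by rewrite (@le_trans _ _ 0) ?subr_le0 ?cos_le1// divr_ge0 ?exprn_ge0.
  have xj : `|x| <= s * B := xB j.
  have x4 : `|x| ^+ 4 <= s ^+ 4 * B ^+ 4 by rewrite -exprMn lerXn2r ?nnegrE ?mulr_ge0.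
  have x2 : `|x| ^+ 2 <= s ^+ 2 * B ^+ 2 by rewrite -exprMn lerXn2r ?nnegrE ?mulr_ge0.
  apply: le_trans (ler_normD _ _) _.
  rewrite [`|s ^+ 2 * _|]normrM (ger0_norm s2) [`|h j * _|]normrM.
  apply: (@le_trans _ _ (s ^+ 4 * B ^+ 4 + s ^+ 2 * (B * (s ^+ 2 * B ^+ 2 / 2)))).
    apply: lerD; first exact: le_trans (cos_taylor _) x4.
    rewrite ler_wpM2l// ler_pM//; apply: le_trans c1 _; lra.
  have -> : s ^+ 2 * (B * (s ^+ 2 * B ^+ 2 / 2)) = s ^+ 4 * B ^+ 3 / 2 by field.
  have : s ^+ 4 * B ^+ 3 <= s ^+ 3 * B ^+ 4 by rewrite ler_pM// exprn_ge0.
  have : s ^+ 4 * B ^+ 4 <= s ^+ 3 * B ^+ 4 by rewrite ler_wpM2r// exprn_ge0.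
  have : 0 <= s ^+ 3 * B ^+ 4 by rewrite mulr_ge0// exprn_ge0.
  lra.
have D0 : `|D| <= 3 * B ^+ 4 * s ^+ 3.
  have -> : D = \sum_j Q i j * (sin (s * th i j) * (1 + s ^+ 2 * h j) - s * th i j).
    under [RHS]eq_bigr do rewrite mulrBr.
    rewrite sumrB -[LHS]subr0; congr (_ - _).
    under eq_bigr do rewrite mulrCA.
    by rewrite -mulr_sumr th_centered mulr0.
  apply: sumQ_norm => j; set x := s * th i j.
  have -> : sin x * (1 + s ^+ 2 * h j) - x =
    (sin x - x) + s ^+ 2 * (h j * sin x) by ring.
  have xj : `|x| <= s * B := xB j.
  have x3 : `|x| ^+ 3 <= s ^+ 3 * B ^+ 3 by rewrite -exprMn lerXn2r ?nnegrE ?mulr_ge0.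
  have sB3 : s ^+ 3 * B ^+ 3 <= s * B ^+ 3.
    by rewrite ler_wpM2r ?exprn_ge0// (exprS s 2) ler_piMr// expr_le1.
  have BB3 : s * B <= s * B ^+ 3.
    by rewrite ler_wpM2l// exprS ler_peMr// expr_ge1.
  have sx : `|sin x| <= 2 * (s * B ^+ 3).
    rewrite -[sin x](subrK x); apply: le_trans (ler_normD _ _) _.
    have := sin_taylor x; have := xB j; rewrite -/x; lra.
  apply: le_trans (ler_normD _ _) _.
  rewrite [`|s ^+ 2 * _|]normrM (ger0_norm s2) [`|h j * _|]normrM.
  apply: (@le_trans _ _ (s ^+ 3 * B ^+ 3 + s ^+ 2 * (B * (2 * (s * B ^+ 3))))).
    apply: lerD; first exact: le_trans (sin_taylor _) x3.
    by rewrite ler_wpM2l// ler_pM.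
  have -> : s ^+ 2 * (B * (2 * (s * B ^+ 3))) = 2 * (s ^+ 3 * B ^+ 4) by ring.
  have : s ^+ 3 * B ^+ 3 <= s ^+ 3 * B ^+ 4 by rewrite ler_wpM2l.
  lra.
have T0 : `|expR (- (s ^+ 2 * v / 2)) * (1 + s ^+ 2 * h i) - A'| <=
    (v ^+ 2 * B + v * B) * s ^+ 3.
  set u := s ^+ 2 * v / 2.
  have u0 : 0 <= u by rewrite /u divr_ge0// mulr_ge0.
  have -> : expR (- u) * (1 + s ^+ 2 * h i) - A' =
     (expR (- u) - (1 - u)) * (1 + s ^+ 2 * h i) - u * (s ^+ 2 * h i).
    by rewrite /A' -/u; ring.
  have h1 : `|1 + s ^+ 2 * h i| <= 2 * B.
    apply: le_trans (ler_normD _ _) _; rewrite normr1 normrM (ger0_norm s2).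
    have : s ^+ 2 * `|h i| <= 1 * B by rewrite ler_pM// expr_le1.
    lra.
  apply: le_trans (ler_normB _ _) _.
  rewrite [`|_ * (1 + _)|]normrM [`|u * _|]normrM [`|s ^+ 2 * _|]normrM (ger0_norm s2) (ger0_norm u0).
  apply: (@le_trans _ _ (u ^+ 2 * (2 * B) + u * (s ^+ 2 * B))).
    apply: lerD; first by rewrite ler_pM// expRN_taylor.
    by rewrite !ler_wpM2l.
  have -> : u ^+ 2 * (2 * B) + u * (s ^+ 2 * B) =
     (v ^+ 2 * B / 2 + v * B / 2) * s ^+ 4 by rewrite /u; field.
  apply: (@le_trans _ _ ((v ^+ 2 * B / 2 + v * B / 2) * s ^+ 3)).
    by rewrite ler_wpM2l// addr_ge0// divr_ge0// mulr_ge0// sqr_ge0.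
  have : 0 <= (v ^+ 2 * B + v * B) * s ^+ 3.
    by rewrite mulr_ge0// addr_ge0// mulr_ge0// sqr_ge0.
  lra.
have -> : \sum_j Q i j * (cos (phi + s * th i j) * (1 + s ^+ 2 * h j)) =
    cos phi * A - sin phi * D.
  rewrite /A /D !mulr_sumr -sumrB; apply: eq_bigr => j _; rewrite cosD; ring.
have -> : cos phi * A - sin phi * D - expR (- (s ^+ 2 * v / 2)) * (cos phi * (1 + s ^+ 2 * h i))
   = cos phi * (A - A') - cos phi * (expR (- (s ^+ 2 * v / 2)) * (1 + s ^+ 2 * h i) - A')
     - sin phi * D by ring.
have b1 (a z K : R) : `|a| <= 1 -> `|z| <= K -> `|a * z| <= K.
  by move=> a1 zK; rewrite normrM; apply: le_trans zK; rewrite ler_piMl.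
have c1 : `|cos phi| <= 1 by rewrite ler_norml cos_geN1 cos_le1.
have s1' : `|sin phi| <= 1 by rewrite ler_norml sin_geN1 sin_le1.
have := b1 _ _ _ c1 AA'; have := b1 _ _ _ c1 T0; have := b1 _ _ _ s1' D0.
set X := cos phi * (A - A'); set Y := cos phi * (_ - A'); set Z := sin phi * D.
move=> Z0 Y0 X0.
have : 0 <= v ^+ 2 * B * s ^+ 3 by rewrite !mulr_ge0// sqr_ge0.
have : 0 <= v * B * s ^+ 3 by rewrite !mulr_ge0.
have : 0 <= B ^+ 4 * s ^+ 3 by rewrite mulr_ge0// exprn_ge0.
have := ler_normB (X - Y) Z; have := ler_normB X Y.
lra.
Qed.

(** Each of the [n.-1] counted transitions multiplies the mean of the perturbed test function by the
    same factor, up to [K s^3]; passing between this function and the cosine costs [O(s^2)] at the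
    start and at the end. *)
Lemma path_expectation_cos_expansion : exists2 K : R, 0 <= K &
  forall (s : R) n, 0 <= s <= 1 -> (0 < n)%N ->
  `|E n (fun y => cos (s * path_sum th n y)) -
    expR (- (s ^+ 2 * asymptotic_variance / 2 * n.-1%:R))|
  <= K * s ^+ 2 + K * s ^+ 3 * n%:R.
Proof.
have [h [K K0 hK]] := tilted_kernel_expansion.
pose v := asymptotic_variance.
pose B := \sum_i `|h i|.
have hB i : `|h i| <= B by rewrite /B (bigD1 i)//= lerDl sumr_ge0.
have B0 : 0 <= B by exact: sumr_ge0.
exists (K + 2 * B); first by rewrite addr_ge0// mulr_ge0.
move=> s n s01 n0; have /andP[s0 s1] := s01.
have s2 : 0 <= s ^+ 2 by exact: sqr_ge0.
have s3 : 0 <= s ^+ 3 by exact: exprn_ge0.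
pose u m y := cos (s * path_sum th m y) * (1 + s ^+ 2 * h (y m)).
set q := expR (- (s ^+ 2 * v / 2)).
have q01 : 0 <= q <= 1.
  by rewrite expR_ge0 expR_le1 oppr_le0 divr_ge0// mulr_ge0// asymptotic_variance_ge0.
have cos1 x : `|cos x| <= 1 :> R by rewrite ler_norml cos_geN1 cos_le1.
have uE m y : `|u m y - cos (s * path_sum th m y)| <= s ^+ 2 * B.
  rewrite /u mulrDr mulr1 addrAC subrr add0r normrM -[leRHS]mul1r.
  by rewrite ler_pM// normrM ger0_norm// ler_wpM2l.
have Eu m : `|E m.+1 (u m.+1) - q ^+ m| <= s ^+ 2 * B + K * s ^+ 3 * m%:R.
  elim: m => [|m IH].
    rewrite expr0 mulr0 addr0 -(path_expectation_cst Q_sum1 nu_sum1 1 1).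
    rewrite -path_expectationB.
    apply: le_trans (norm_path_expectation Q_ge0 nu_ge0 _ _) _.
    rewrite -[leRHS](path_expectation_cst Q_sum1 nu_sum1 1).
    apply: le_path_expectation => // y.
    by have := uE 1%N y; rewrite path_sum_small// mulr0 cos0.
  rewrite path_expectationS.
  have step : `|E m.+1 (fun z => \sum_j Q (z m.+1) j * u m.+2 (extend_path z m.+1 j)) -
     q * E m.+1 (u m.+1)| <= K * s ^+ 3.
    rewrite -path_expectationZ -path_expectationB.
    apply: le_trans (norm_path_expectation Q_ge0 nu_ge0 _ _) _.
    rewrite -[leRHS](path_expectation_cst Q_sum1 nu_sum1 m.+1).
    apply: le_path_expectation => // y.
    rewrite (eq_bigr (fun j => Q (y m.+1) j *
      (cos (s * path_sum th m.+1 y + s * th (y m.+1) j) * (1 + s ^+ 2 * h j)))).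
      exact: hK.
    by move=> j _; rewrite /u path_sumS// [s * (_ + _)]mulrDr /extend_path ltnn.
  rewrite exprS -(subrKA (q * E m.+1 (u m.+1))) -mulrBr.
  apply: le_trans (ler_normD _ _) _; rewrite -(natr1 m) [_ * (m%:R + 1)]mulrDr mulr1 addrA addrC.
  apply: lerD; first exact: step.
  rewrite normrM; apply: le_trans IH.
  by case/andP: q01 => q0 q1; rewrite ger0_norm// ler_piMl.
case: n n0 => // n _.
have -> : expR (- (s ^+ 2 * asymptotic_variance / 2 * n.+1.-1%:R)) = q ^+ n.
  by rewrite -mulNr expRM_natr.
rewrite -(subrKA (E n.+1 (u n.+1))); apply: le_trans (ler_normD _ _) _.
have : `|E n.+1 (fun y => cos (s * path_sum th n.+1 y)) - E n.+1 (u n.+1)| <= s ^+ 2 * B.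
  rewrite -path_expectationB.
  apply: le_trans (norm_path_expectation Q_ge0 nu_ge0 _ _) _.
  rewrite -[leRHS](path_expectation_cst Q_sum1 nu_sum1 n.+1).
  by apply: le_path_expectation => // y; rewrite distrC.
have := Eu n; rewrite -natr1.
have : 0 <= K * s ^+ 3 * n%:R by rewrite !mulr_ge0.
have : 0 <= K * s ^+ 3 by rewrite !mulr_ge0.
have : 0 <= B * s ^+ 3 * n%:R by rewrite !mulr_ge0.
have : 0 <= B * s ^+ 3 by rewrite !mulr_ge0.
have : 0 <= K * s ^+ 2 by rewrite !mulr_ge0.
have : 0 <= B * s ^+ 2 by rewrite !mulr_ge0.
by set X := `|_ - _|; set Y := `|_ - _|; lra.
Qed.

(** With [s = 1 / sqrt n] the error of the expansion is [K / n + K / sqrt n], and the exponent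
    carries the factor [(n - 1) / n]. *)
Lemma path_expectation_cos_cvg :
  E n (fun y => cos ((Num.sqrt n%:R)^-1 * path_sum th n y)) @[n --> \oo] -->
  expR (- asymptotic_variance / 2).
Proof.
have [K K0 hK] := path_expectation_cos_expansion.
have invn0 : (n%:R : R)^-1 @[n --> \oo] --> (0 : R).
  by apply/gtr0_cvgV0; [near=> n; rewrite ltr0n; near: n; exact: nbhs_infty_gt|exact: cvgr_idn].
have s0 : (Num.sqrt n%:R : R)^-1 @[n --> \oo] --> (0 : R).
  under eq_fun do rewrite -sqrtrV ?ler0n//.
  have := cvg_comp _ _ invn0 (@sqrt_continuous R 0); rewrite sqrtr0.
  exact.
pose v := asymptotic_variance.
have main : expR (- (n%:R^-1 * v / 2 * (n%:R - 1))) @[n --> \oo] --> expR (- v / 2).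
  apply: continuous_cvg; first exact: continuous_expR.
  rewrite mulNr; apply: cvgN.
  rewrite (_ : v / 2 = v / 2 - v / 2 * 0); last by rewrite mulr0 subr0.
  apply: (@cvg_trans _ ((fun n => v / 2 - v / 2 * n%:R^-1) @ \oo)).
    apply: near_eq_cvg; near=> n.
    have n0 : n%:R != 0 :> R by rewrite pnatr_eq0 -lt0n; near: n; exact: nbhs_infty_gt.
    by field.
  by apply: cvgB; [exact: cvg_cst|apply: cvgMr].
apply: (cvg_sub0 _ main).
have b0 : K * n%:R^-1 + K * (Num.sqrt n%:R)^-1 @[n --> \oo] --> (0 : R).
  by rewrite -[X in _ --> X](addr0 (0:R)) -[in X in _ --> X](mulr0 K);
    apply: cvgD; apply: cvgMr.
apply/cvgrPdist_le => e e0; near=> n.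
have n0 : (0 < n)%N by near: n; exact: nbhs_infty_gt.
have nR : 0 < n%:R :> R by rewrite ltr0n.
have sn : (Num.sqrt n%:R : R)^-1 ^+ 2 = n%:R^-1 by rewrite exprVn sqr_sqrtr// ltW.
have s3n : (Num.sqrt n%:R : R)^-1 ^+ 3 * n%:R = (Num.sqrt n%:R)^-1.
  by rewrite exprS sn -mulrA mulVf ?gt_eqF// mulr1.
have s01 : 0 <= (Num.sqrt n%:R : R)^-1 <= 1.
  rewrite invr_ge0 sqrtr_ge0/= invf_le1 ?sqrtr_gt0//.
  by rewrite -[leLHS]sqrtr1 ler_sqrt// ler1n.
have := hK _ n s01 n0; rewrite -[_ * _ ^+ 3 * _]mulrA s3n sn (_ : n.-1%:R = n%:R - 1); last first.
  by rewrite -subn1 natrB.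
rewrite sub0r normrN => /le_trans; apply.
apply: le_trans (ler_norm _) _; near: n.
have /cvgrPdist_le/(_ e e0) := b0; apply: filterS => n.
by rewrite sub0r normrN.
Unshelve. all: by end_near. Qed.

End markov_clt.

(** * The law of the observed chain *)

Section markov_paths.
Context {R : realType} d (Omega : measurableType d) (Pr : probability Omega R).

Lemma probability_split_finite (T : finType) (A : set Omega) (Z : Omega -> T) :
    measurable A -> (forall j, measurable (Z @^-1` [set j])) ->
  Pr A = (\sum_j Pr (A `&` Z @^-1` [set j]))%E.
Proof.
move=> mA mZ.
have {1}-> : A = \bigcup_(j in [set: T]) (A `&` Z @^-1` [set j]).
  by apply/seteqP; split => [w Aw|w [j _ []]//]; exists (Z w).
rewrite measure_fin_bigcup.
- rewrite [RHS]fsbig_seq ?index_enum_uniq//.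
  suff -> : [set` index_enum T] = setT by [].
  by apply/seteqP; split => // x _; rewrite /= mem_index_enum.
- exact: finite_finset.
- by move=> i j _ _ [w [[_ /= <-] [_ /= <-]]].
- by move=> i _; exact: measurableI.
Qed.

Lemma probability_split_nat (A : set Omega) (Z : Omega -> nat) :
    measurable A -> (forall j, measurable (Z @^-1` [set j])) ->
  Pr A = (\sum_(j <oo) Pr (A `&` Z @^-1` [set j]))%E.
Proof.
move=> mA mZ.
have {1}-> : A = \bigcup_j (A `&` Z @^-1` [set j]).
  by apply/seteqP; split => [w Aw|w [j _ []]//]; exists (Z w).
rewrite measure_bigcup.
- by apply: eq_eseriesl => i; rewrite in_setT.
- by move=> i _; exact: measurableI.
- by move=> i j _ _ [w [[_ /= <-] [_ /= <-]]].
Qed.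

Definition depends_upto (N : nat) (B : set (nat -> 'I_N)) (n : nat) : Prop :=
  forall y z, (forall l, (l <= n)%N -> y l = z l) -> B y -> B z.

Variables (N : nat) (Q : 'M[R]_N) (Y : nat -> Omega -> 'I_N).
Hypothesis Ymarkov : markov_chain Pr Q Y.

Let mY : forall m i, measurable (Y m @^-1` [set i]) := Ymarkov.1.

Let path (w : Omega) : nat -> 'I_N := fun k => Y k w.

Definition path_cylinder (t : nat) (y : nat -> 'I_N) : set Omega :=
  [set w | forall l, (l <= t)%N -> Y l w = y l].

Let measurable_path_cylinder t y : measurable (path_cylinder t y).
Proof.
rewrite (_ : path_cylinder t y = \bigcap_(l in `I_t.+1) (Y l @^-1` [set y l])) //.
exact: bigcap_measurableType.
Qed.

Let path_cylinderS t y j :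
  path_cylinder t y `&` Y t.+1 @^-1` [set j] = path_cylinder t.+1 (extend_path y t j).
Proof.
apply/seteqP; split => w /=.
  move=> [yt yj] l; rewrite /extend_path; case: (leqP l t) => [lt _|tl lt]; first exact: yt.
  by have -> : l = t.+1 by apply/eqP; rewrite eqn_leq lt.
move=> yt; split=> [l lt|]; last by rewrite yt// /extend_path ltnn.
by rewrite yt ?(leqW lt)// /extend_path lt.
Qed.

Lemma probability_path_cylinderI m t y (B : set (nat -> 'I_N)) :
    depends_upto B (t + m) ->
  measurable (path_cylinder t y `&` [set w | B (path w)]) /\
  Pr (path_cylinder t y `&` [set w | B (path w)]) =
  (Pr (path_cylinder t y) * (cond_expectation Q m t y (fun z => `[< B z >]%:R))%:E)%E.
Proof.
elim: m t y => [|m IH] t y Bt.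
  rewrite addn0 in Bt; have [By|nBy] := pselect (B y).
    rewrite (_ : _ `&` _ = path_cylinder t y); last first.
      apply/seteqP; split => [w []//|w yw]; split => //=.
      by apply: Bt By => l lt; rewrite /path yw.
    by split => //; rewrite /= asboolT// mule1.
  rewrite (_ : _ `&` _ = set0); last first.
    apply/seteqP; split => // w [yw /= Bw]; apply: nBy.
    by apply: Bt Bw => l lt; rewrite /path yw.
  by split => //; rewrite /= asboolF// mule0 measure0.
have IH' j := IH t.+1 (extend_path y t j); rewrite addSnnS in IH'.
have E j : path_cylinder t y `&` [set w | B (path w)] `&` Y t.+1 @^-1` [set j] =
    path_cylinder t.+1 (extend_path y t j) `&` [set w | B (path w)].
  by rewrite -path_cylinderS setIAC.
have mB : measurable (path_cylinder t y `&` [set w | B (path w)]).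
  rewrite (_ : _ `&` _ = \bigcup_(j in [set: 'I_N])
     (path_cylinder t.+1 (extend_path y t j) `&` [set w | B (path w)])).
    apply: fin_bigcup_measurable; first exact: finite_finset.
    by move=> j _; have [] := IH' j Bt.
  apply/seteqP; split => [w Aw|w [j _]]; last by rewrite -E => -[].
  by exists (Y t.+1 w) => //; rewrite -E.
split => //; rewrite (probability_split_finite (Z := Y t.+1))//.
under eq_bigr => j _ do rewrite E (IH' j Bt).2.
have stepE j : Pr (path_cylinder t.+1 (extend_path y t j)) =
    (Pr (path_cylinder t y) * (Q (y t) j)%:E)%E.
  rewrite [LHS]Ymarkov.2 {2 3}/extend_path leqnn ltnn; congr (Pr _ * _)%E.
  by apply/seteqP; split => w yw l lt; rewrite yw// /extend_path lt.
under eq_bigr => j _ do rewrite stepE -muleA -EFinM.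
have /fineK <- : Pr (path_cylinder t y) \is a fin_num.
  by apply: fin_num_measure.
under eq_bigr => j _ do rewrite -EFinM.
by rewrite sumEFin -mulr_sumr EFinM.
Qed.

(** An event determined by finitely many states is a finite union of cylinder pieces, so its
    measurability needs no study of the functions that define it. This is what admits rejection
    events that compare a statistic with a random quantile. *)
Lemma probability_path_event n (B : set (nat -> 'I_N)) : depends_upto B n ->
  measurable [set w | B (path w)] /\
  Pr [set w | B (path w)] =
  (path_expectation Q (fun i => fine (Pr (Y 0%N @^-1` [set i]))) n
     (fun z => `[< B z >]%:R))%:E.
Proof.
move=> Bn; have E j : [set w | B (path w)] `&` Y 0%N @^-1` [set j] =
    path_cylinder 0 (fun=> j) `&` [set w | B (path w)].
  rewrite setIC; congr (_ `&` _); apply/seteqP; split => w /= => [<- l|->//].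
  by rewrite leqn0 => /eqP ->.
have H j := probability_path_cylinderI (t := 0) (fun=> j) Bn.
have mB : measurable [set w | B (path w)].
  rewrite (_ : mkset _ = \bigcup_(j in [set: 'I_N])
     (path_cylinder 0 (fun=> j) `&` [set w | B (path w)])).
    apply: fin_bigcup_measurable; first exact: finite_finset.
    by move=> j _; have [] := H j.
  apply/seteqP; split => [w Aw|w [j _ []]//].
  by exists (Y 0%N w) => //; rewrite -E.
split => //; rewrite (probability_split_finite (Z := Y 0%N))//.
rewrite /path_expectation -sumEFin; apply: eq_bigr => j _.
rewrite E (H j).2 EFinM fineK; last exact: fin_num_measure.
congr (Pr _ * _)%E; apply/seteqP; split => w /= => [->//|<- l].
by rewrite leqn0 => /eqP ->.
Qed.

Lemma initial_law_sum1 : \sum_i fine (Pr (Y 0%N @^-1` [set i])) = 1.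
Proof.
apply: EFin_inj; rewrite -sumEFin -(probability_setT Pr).
rewrite (probability_split_finite (Z := Y 0%N))//.
by apply: eq_bigr => i _; rewrite setTI fineK// fin_num_measure.
Qed.

Lemma markov_chain_step s i j (B : set (nat -> 'I_N)) : depends_upto B s ->
    (forall y, B y -> y s = i) ->
  Pr ([set w | B (path w)] `&` Y s.+1 @^-1` [set j]) =
  (Pr [set w | B (path w)] * (Q i j)%:E)%E.
Proof.
move=> Bs Bi; rewrite (_ : _ `&` _ = [set w | (B `&` [set y | y s.+1 = j]) (path w)])//.
have Bjs : depends_upto (B `&` [set y | y s.+1 = j]) s.+1.
  move=> y z yz [By /= yj]; split; last by rewrite /= -yz.
  by apply: Bs By => l ls; apply: yz; exact: leqW.
rewrite (probability_path_event Bs).2 (probability_path_event Bjs).2.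
rewrite -EFinM mulrC -path_expectationZ path_expectationS; congr (_%:E).
apply: eq_path_expectation => y.
have Bext j' : B (extend_path y s j') <-> B y.
  by split; apply: Bs => l ls; rewrite /extend_path ls.
have [By|nBy] := pselect (B y); last first.
  rewrite asboolF// mulr0 big1// => j' _; rewrite asboolF ?mulr0//.
  by move=> -[/Bext].
rewrite asboolT// mulr1 (bigD1 j)//= asboolT; last first.
  by split; [exact/Bext|rewrite /= /extend_path ltnn].
rewrite mulr1 (Bi _ By) big1 ?addr0// => j' /eqP j'j.
by rewrite asboolF ?mulr0// => -[_ /=]; rewrite /extend_path ltnn.
Qed.

(** Meant for the unobserved chain: between two observations it makes an arbitrary number [l] of
    steps, possibly none, and the past may be any event that fixes the current state. *)
Lemma markov_chain_steps s l i j (B : set (nat -> 'I_N)) : depends_upto B s ->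
    (forall y, B y -> y s = i) ->
  Pr ([set w | B (path w)] `&` Y (s + l)%N @^-1` [set j]) =
  (Pr [set w | B (path w)] * ((Q ^+ l) i j)%:E)%E.
Proof.
move=> Bs Bi; elim: l j => [|l IH] j.
  rewrite addn0 expr0 mxE; case: (eqVneq i j) => [<-|ij].
    rewrite mule1; congr (Pr _); apply/seteqP; split => [w []//|w Bw].
    by split => //; exact: (Bi (path w)).
  rewrite mule0 (_ : _ `&` _ = set0) ?measure0//.
  apply/seteqP; split => // w [/= /Bi iE jE]; move: ij.
  by rewrite -iE -jE eqxx.
have Bd j' : depends_upto (B `&` [set y | y (s + l)%N = j']) (s + l).
  move=> y z yz [By /= yj]; split; last by rewrite /= -yz.
  by apply: Bs By => k ks; apply: yz; rewrite (leq_trans ks) ?leq_addr.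
have mB : measurable ([set w | B (path w)] `&` Y (s + l.+1)%N @^-1` [set j]).
  by apply: measurableI => //; exact: (probability_path_event Bs).1.
rewrite (probability_split_finite (Z := Y (s + l)%N))//.
transitivity (\sum_j' (Pr [set w | B (path w)] * ((Q ^+ l) i j' * Q j' j)%:E))%E.
  apply: eq_bigr => j' _; rewrite setIAC EFinM muleA -IH addnS.
  exact: (markov_chain_step j (Bd j') (fun y By => By.2)).
have /fineK <- : Pr [set w | B (path w)] \is a fin_num.
  by apply: fin_num_measure; exact: (probability_path_event Bs).1.
under eq_bigr => j' _ do rewrite -EFinM.
by rewrite sumEFin -mulr_sumr EFinM exprSr mxE.
Qed.

End markov_paths.

(** * The mixture of powers that governs the observed chain *)

Section mixture_matrix.
Context {R : realType} (N : nat) (P : 'M[R]_N) (mu : probability nat R).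
Hypothesis P_stoch : stochastic P.

Lemma stochastic_exp l : stochastic (P ^+ l).
Proof.
case: P_stoch => P0 P1; elim: l => [|l [IH0 IH1]].
  split=> [i j|i]; first by rewrite expr0 mxE ler0n.
  rewrite expr0 (bigD1 i)//= mxE eqxx big1 ?addr0// => j ji.
  by rewrite mxE eq_sym (negbTE ji).
rewrite exprS; split=> [i j|i].
  by rewrite mxE; apply: sumr_ge0 => k _; rewrite mulr_ge0.
under eq_bigr do rewrite mxE.
rewrite exchange_big /=; under eq_bigr do rewrite -mulr_sumr IH1 mulr1.
exact: P1.
Qed.

Lemma stochastic_le1 (S : 'M[R]_N) i j : stochastic S -> S i j <= 1.
Proof.
by case=> S0 S1; rewrite -(S1 i) (bigD1 j)//= lerDl sumr_ge0.
Qed.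

Definition gap_weight (l : nat) : R := fine (mu [set l]).

Lemma gap_weight_ge0 l : 0 <= gap_weight l.
Proof. exact: fine_ge0. Qed.

Lemma gap_weightE l : (gap_weight l)%:E = mu [set l].
Proof. by rewrite /gap_weight fineK// fin_num_measure. Qed.

Lemma nneseries_gap_weight : (\sum_(l <oo) (gap_weight l)%:E)%E = 1%E.
Proof.
rewrite -(probability_setT mu) (probability_split_nat mu (Z := id))//.
by apply: eq_eseriesr => l _; rewrite gap_weightE setTI.
Qed.

Lemma sum_gap_weight_le1 n : \sum_(0 <= l < n) gap_weight l <= 1.
Proof.
rewrite -lee_fin -sumEFin -nneseries_gap_weight.
by apply: nneseries_lim_ge => k _ _; rewrite lee_fin gap_weight_ge0.
Qed.

Let term i j l : R := gap_weight l * (P ^+ l) i j.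

Let term_ge0 i j l : 0 <= term i j l.
Proof. by rewrite mulr_ge0 ?gap_weight_ge0//; case: (stochastic_exp l). Qed.

Lemma is_cvg_G_series i j :
  cvgn (series (fun l => fine (mu [set l]) * (P ^+ l) i j)).
Proof.
apply: nondecreasing_is_cvgn.
  apply: nondecreasing_series => l _ _; exact: term_ge0.
exists 1 => _ [n _ <-]; apply: le_trans (sum_gap_weight_le1 n).
rewrite /series /=; apply: ler_sum => l _; rewrite ler_piMr ?gap_weight_ge0//.
exact: stochastic_le1 (stochastic_exp l).
Qed.

Lemma G_nneseries i j :
  (\sum_(l <oo) (gap_weight l * (P ^+ l) i j)%:E)%E = (G_ mu P i j)%:E.
Proof.
rewrite mxE -EFin_lim; last exact: is_cvg_G_series.
by apply: congr_lim; apply/funext => n; rewrite /= sumEFin.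
Qed.

Lemma G_ge_term l i j : gap_weight l * (P ^+ l) i j <= G_ mu P i j.
Proof.
rewrite -lee_fin -G_nneseries.
have := @nneseries_lim_ge R (fun l => (gap_weight l * (P ^+ l) i j)%:E) predT 0 l.+1.
rewrite big_nat_recr//= => H; apply: le_trans (H _); last first.
  by move=> k _ _; rewrite lee_fin; exact: term_ge0.
rewrite leeDr// sume_ge0// => k _; rewrite lee_fin; exact: term_ge0.
Qed.

Lemma G_nneseries_cvg i j :
  series (fun l => gap_weight l * (P ^+ l) i j) @ \oo --> G_ mu P i j.
Proof. by rewrite mxE; exact: is_cvg_G_series. Qed.

Lemma series_gap_weight_cvg : series gap_weight @ \oo --> (1 : R).
Proof.
have c : cvgn (series gap_weight).
  apply: nondecreasing_is_cvgn.
    by apply: nondecreasing_series => l _ _; exact: gap_weight_ge0.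
  by exists 1 => _ [n _ <-]; exact: sum_gap_weight_le1.
suff <- : limn (series gap_weight) = 1 by [].
apply: EFin_inj; rewrite -EFin_lim// -nneseries_gap_weight.
by apply: congr_lim; apply/funext => n; rewrite /= sumEFin.
Qed.

(* Finite sums of the entries of [G_ mu P] are limits of finite sums of the
   entries of the powers of [P]. *)
Lemma G_sum_cvg (I : finType) (a : I -> R) (u v : I -> 'I_N) :
  series (fun l => gap_weight l * \sum_i a i * (P ^+ l) (u i) (v i)) @ \oo -->
  \sum_i a i * G_ mu P (u i) (v i).
Proof.
rewrite (_ : series _ = fun n => \sum_i a i *
    series (fun l => gap_weight l * (P ^+ l) (u i) (v i)) n); last first.
  apply/funext => n; rewrite /series /=; under [RHS]eq_bigr do rewrite mulr_sumr.
  rewrite exchange_big /=; apply: eq_bigr => l _; rewrite mulr_sumr.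
  by apply: eq_bigr => i _; rewrite mulrCA.
apply: cvg_big => [|i _]; first exact: add_continuous.
by apply: cvgMr; exact: G_nneseries_cvg.
Qed.

Lemma stochastic_G : stochastic (G_ mu P).
Proof.
split=> [i j|i].
  by apply: le_trans (G_ge_term 0 i j); exact: term_ge0.
have := @G_sum_cvg 'I_N (fun=> 1) (fun=> i) (fun j : 'I_N => j).
under [X in _ --> X -> _]eq_bigr do rewrite mul1r.
move/cvg_unique => /(_ (@norm_hausdorff _ _)); apply.
rewrite (_ : (fun l => _) = gap_weight); first exact: series_gap_weight_cvg.
apply/funext => l; under eq_bigr do rewrite mul1r.
by rewrite (stochastic_exp l).2 mulr1.
Qed.

Lemma G_comm : P *m G_ mu P = G_ mu P *m P.
Proof.
apply/matrixP => i j; rewrite !mxE.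
have c1 := @G_sum_cvg 'I_N (fun k => P i k) id (fun=> j).
have c2 := @G_sum_cvg 'I_N (fun k => P k j) (fun=> i) id.
under [RHS]eq_bigr do rewrite mulrC.
apply: cvg_unique c1 _ => //.
rewrite (_ : (fun l => _) = fun l => gap_weight l * \sum_k P k j * (P ^+ l) i k)//.
apply/funext => l; congr (_ * _).
have : (P * P ^+ l) i j = (P ^+ l * P) i j by rewrite -exprS exprSr.
by rewrite !mxE => ->; apply: eq_bigr => k _; rewrite mulrC.
Qed.

Lemma invariant_G (pi : 'rV[R]_N) : pi *m P = pi -> pi *m G_ mu P = pi.
Proof.
move=> piP; have piPl l : pi *m P ^+ l = pi.
  elim: l => [|l IH]; first by rewrite expr0 mulmx1.
  by rewrite exprS mulmxA piP.
apply/rowP => j; rewrite mxE.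
have := @G_sum_cvg 'I_N (fun k => pi 0 k) id (fun=> j).
move/cvg_unique => /(_ (@norm_hausdorff _ _)); apply.
rewrite (_ : (fun l => _) = fun l => gap_weight l * pi 0 j); last first.
  by apply/funext => l; congr (_ * _); have /rowP/(_ j) := piPl l; rewrite mxE.
rewrite (_ : series _ = fun n => series gap_weight n * pi 0 j); last first.
  by apply/funext => n; rewrite /series /= mulr_suml.
rewrite -[in X in [set x | _] X](mul1r (pi 0 j)) /=.
by apply: cvgMl; exact: series_gap_weight_cvg.
Qed.

End mixture_matrix.

(** * Markov property of the chain at random observation times *)

Section observed_chain.
Context {R : realType} (N : nat) d (Omega : measurableType d).
Variables (P : 'M[R]_N) (Pr : probability Omega R) (X : nat -> Omega -> 'I_N).
Variables (mu : probability nat R) (tau : nat -> {RV Pr >-> nat}).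
Hypothesis P_stoch : stochastic P.
Hypothesis hX : markov_chain Pr P X.
Hypothesis tau_indep : mutually_independent tau.
Hypothesis tau_law : identically_distributed tau mu.
Hypothesis Xtau : independent_of_gaps X tau.

Local Notation Y k := (fun w => observed X (fun j => tau j) w k).
Local Notation Q := (G_ mu P).

Let gaps_event (l : seq nat) : set Omega :=
  \bigcap_(i in [set` iota 0 (size l)]) (tau i @^-1` [set nth 0%N l i]).

Let time (l : seq nat) (k : nat) : nat := \sum_(i < k) nth 0%N l i.

Let state_set (l : seq nat) (y : nat -> 'I_N) : set (nat -> 'I_N) :=
  [set x | forall k, (k <= size l)%N -> x (time l k) = y k].

Let state_event l y : set Omega := [set w | state_set l y (fun k => X k w)].

Let fixed_event l y := gaps_event l `&` state_event l y.

Let time_mono l k k' : (k <= k')%N -> (time l k <= time l k')%N.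
Proof.
by move=> kk'; rewrite /time -(subnKC kk') big_split_ord /= leq_addr.
Qed.

Let state_set_depends l y : depends_upto (state_set l y) (time l (size l)).
Proof.
move=> x z xz lx k kl; rewrite -xz; first exact: lx.
exact: time_mono.
Qed.

Let time_rcons l a k : (k <= size l)%N -> time (rcons l a) k = time l k.
Proof.
move=> kl; apply: eq_bigr => i _.
by rewrite nth_rcons (leq_trans (ltn_ord i) kl).
Qed.

Let time_rcons_last l a : time (rcons l a) (size l).+1 = (time l (size l) + a)%N.
Proof.
rewrite /time big_ord_recr /= nth_rcons ltnn eqxx; congr (_ + _)%N.
by apply: eq_bigr => i _; rewrite nth_rcons ltn_ord.
Qed.

Let state_event_rcons l a y : state_event (rcons l a) y =
  state_event l y `&` X (time l (size l) + a)%N @^-1` [set y (size l).+1].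
Proof.
apply/seteqP; split => w; rewrite /state_event /state_set /= size_rcons.
  move=> H; split=> [k kl|]; first by rewrite -(time_rcons a kl) H// leqW.
  by rewrite -time_rcons_last H.
move=> [H1 H2] k; rewrite leq_eqVlt ltnS => /predU1P[->|kl].
  by rewrite time_rcons_last.
by rewrite time_rcons// H1.
Qed.

Let gaps_event_rcons l a : gaps_event (rcons l a) =
  gaps_event l `&` tau (size l) @^-1` [set a].
Proof.
apply/seteqP; split => w; rewrite /gaps_event size_rcons.
  move=> H; split=> [i /=|].
    rewrite mem_iota add0n => /= il.
    have := H i; rewrite /mkset mem_iota add0n /= nth_rcons il; apply.
    exact: ltnW.
  have := H (size l); rewrite /mkset mem_iota add0n /= nth_rcons ltnn eqxx; exact.
move=> [H1 H2] i; rewrite /mkset mem_iota add0n ltnS /= => il.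
rewrite nth_rcons; case: ltngtP il => // [il _|-> _ //].
by apply: H1; rewrite /= mem_iota add0n.
Qed.

Let measurable_gaps l : measurable (gaps_event l).
Proof.
apply: bigcap_measurableType => i _; exact: measurable_funPTI.
Qed.

Let measurable_state l y : measurable (state_event l y).
Proof. exact: (probability_path_event hX (@state_set_depends l y)).1. Qed.

Let gaps_event_prob l : Pr (gaps_event l) =
  (\prod_(i <- iota 0 (size l)) mu [set nth 0%N l i])%E.
Proof.
have H := tau_indep (s := iota 0 (size l)) (B := fun i => [set nth 0%N l i]).
rewrite /gaps_event H ?iota_uniq//.
by apply: eq_bigr => i _; rewrite -(tau_law i)//.
Qed.

Let gaps_event_prob_rcons l a :
  Pr (gaps_event (rcons l a)) = (Pr (gaps_event l) * mu [set a])%E.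
Proof.
rewrite !gaps_event_prob size_rcons -{1}addn1 iotaD big_cat /= big_seq1 add0n.
rewrite nth_rcons ltnn eqxx; congr (_ * _)%E.
rewrite big_seq [RHS]big_seq; apply: eq_bigr => i.
by rewrite mem_iota add0n => /= il; rewrite nth_rcons il.
Qed.

Let sigma_bigcap (I : choiceType) (G : set (set Omega)) (s : seq I) (F : I -> set Omega) :
  (forall i, i \in s -> <<s G >> (F i)) -> <<s G >> (\bigcap_(i in [set` s]) F i).
Proof.
move=> GF; have := @sigma_algebra_bigcap; move=> _.
rewrite -(setCK (bigcap _ _)) setC_bigcap; apply: sigma_algebraC.
rewrite bigcup_seq.
elim: s GF => [|i s IH] GF; first by rewrite big_nil; exact: sigma_algebra0.
rewrite big_cons -bigcup2E; apply: sigma_algebra_bigcup => -[|[|k]] /=.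
- by apply: sigma_algebraC; apply: GF; rewrite inE eqxx.
- by apply: IH => j js; apply: GF; rewrite inE js orbT.
- exact: sigma_algebra0.
Qed.

Let fixed_event_prob l y :
  Pr (fixed_event l y) = (Pr (gaps_event l) * Pr (state_event l y))%E.
Proof.
rewrite /fixed_event setIC muleC; apply: Xtau.
  rewrite (_ : state_event l y = \bigcap_(k in [set` iota 0 (size l).+1])
      (X (time l k) @^-1` [set y k])); last first.
    apply/seteqP; split => w H k.
      by rewrite /mkset mem_iota add0n ltnS => /= kl; exact: H.
    by move=> kl; apply: (H k); rewrite /mkset mem_iota add0n ltnS.
  apply: sigma_bigcap => k _; apply: sub_sigma_algebra.
  by exists (time l k), [set y k].
apply: sigma_bigcap => k _; apply: sub_sigma_algebra.
by exists k, [set nth 0%N l k].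
Qed.

Let fixed_event_prob_rcons l a y : Pr (fixed_event (rcons l a) y) =
  (Pr (fixed_event l y) *
   (gap_weight mu a * (P ^+ a) (y (size l)) (y (size l).+1))%:E)%E.
Proof.
rewrite !fixed_event_prob gaps_event_prob_rcons state_event_rcons.
rewrite (@markov_chain_steps R _ _ Pr N P X hX _ a (y (size l)) _ _
  (@state_set_depends l y)); last first.
  by move=> x Hx; exact: Hx.
by rewrite EFinM gap_weightE muleACA.
Qed.

(** The first gaps are prescribed by [l], the next [m] are free and only the observed states are
    imposed. For [m = 0] the observation times are known and independence gives a product; for empty
    [l] this is the event on which the law of the observed chain is read. *)
Let free_event l m y : set Omega :=
  fixed_event l y `&` [set w | forall k, (k <= size l + m)%N -> Y k w = y k].

Let observation_timeE l w : gaps_event l w ->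
  forall k, (k <= size l)%N -> observation_time (fun j => tau j) k w = time l k.
Proof.
move=> Gw k kl; apply: eq_bigr => i _.
by apply: (Gw i); rewrite /= mem_iota add0n (leq_trans (ltn_ord i)).
Qed.

Let free_event0 l y : free_event l 0 y = fixed_event l y.
Proof.
rewrite /free_event addn0; apply/seteqP; split=> w [] // Gw Xw; split => // k kl.
by rewrite /observed (observation_timeE Gw kl); exact: Xw.
Qed.

Let free_eventS l m y a :
  free_event l m.+1 y `&` tau (size l) @^-1` [set a] = free_event (rcons l a) m y.
Proof.
rewrite /free_event /fixed_event size_rcons addSnnS.
apply/seteqP; split => w.
  move=> [[[Gw Xw] Yw] ta].
  have Gw' : gaps_event (rcons l a) w by rewrite gaps_event_rcons.
  split => //; split => // k; rewrite size_rcons => kl.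
  have := Yw k; rewrite /observed (observation_timeE Gw') ?size_rcons//; apply.
  by rewrite (leq_trans kl)// -addSnnS leq_addr.
by rewrite gaps_event_rcons state_event_rcons => -[[[Gw ta] [Xw _]] Yw].
Qed.

(** Induction on [m] for all [l] at once: splitting according to the value [a] of the next gap moves
    it into the prescribed list, and the weights [mu a * P ^ a] sum to [G_ mu P]. *)
Let free_event_prob m l y : measurable (free_event l m y) /\
  Pr (free_event l m y) = (Pr (fixed_event l y) *
    (\prod_(i < m) Q (y (size l + i)%N) (y (size l + i).+1))%:E)%E.
Proof.
elim: m l => [|m IH] l.
  rewrite free_event0 big_ord0 mule1; split => //.
  exact: measurableI.
have mF : measurable (free_event l m.+1 y).
  rewrite (_ : free_event l m.+1 y = \bigcup_a free_event (rcons l a) m y).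
    by apply: bigcupT_measurable => a; exact: (IH _).1.
  apply/seteqP; split => [w Fw|w [a _]]; last by rewrite -free_eventS => -[].
  by exists (tau (size l) w) => //; rewrite -free_eventS.
split => //; rewrite (probability_split_nat Pr (Z := tau (size l)) mF); last first.
  by move=> a; exact: measurable_funPTI.
have mfix : measurable (fixed_event l y) by exact: measurableI.
pose c := fine (Pr (fixed_event l y)).
have cE : Pr (fixed_event l y) = c%:E by rewrite fineK// fin_num_measure.
pose p := \prod_(i < m) Q (y ((size l).+1 + i)%N) (y ((size l).+1 + i).+1).
have p0 : 0 <= p by apply: prodr_ge0 => i _; case: (stochastic_G mu P_stoch).
transitivity (\sum_(a <oo) ((c * p)%:E *
    (gap_weight mu a * (P ^+ a) (y (size l)) (y (size l).+1))%:E))%E.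
  apply: eq_eseriesr => a _; rewrite free_eventS (IH _).2 fixed_event_prob_rcons cE.
  by rewrite size_rcons -!EFinM mulrAC.
rewrite nneseriesZl; last first.
  move=> a _; rewrite lee_fin mulr_ge0 ?gap_weight_ge0//.
  by case: (stochastic_exp P_stoch a).
rewrite G_nneseries// cE -!EFinM -mulrA; congr (_ * _)%:E.
rewrite big_ord_recl addn0 mulrC; congr (_ * _).
by apply: eq_bigr => i _; rewrite /= addSnnS.
Qed.

Lemma observed_markov_chain : markov_chain Pr Q (fun k => Y k).
Proof.
have law t y : measurable [set w | forall l, (l <= t)%N -> Y l w = y l] /\
    Pr [set w | forall l, (l <= t)%N -> Y l w = y l] =
    (Pr (fixed_event [::] y) * (\prod_(i < t) Q (y i) (y i.+1))%:E)%E.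
  have := free_event_prob t [::] y; rewrite [size _]/=.
  suff -> : free_event [::] t y = [set w | forall l, (l <= t)%N -> Y l w = y l] by [].
  apply/seteqP; split => w; first by case.
  move=> Yw; split => //; split => // k; rewrite leqn0 => /eqP ->.
  have := Yw 0%N isT; rewrite /observed /observation_time /time.
  by rewrite !big_ord0.
split=> [m i|m x].
  have mT : measurable_fun setT (observation_time (fun j => tau j) m).
    elim: m => [|m IH].
      rewrite (_ : observation_time _ 0 = cst 0%N); last first.
        by apply/funext => w; rewrite /observation_time big_ord0.
      exact: measurable_cst.
    rewrite (_ : observation_time _ m.+1 =
       fun w => (observation_time (fun j => tau j) m w + tau m w)%N); last first.
      by apply/funext => w; rewrite /observation_time big_ord_recr.
    by apply: measurable_fun_addn.
  rewrite (_ : _ @^-1` _ = \bigcup_a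
     (observation_time (fun j => tau j) m @^-1` [set a] `&` X a @^-1` [set i])).
    apply: bigcupT_measurable => a; apply: measurableI; last exact: hX.1.
    by rewrite -[X in measurable X]setTI; apply: mT.
  by apply/seteqP; split => [w Xi|w [a _ [/= <-]]//];
    exists (observation_time (fun j => tau j) m w).
by rewrite (law _ _).2 (law _ _).2 big_ord_recr /= EFinM muleA.
Qed.

End observed_chain.

(** * Harmonic functions and positivity of the invariant law *)

Section irreducible_mixture.
Context {R : realType} (N : nat).

Lemma exp_pos_mul (P : 'M[R]_N) m l i j k : stochastic P ->
  0 < (P ^+ m) i j -> 0 < (P ^+ l) j k -> 0 < (P ^+ (m + l)) i k.
Proof.
move=> Ps Pij Pjk; rewrite exprD mxE (bigD1 j)//=.
apply: ltr_pwDl; first exact: mulr_gt0.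
by apply: sumr_ge0 => h _; rewrite mulr_ge0//; case: (stochastic_exp Ps m);
  case: (stochastic_exp Ps l).
Qed.

(* The return times of [i] hit every residue class modulo [l]: the smallest
   positive residue that they hit divides all of them, hence is 1. *)
Lemma aperiodic_residue (P : 'M[R]_N) i l r : stochastic P -> irreducible P -> aperiodic P ->
  (0 < l)%N -> exists m, 0 < (P ^+ m) i i /\ m = r %[mod l].
Proof.
move=> Ps Pirr Paper l0.
pose ret m := 0 < (P ^+ m) i i.
have ret0 : ret 0%N by rewrite /ret expr0 mxE eqxx.
have retD m1 m2 : ret m1 -> ret m2 -> ret (m1 + m2)%N by exact: exp_pos_mul.
have retM a m : ret m -> ret (a * m)%N.
  by move=> rm; elim: a => [//|a IH]; rewrite mulSn; exact: retD.
pose hit g := (0 < g)%N && `[< exists2 m, ret m & m = g %[mod l] >].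
have hitl : exists g, hit g.
  exists l; rewrite /hit l0 /=; apply/asboolP; exists 0%N => //.
  by rewrite modnn mod0n.
case: (ex_minnP hitl) => g /andP[g0 /asboolP[mg rmg mgE]] gmin.
have g1 : g = 1%N.
  apply: (Paper i) => m m0 rm.
  rewrite /dvdn; apply/eqP; case: (posnP (m %% g)) => // r0.
  suff : hit (m %% g)%N by move/gmin; rewrite leqNgt ltn_mod g0.
  (* Since [mg] is congruent to [g] modulo [l], adding [l.-1 * (m %/ g)] copies of it subtracts
     [(m %/ g) * g] modulo [l], which leaves the remainder of [m] modulo [g]. *)
  rewrite /hit r0; apply/asboolP; exists (m + (l.-1 * (m %/ g)) * mg)%N.
    by apply: retD => //; exact: retM.
  rewrite -modnDmr -modnMmr mgE modnMmr modnDmr.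
  rewrite {1}(divn_eq m g) addnAC -mulnA -mulSn prednK// addnC.
  by rewrite [(l * _)%N]mulnC addnC modnMDl.
exists (r * mg)%N; split; first exact: retM.
by rewrite -modnMmr mgE g1 modnMmr muln1.
Qed.

(** Maximum principle: [hmax] propagates the maximum along steps of length [l]. Every state can be
    reached from a maximizer in a multiple of [l] steps, by first returning to the maximizer in a
    time of the right residue. *)
Lemma harmonic_power_cst (P : 'M[R]_N) l (h : 'cV[R]_N) :
    stochastic P -> irreducible P -> aperiodic P -> (0 < l)%N ->
    (forall i j, 0 < (P ^+ l) i j -> (forall k, h k 0 <= h i 0) -> h j 0 = h i 0) ->
  exists a, h = const_mx a.
Proof.
move=> Ps Pirr Paper l0 hmax.
case: (posnP N) => [N0|N0].
  by exists 0; apply/colP => i; have := ltn_ord i; rewrite [X in (_ < X)%N]N0.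
have [i hi] : exists i, forall k, h k 0 <= h i 0.
  pose i := [arg max_(i > Ordinal N0) h i 0]%O.
  by exists i; rewrite /i; case: arg_maxP => // j _ jmax k; exact: jmax.
exists (h i 0); apply/colP => j; rewrite mxE.
have steps s k : 0 < (P ^+ (s * l)) i k -> h k 0 = h i 0.
  elim: s k => [|s IH] k.
    rewrite mul0n expr0 mxE; case: eqVneq => [-> //|_]; by rewrite ltxx.
  rewrite mulSnr exprD mxE => pos.
  have [k' pk'] : exists k', 0 < (P ^+ (s * l)) i k' * (P ^+ l) k' k.
    apply/existsP; apply: contraTT pos; rewrite negb_exists => /forallP H.
    by rewrite -leNgt; apply: sumr_le0 => k' _; rewrite leNgt.
  have P0 m a b : 0 <= (P ^+ m) a b by case: (stochastic_exp Ps m).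
  have p1 : 0 < (P ^+ (s * l)) i k'.
    by rewrite lt0r P0 andbT; apply: contraTneq pk' => ->; rewrite mul0r ltxx.
  have p2 : 0 < (P ^+ l) k' k.
    by rewrite lt0r P0 andbT; apply: contraTneq pk' => ->; rewrite mulr0 ltxx.
  rewrite -(IH _ p1); apply: hmax p2 _ => k''.
  by rewrite (IH _ p1).
have [m pm] := Pirr i j.
(* [l * m - m] represents [- m] modulo [l] without leaving the natural numbers. *)
have [m' [pm' m'E]] := aperiodic_residue i (l * m - m) Ps Pirr Paper l0.
have dv : (l %| m' + m)%N.
  rewrite /dvdn -modnDml m'E modnDml subnK ?modnMr//.
  by rewrite leq_pmull.
apply: (steps ((m' + m) %/ l)%N); rewrite divnK//.
exact: exp_pos_mul pm.
Qed.

(** As [mu] is not the Dirac mass at 0, it charges some [l > 0]. Every transition possible under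
    [P ^+ l] is then possible under the mixture, and at a maximizer an average can equal the maximum
    only if all reachable values do. *)
Lemma harmonic_G_cst (P : 'M[R]_N) (mu : probability nat R) (h : 'cV[R]_N) :
    stochastic P -> irreducible P -> aperiodic P ->
    (exists B : set nat, mu B <> \d_0%N B) ->
  G_ mu P *m h = h -> exists a, h = const_mx a.
Proof.
move=> Ps Pirr Paper mu0 hQ.
have [l l0 mul] : exists2 l, (0 < l)%N & 0 < gap_weight mu l.
  apply: contrapT => nl; case: mu0 => B; apply.
  have mul0 l : (0 < l)%N -> gap_weight mu l = 0.
    move=> l0; apply: contrapT => /eqP ml; apply: nl; exists l => //.
    by rewrite lt0r ml gap_weight_ge0.
  have wE l : mu [set l] = (l == 0%N)%:R%:E.
    rewrite -gap_weightE; case: l => [|l]; last by rewrite mul0.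
    have := nneseries_gap_weight mu; rewrite (nneseries_split 0 1); last first.
      by move=> k _; rewrite lee_fin gap_weight_ge0.
    rewrite add0n big_nat1 eseries0 ?adde0//.
    by move=> k k1 _; rewrite mul0.
  rewrite (probability_split_nat mu (Z := id))// diracE.
  rewrite (nneseries_split 0 1)//.
  rewrite add0n big_nat1 eseries0 ?adde0; last first.
    move=> k k1 _; apply/eqP; rewrite eq_le measure_ge0 andbT.
    apply: le_trans (le_measure _ _ _ (@subIsetr _ _ _)) _; rewrite ?inE//.
    by rewrite [X in (X <= _)%E]wE; case: k k1.
  case: (boolP (0%N \in B)) => [/set_mem B0|/negP B0].
    rewrite (_ : _ `&` _ = [set 0%N]) ?wE//.
    by apply/seteqP; split => [x []//|x /= ->].
  rewrite (_ : _ `&` _ = set0) ?measure0//.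
  by apply/seteqP; split => x //= [Bx x0]; apply: B0; rewrite inE -x0.
apply: (harmonic_power_cst Ps Pirr Paper l0) => i j pij imax.
have [Q0 Q1] := stochastic_G mu Ps.
have Qij : 0 < G_ mu P i j.
  by apply: lt_le_trans (G_ge_term mu Ps l i j); exact: mulr_gt0.
have : \sum_k G_ mu P i k * (h i 0 - h k 0) = 0.
  under eq_bigr do rewrite mulrBr.
  rewrite sumrB -mulr_suml Q1 mul1r; have /colP/(_ i) := hQ.
  by rewrite mxE => ->; rewrite subrr.
move/eqP; rewrite psumr_eq0; last by move=> k _; rewrite mulr_ge0// subr_ge0.
move/allP/(_ j (mem_index_enum j)); rewrite /= mulf_eq0 gt_eqF//= subr_eq0.
by move/eqP.
Qed.

Lemma invariant_gt0 (P : 'M[R]_N) (pi : 'rV[R]_N) :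
  stochastic P -> irreducible P -> invariant_distribution P pi -> forall j, 0 < pi 0 j.
Proof.
move=> Ps Pirr [pi0 pi1 piP] j.
have piPl l : pi *m P ^+ l = pi.
  elim: l => [|l IH]; first by rewrite expr0 mulmx1.
  by rewrite exprS mulmxA piP.
have [i pii] : exists i, 0 < pi 0 i.
  apply: contrapT => npi; have : (0 : R) = 1; last by move/eqP; rewrite eq_sym oner_eq0.
  rewrite -pi1 big1// => i _; apply/eqP; rewrite eq_le pi0 andbT leNgt.
  by apply/negP => pii; apply: npi; exists i.
have [m pm] := Pirr i j.
have /rowP/(_ j) := piPl m; rewrite mxE => <-.
rewrite (bigD1 i)//=; apply: ltr_pwDl; first exact: mulr_gt0.
by apply: sumr_ge0 => k _; rewrite mulr_ge0//; case: (stochastic_exp Ps m).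
Qed.

End irreducible_mixture.

(** * Orthogonal projections and their continuity *)

Section orthogonal_projections.
Context {R : realType}.

Definition sqnorm n (v : 'cV[R]_n) : R := \sum_i v i 0 ^+ 2.

Lemma euclidean_norm_sqr n (v : 'cV[R]_n) : euclidean_norm v ^+ 2 = sqnorm v.
Proof. by rewrite sqr_sqrtr// sumr_ge0// => i _; exact: sqr_ge0. Qed.

Lemma sqnormE n (v : 'cV[R]_n) : sqnorm v = (v^T *m v) 0 0.
Proof. by rewrite mxE; apply: eq_bigr => i _; rewrite mxE expr2. Qed.

Lemma sqnorm_ge0 n (v : 'cV[R]_n) : 0 <= sqnorm v.
Proof. by apply: sumr_ge0 => i _; exact: sqr_ge0. Qed.

Lemma sqnorm_eq0 n (v : 'cV[R]_n) : sqnorm v = 0 -> v = 0.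
Proof.
move/eqP; rewrite psumr_eq0 => [/allP v0|i _]; last exact: sqr_ge0.
apply/colP => i; have := v0 i (mem_index_enum i).
by rewrite sqrf_eq0 [RHS]mxE => /eqP.
Qed.

Lemma sqnormD_orth n (u v : 'cV[R]_n) : u^T *m v = 0 -> sqnorm (u + v) = sqnorm u + sqnorm v.
Proof.
move=> uv; have vu : v^T *m u = 0 by apply: trmx_inj; rewrite trmx_mul trmxK uv !trmx0.
rewrite !sqnormE (_ : (u + v)^T = u^T + v^T); last by rewrite linearD.
rewrite mulmxDl !mulmxDr uv vu addr0 add0r.
by rewrite [LHS]mxE.
Qed.

Lemma sqnormN n (v : 'cV[R]_n) : sqnorm (- v) = sqnorm v.
Proof. by apply: eq_bigr => i _; rewrite mxE sqrrN. Qed.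

Lemma sqnormZ n (a : R) (v : 'cV[R]_n) : sqnorm (a *: v) = a ^+ 2 * sqnorm v.
Proof. by rewrite mulr_sumr; apply: eq_bigr => i _; rewrite mxE exprMn. Qed.

Lemma mulmx_cV_inj m n (A B : 'M[R]_(m, n)) : (forall v : 'cV_n, A *m v = B *m v) -> A = B.
Proof.
by move=> AB; apply/matrixP => i j; have /colP/(_ i) := AB (delta_mx j 0);
  rewrite -!colE !mxE.
Qed.

Lemma sub_orthogonal_compl d n (w : 'rV[R]_n) (U : 'M[R]_(d, n)) :
  (w <= orthogonal_compl U)%MS = (w *m U^T == 0).
Proof. by apply/sub_kermxP/eqP. Qed.

Lemma orthogonal_compl_orth d n (u w : 'cV[R]_n) (U : 'M[R]_(d, n)) :
  (u^T <= U)%MS -> (w^T <= orthogonal_compl U)%MS -> w^T *m u = 0.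
Proof.
case/submxP => D uD; rewrite sub_orthogonal_compl => /eqP wU.
by rewrite -[u]trmxK uD trmx_mul mulmxA wU mul0mx.
Qed.

Lemma orthogonal_complS d1 d2 n (U : 'M[R]_(d1, n)) (V : 'M[R]_(d2, n)) :
  (U <= V)%MS -> (orthogonal_compl V <= orthogonal_compl U)%MS.
Proof.
case/submxP => D ->; apply/sub_kermxP.
by rewrite trmx_mul mulmxA mulmx_ker mul0mx.
Qed.

Lemma orthogonal_proj_unique n (F : 'M[R]_n) (v u : 'cV[R]_n) :
  (u^T <= F)%MS -> ((v - u)^T <= orthogonal_compl F)%MS -> orthogonal_proj F *m v = u.
Proof.
move=> uF vuF; set w := _ *m v.
have wF : (w^T <= F)%MS := orthogonal_proj_sub F v.
have vwF := orthogonal_proj_compl F v.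
suff : ((w - u)^T <= F :&: orthogonal_compl F)%MS.
  rewrite orthogonal_cap0 submx0 => /eqP wu; apply/eqP; rewrite -subr_eq0; apply/eqP.
  by apply: trmx_inj; rewrite wu trmx0.
rewrite sub_capmx; apply/andP; split; first by rewrite linearB /= addmx_sub// eqmx_opp.
rewrite (_ : w - u = (v - u) - (v - w)); last by rewrite opprB [RHS]addrC subrKA.
by rewrite linearB /= addmx_sub// eqmx_opp.
Qed.

(** The projector onto the row space of [U] by the normal equations. It is a rational function of
    the entries of [U], hence continuous wherever the rows remain independent. *)
Definition gram_proj m n (U : 'M[R]_(m, n)) : 'M[R]_n := U^T *m invmx (U *m U^T) *m U.

Lemma row_free_gram m n (U : 'M[R]_(m, n)) : row_free U = (U *m U^T \in unitmx).
Proof.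
apply/idP/idP => [Uf|].
  rewrite -row_free_unit; apply: inj_row_free => v vUU.
  apply/eqP; rewrite -(mulmx_free_eq0 _ Uf); apply/eqP.
  have : sqnorm (v *m U)^T = 0.
    by rewrite sqnormE trmxK trmx_mul -mulmxA (mulmxA U) (mulmxA v) vUU mul0mx mxE.
  by move/sqnorm_eq0 => H; apply: trmx_inj; rewrite H trmx0.
rewrite -row_free_unit => UUf; apply: inj_row_free => v vU.
by apply/eqP; rewrite -(mulmx_free_eq0 _ UUf) mulmxA vU mul0mx.
Qed.

Lemma orthogonal_proj_gram m n (U : 'M[R]_(m, n)) (F : 'M[R]_n) :
  row_free U -> (F :=: U)%MS -> orthogonal_proj F = gram_proj U.
Proof.
rewrite row_free_gram => Uu FU; apply: mulmx_cV_inj => v; apply: orthogonal_proj_unique.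
  by rewrite FU /gram_proj -!mulmxA trmx_mul trmxK submxMl.
have : ((v - gram_proj U *m v)^T <= orthogonal_compl U)%MS.
  rewrite sub_orthogonal_compl -trmx_mul mulmxBr /gram_proj !mulmxA mulmxV//.
  by rewrite mul1mx subrr trmx0.
by move/submx_trans; apply; apply: orthogonal_complS; rewrite FU.
Qed.

Section nested.
Variables (n d0 d1 : nat) (E0 : 'M[R]_(d0, n)) (E : 'M[R]_(d1, n)).
Hypothesis E0E : (E0 <= E)%MS.
Let F : 'M[R]_n := (E :&: orthogonal_compl E0)%MS.

Lemma orthogonal_proj_genmx_sub d (U : 'M[R]_(d, n)) (v : 'cV[R]_n) :
  ((orthogonal_proj <<U>>%MS *m v)^T <= U)%MS.
Proof. by rewrite -(genmxE U) orthogonal_proj_sub. Qed.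

Lemma orthogonal_proj_genmx_compl d (U : 'M[R]_(d, n)) (v : 'cV[R]_n) :
  ((v - orthogonal_proj <<U>>%MS *m v)^T <= orthogonal_compl U)%MS.
Proof.
apply: submx_trans (orthogonal_proj_compl _ _) _; apply: orthogonal_complS.
by rewrite genmxE.
Qed.

(** This turns the projector onto an intersection with an orthogonal complement into two projectors
    onto images, for which a Gram formula is available. *)
Lemma orthogonal_proj_nested :
  orthogonal_proj F = orthogonal_proj <<E>>%MS - orthogonal_proj <<E0>>%MS.
Proof.
apply: mulmx_cV_inj => v; rewrite mulmxBl.
set a := orthogonal_proj <<E>>%MS *m v; set a0 := orthogonal_proj <<E0>>%MS *m v.
have aE : (a^T <= E)%MS := orthogonal_proj_genmx_sub E v.
have a0E0 : (a0^T <= E0)%MS := orthogonal_proj_genmx_sub E0 v.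
have vaE : ((v - a)^T <= orthogonal_compl E)%MS := orthogonal_proj_genmx_compl E v.
have va0E0 : ((v - a0)^T <= orthogonal_compl E0)%MS := orthogonal_proj_genmx_compl E0 v.
have subB d (x y : 'cV[R]_n) (U : 'M[R]_(d, n)) :
    (x^T <= U)%MS -> (y^T <= U)%MS -> ((x - y)^T <= U)%MS.
  by move=> xU yU; rewrite linearB /= addmx_sub// eqmx_opp.
apply: orthogonal_proj_unique.
  rewrite /F sub_capmx; apply/andP; split.
    exact: subB aE (submx_trans a0E0 E0E).
  rewrite (_ : a - a0 = (v - a0) - (v - a)); last by rewrite opprB [RHS]addrC subrKA.
  exact: subB va0E0 (submx_trans vaE (orthogonal_complS E0E)).
rewrite (_ : v - (a - a0) = (v - a) - (- a0)); last by rewrite opprK opprB addrA addrAC.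
apply: subB; first by apply: submx_trans vaE (orthogonal_complS _); exact: capmxSl.
rewrite linearN /= eqmx_opp sub_orthogonal_compl; apply/eqP; apply: trmx_inj.
rewrite trmx0 trmx_mul !trmxK.
have /submxP[D ->] : (F <= orthogonal_compl E0)%MS by exact: capmxSr.
have /submxP[D' a0E] := a0E0.
by rewrite -[a0]trmxK a0E trmx_mul mulmxA -(mulmxA D) mulmx_ker mulmx0 mul0mx.
Qed.

Lemma sqnorm_proj_nested (v : 'cV[R]_n) :
  sqnorm (v - orthogonal_proj <<E0>>%MS *m v) - sqnorm (v - orthogonal_proj <<E>>%MS *m v) =
  sqnorm (orthogonal_proj F *m v).
Proof.
set a0 := _ *m v; set a := orthogonal_proj <<E>>%MS *m v.
have Fv : orthogonal_proj F *m v = a - a0 by rewrite orthogonal_proj_nested mulmxBl.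
have -> : v - a0 = (v - a) + (a - a0) by rewrite addrA subrK.
rewrite sqnormD_orth; first by rewrite Fv addrAC subrr add0r.
apply: (@orthogonal_compl_orth _ _ _ _ E); last exact: orthogonal_proj_genmx_compl.
by rewrite -Fv; apply: submx_trans (orthogonal_proj_sub _ _) (capmxSl _ _).
Qed.

End nested.

Lemma inf_eq (S : set R) (s : R) : S s -> lbound S s -> inf S = s.
Proof.
move=> Ss lb; apply/eqP; rewrite eq_le; apply/andP; split.
  by apply: ge_inf => //; exists s.
by apply: lb_le_inf => //; exists s.
Qed.

(** Least squares: the residual [r] is orthogonal to the image of [D *m Phi], so Pythagoras applies.
    That [r] is attained in [M] is kept as a conclusion because under the alternative it makes the
    infimum positive. *)
Lemma inf_sqnorm_affine n m d (D : 'M[R]_(m, n)) (Phi : 'M[R]_(n, d))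
    (m0 : 'cV[R]_n) (M : set 'cV[R]_n) :
    (forall v, M v <-> exists x : 'cV_d, v = m0 + Phi *m x) ->
  let r := D *m m0 - orthogonal_proj <<(D *m Phi)^T>>%MS *m (D *m m0) in
  inf [set euclidean_norm (D *m v) ^+ 2 | v in M] = sqnorm r /\
  exists2 v, M v & D *m v = r.
Proof.
move=> ME r; pose E := (D *m Phi)^T.
have [v Mv Dv] : exists2 v, M v & D *m v = r.
  have /submxP[x xE] := orthogonal_proj_genmx_sub E (D *m m0).
  exists (m0 - Phi *m x^T); first by apply/ME; exists (- x^T); rewrite mulmxN.
  rewrite mulmxBr /r; congr (_ - _); apply: trmx_inj.
  by rewrite xE /E mulmxA trmx_mul trmxK.
split; last by exists v.
apply: inf_eq; first by exists v => //; rewrite euclidean_norm_sqr Dv.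
move=> _ [w /ME[x ->] <-]; rewrite euclidean_norm_sqr mulmxDr mulmxA.
have -> : D *m m0 + D *m Phi *m x = r + (orthogonal_proj <<E>>%MS *m (D *m m0) + D *m Phi *m x).
  by rewrite /r addrA subrK.
rewrite (sqnormD_orth (u := r)) ?lerDl ?sqnorm_ge0//.
apply: (@orthogonal_compl_orth _ _ _ _ E); last exact: orthogonal_proj_genmx_compl.
rewrite linearD /= addmx_sub ?orthogonal_proj_genmx_sub//.
by rewrite trmx_mul submxMl.
Qed.

End orthogonal_projections.

Section entrywise_convergence.
Context {R : realType} {T : Type} (F : set_system T) {FF : Filter F}.

(** Stated for an arbitrary filter, so that the same calculus serves for parameters close to the
    true ones and for convergence in probability. *)
Definition mxcvg m n (A : T -> 'M[R]_(m, n)) (A0 : 'M[R]_(m, n)) : Prop :=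
  forall i j, A t i j @[t --> F] --> A0 i j.

Lemma mxcvg_cst m n (A0 : 'M[R]_(m, n)) : mxcvg (fun=> A0) A0.
Proof. by move=> i j; exact: cvg_cst. Qed.

Lemma mxcvgD m n (A B : T -> 'M[R]_(m, n)) A0 B0 :
  mxcvg A A0 -> mxcvg B B0 -> mxcvg (fun t => A t + B t) (A0 + B0).
Proof. by move=> hA hB i j; under eq_fun do rewrite mxE; rewrite mxE; apply: cvgD. Qed.

Lemma mxcvgN m n (A : T -> 'M[R]_(m, n)) A0 :
  mxcvg A A0 -> mxcvg (fun t => - A t) (- A0).
Proof. by move=> hA i j; under eq_fun do rewrite mxE; rewrite mxE; apply: cvgN. Qed.

Lemma mxcvgB m n (A B : T -> 'M[R]_(m, n)) A0 B0 :
  mxcvg A A0 -> mxcvg B B0 -> mxcvg (fun t => A t - B t) (A0 - B0).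
Proof. by move=> hA hB; apply: mxcvgD => //; exact: mxcvgN. Qed.

Lemma mxcvg_tr m n (A : T -> 'M[R]_(m, n)) A0 :
  mxcvg A A0 -> mxcvg (fun t => (A t)^T) A0^T.
Proof. by move=> hA i j; under eq_fun do rewrite mxE; rewrite mxE; exact: hA. Qed.

Lemma mxcvgM m n p (A : T -> 'M[R]_(m, n)) (B : T -> 'M[R]_(n, p)) A0 B0 :
  mxcvg A A0 -> mxcvg B B0 -> mxcvg (fun t => A t *m B t) (A0 *m B0).
Proof.
move=> hA hB i j; under eq_fun do rewrite mxE; rewrite mxE.
by apply: cvg_big => [|k _]; [exact: add_continuous|exact: cvgM].
Qed.

Lemma mxcvg_sub m n p q (f : 'I_p -> 'I_m) (g : 'I_q -> 'I_n) (A : T -> 'M[R]_(m, n)) A0 :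
  mxcvg A A0 -> mxcvg (fun t => mxsub f g (A t)) (mxsub f g A0).
Proof. by move=> hA i j; under eq_fun do rewrite mxE; rewrite mxE; exact: hA. Qed.

Lemma mxcvg_det n (A : T -> 'M[R]_n) A0 : mxcvg A A0 -> \det (A t) @[t --> F] --> \det A0.
Proof.
move=> hA; apply: cvg_big => [|s _]; first exact: add_continuous.
apply: cvgMr; apply: cvg_big => [|i _]; [exact: mul_continuous|exact: hA].
Qed.

Lemma mxcvg_adj n (A : T -> 'M[R]_n) A0 : mxcvg A A0 -> mxcvg (fun t => \adj (A t)) (\adj A0).
Proof.
move=> hA i j; under eq_fun do rewrite mxE; rewrite mxE; apply: cvgMr.
apply: mxcvg_det => k l; under eq_fun do rewrite !mxE; rewrite !mxE; exact: hA.
Qed.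

Lemma mxcvg_near_unit n (A : T -> 'M[R]_n) A0 : mxcvg A A0 -> A0 \in unitmx ->
  \forall t \near F, A t \in unitmx.
Proof.
move=> hA; rewrite unitmxE unitfE => d0.
have /cvgrPdist_lt := mxcvg_det hA.
move=> /(_ `|\det A0|); rewrite normr_gt0 => /(_ d0); apply: filterS => t.
by rewrite unitmxE unitfE; apply: contraTneq => ->; rewrite subr0 ltxx.
Qed.

Lemma mxcvg_near m n (A B : T -> 'M[R]_(m, n)) A0 :
  (\forall t \near F, A t = B t) -> mxcvg B A0 -> mxcvg A A0.
Proof.
move=> AB hB i j; apply: cvg_trans (hB i j); apply: near_eq_cvg.
by apply: filterS AB => t ->.
Qed.

Lemma mxcvgV n (A : T -> 'M[R]_n) A0 : mxcvg A A0 -> A0 \in unitmx ->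
  mxcvg (fun t => invmx (A t)) (invmx A0).
Proof.
move=> hA A0u; rewrite {2}/invmx A0u.
apply: (@mxcvg_near _ _ _ (fun t => (\det (A t))^-1 *: \adj (A t))).
  by apply: filterS (mxcvg_near_unit hA A0u) => t Au; rewrite /invmx Au.
move=> i j; under eq_fun do rewrite mxE; rewrite mxE; apply: cvgM.
  apply: cvgV; last exact: mxcvg_det.
  by rewrite -unitfE -unitmxE.
exact: mxcvg_adj.
Qed.

Lemma mxcvg_gram_proj m n (U : T -> 'M[R]_(m, n)) U0 : mxcvg U U0 -> row_free U0 ->
  mxcvg (fun t => gram_proj (U t)) (gram_proj U0).
Proof.
move=> hU; rewrite row_free_gram => U0u; apply: mxcvgM => //; apply: mxcvgM.
  exact: mxcvg_tr.
by apply: mxcvgV => //; apply: mxcvgM => //; exact: mxcvg_tr.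
Qed.

Lemma mxcvg_Delta N (A : T -> 'M[R]_N) A0 : mxcvg A A0 -> mxcvg (fun t => Delta (A t)) (Delta A0).
Proof.
move=> hA; apply: mxcvgB => i j; under eq_fun do rewrite mxE; rewrite mxE; apply: cvgM.
- exact: cvg_cst.
- exact: hA.
- under eq_fun do rewrite mxE; rewrite mxE; exact: hA.
- exact: cvg_cst.
Qed.

Lemma mxcvg_sqnorm n (v : T -> 'cV[R]_n) v0 : mxcvg v v0 -> sqnorm (v t) @[t --> F] --> sqnorm v0.
Proof.
move=> hv; rewrite /sqnorm; apply: cvg_big => [|i _]; first exact: add_continuous.
by under eq_fun do rewrite expr2; rewrite expr2; apply: cvgM; exact: hv.
Qed.

Lemma mxcvg_near_bound m n (A : T -> 'M[R]_(m, n)) A0 (e : R) : mxcvg A A0 -> 0 < e ->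
  \forall t \near F, forall i j, `|A t i j - A0 i j| <= e.
Proof.
move=> hA e0.
have : \forall t \near F, forall ij : 'I_m * 'I_n, `|A t ij.1 ij.2 - A0 ij.1 ij.2| <= e.
  apply: filter_forall => -[i j] /=.
  have /cvgrPdist_le/(_ e e0) := hA i j.
  by apply: filterS => t; rewrite distrC.
by apply: filterS => t H i j; exact: (H (i, j)).
Qed.

End entrywise_convergence.

(** * The difference of constrained infima as a function of the transition matrix *)

Section contrast_statistic.
Context {R : realType} (N : nat).
Variables (Q : 'M[R]_N) (r k d : nat).
Variables (A : 'M[R]_(r, N * N)) (b : 'cV[R]_r) (A0 : 'M[R]_(k, N * N)) (b0 : 'cV[R]_k).
Variables (M M0 : set 'cV[R]_(N * N)) (p0 : 'cV[R]_(N * N)).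
Variables (Phi0 : 'M[R]_(N * N, d - k)) (Phi1 : 'M[R]_(N * N, k)) (Phi : 'M[R]_(N * N, d - k + k)).
Hypothesis hM : M = [set m | A *m m = b].
Hypothesis hM0 : M0 = [set m | A *m m = b /\ A0 *m m = b0].
Hypothesis hp0 : M0 p0.
Hypothesis hPhi0 : is_basis Phi0 (Ker A :&: Ker A0)%MS.
Hypothesis hPhi : Phi = row_mx Phi0 Phi1.
Hypothesis hPhi_basis : is_basis Phi (Ker A).
Hypothesis hA1 : Com Q `&` [set m | A *m m = 0] `&` [set m | A0 *m m = 0] = [set 0].
Hypothesis hA2 : is_max
    [set \rank (Delta Q' *m Phi) | Q' in
       [set Q' : 'M[R]_N | Q' *m const_mx 1 = const_mx 1 :> 'cV[R]_N /\
                           supp Q' `<=` supp Q]]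
    (\rank (Delta Q *m Phi)).

Lemma sub_Ker m n (B : 'M[R]_(m, n)) (v : 'cV[R]_n) : (v^T <= Ker B)%MS = (B *m v == 0).
Proof.
apply/sub_kermxP/eqP; first by rewrite -trmx_mul => /(congr1 trmx); rewrite trmxK trmx0.
by rewrite -trmx_mul => ->; rewrite trmx0.
Qed.

Lemma basis_imageP n e dd (Ph : 'M[R]_(n, dd)) (U : 'M[R]_(e, n)) (v : 'cV[R]_n) :
  is_basis Ph U -> (v^T <= U)%MS <-> exists x : 'cV_dd, v = Ph *m x.
Proof.
case/andP => _ /eqmxP PhU; rewrite -PhU; split => [/submxP[x vx]|[x ->]].
  by exists x^T; apply: trmx_inj; rewrite vx trmx_mul trmxK.
by rewrite trmx_mul submxMl.
Qed.

Lemma M_affine m0 : M m0 -> forall v, M v <-> exists x : 'cV_(d - k + k), v = m0 + Phi *m x.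
Proof.
rewrite hM /= => m0b v; split => [vb|[x ->]].
  have [|x vx] := (basis_imageP (v - m0) hPhi_basis).1 (_ : ((v - m0)^T <= Ker A)%MS).
    by rewrite sub_Ker mulmxBr vb m0b subrr.
  by exists x; rewrite -vx addrC subrK.
have : ((Phi *m x)^T <= Ker A)%MS by apply/(basis_imageP _ hPhi_basis); exists x.
by rewrite sub_Ker mulmxDr m0b => /eqP ->; rewrite addr0.
Qed.

Lemma M0_affine m0 : M0 m0 -> forall v, M0 v <-> exists x : 'cV_(d - k), v = m0 + Phi0 *m x.
Proof.
rewrite hM0 /= => -[m0b m0b0] v; split => [[vb vb0]|[x ->]].
  have [|x vx] := (basis_imageP (v - m0) hPhi0).1 (_ : ((v - m0)^T <= Ker A :&: Ker A0)%MS).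
    by rewrite sub_capmx !sub_Ker !mulmxBr vb m0b vb0 m0b0 !subrr !eqxx.
  by exists x; rewrite -vx addrC subrK.
have : ((Phi0 *m x)^T <= Ker A :&: Ker A0)%MS by apply/(basis_imageP _ hPhi0); exists x.
rewrite sub_capmx !sub_Ker !mulmxDr m0b m0b0 => /andP[/eqP -> /eqP ->].
by rewrite !addr0.
Qed.

Local Notation E0 Q' := (Defs.Im (Delta Q' *m Phi0)).
Local Notation E Q' := (Defs.Im (Delta Q' *m Phi)).
Local Notation PF Q' := (orthogonal_proj (F_space Phi Phi0 Q')).

Lemma E0_sub_E Q' : (E0 Q' <= E Q')%MS.
Proof.
rewrite /Defs.Im hPhi mul_mx_row tr_row_mx; apply: submx_trans (addsmxSl _ (Delta Q' *m Phi1)^T) _.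
by rewrite addsmxE.
Qed.

Definition contrast (Q' : 'M[R]_N) : R :=
  inf [set euclidean_norm (Delta Q' *m m) ^+ 2 | m in M0] -
  inf [set euclidean_norm (Delta Q' *m m) ^+ 2 | m in M].

(** A common point of [M] and [M0] serves as base point of both affine spaces, so the two residuals
    are those of one vector with respect to nested subspaces. *)
Lemma contrast_null Q' p : M p -> M0 p -> contrast Q' = sqnorm (PF Q' *m (Delta Q' *m p)).
Proof.
move=> Mp M0p; rewrite /contrast.
have [-> _] := inf_sqnorm_affine (Delta Q') (M_affine Mp).
have [-> _] := inf_sqnorm_affine (Delta Q') (M0_affine M0p).
exact: sqnorm_proj_nested (E0_sub_E Q') _.
Qed.

Lemma Delta_commuting (P Q' : 'M[R]_N) : P *m Q = Q *m P ->
  Delta Q' *m vec P = - (Delta P *m vec (Q' - Q)).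
Proof.
move=> PQ; rewrite !Delta_vec mulmxBr mulmxBl PQ opprB addrA subrK.
by apply/colP => i; rewrite !mxE opprB.
Qed.

(** A combination of the columns of [Phi0] killed by [Delta Q] commutes with [Q], hence vanishes by
    (A1). The Gram matrix in [hat_p] is therefore invertible at [Q]. *)
Lemma E0_row_free : row_free (E0 Q).
Proof.
apply: inj_row_free => v vE.
have Dv : Delta Q *m (Phi0 *m v^T) = 0.
  by apply: trmx_inj; rewrite mulmxA trmx_mul trmxK -/(Defs.Im _) vE trmx0.
have : ((Phi0 *m v^T)^T <= Ker A :&: Ker A0)%MS.
  by apply/(basis_imageP _ hPhi0); exists v^T.
rewrite sub_capmx !sub_Ker => /andP[/eqP Av /eqP A0v].
have : (Com Q `&` [set m | A *m m = 0] `&` [set m | A0 *m m = 0]) (Phi0 *m v^T).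
  split => //; split => //; exists (unvec (Phi0 *m v^T)); last by rewrite unvecK.
  rewrite /= /comm_mx; apply/eqP; rewrite -subr_eq0; apply/eqP.
  apply: (can_inj (@vecK R N)); rewrite -Delta_vec unvecK Dv.
  by apply/colP => i; rewrite !mxE.
rewrite hA1 /= => Phv; case/andP: hPhi0 => fr _.
by apply/eqP; rewrite -(mulmx_free_eq0 _ fr); apply/eqP; apply: trmx_inj;
  rewrite trmx_mul trmxK Phv trmx0.
Qed.

Variable pi : 'rV[R]_N.
Hypothesis pi_gt0 : forall i, 0 < pi 0 i.

Definition close_parameters (dl : R) : set ('M[R]_N * 'rV[R]_N) :=
  [set t : 'M[R]_N * 'rV[R]_N | [/\ forall i j, `|t.1 i j - Q i j| <= dl,
     forall i, `|t.2 0 i - pi 0 i| <= dl,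
     t.1 *m const_mx 1 = const_mx 1 :> 'cV[R]_N & supp t.1 `<=` supp Q]].

(** The neighbourhoods of the true parameters are cut down to matrices with unit row sums and
    support in that of [Q], the class on which (A2) bounds the rank. *)
Definition parameter_filter : set_system ('M[R]_N * 'rV[R]_N) :=
  filter_from [set dl : R | 0 < dl] close_parameters.

Global Instance parameter_filter_filter : Filter parameter_filter.
Proof.
apply: filter_from_filter; first by exists 1; exact: ltr01.
move=> i j i0 j0; exists (Num.min i j); first by rewrite /= lt_min i0.
move=> t [h1 h2 h3 h4]; split; split => //.
- by move=> a c; rewrite (le_trans (h1 a c))// ge_min lexx.
- by move=> a; rewrite (le_trans (h2 a))// ge_min lexx.
- by move=> a c; rewrite (le_trans (h1 a c))// ge_min lexx orbT.
- by move=> a; rewrite (le_trans (h2 a))// ge_min lexx orbT.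
Qed.

Local Notation PFil := parameter_filter.

Lemma mxcvg_fst : mxcvg PFil fst Q.
Proof.
move=> i j; apply/cvgrPdist_le => e e0; exists e => // t [h _ _ _].
by rewrite distrC.
Qed.

Lemma mxcvg_snd : mxcvg PFil snd pi.
Proof.
move=> i j; apply/cvgrPdist_le => e e0; exists e => // t [_ h _ _].
by rewrite distrC (ord1 i).
Qed.

Lemma mxcvg_E m (B : 'M[R]_(N * N, m)) : 
  mxcvg PFil (fun t => Defs.Im (Delta t.1 *m B)) (Defs.Im (Delta Q *m B)).
Proof.
apply: mxcvg_tr; apply: mxcvgM; last exact: mxcvg_cst.
by apply: mxcvg_Delta; exact: mxcvg_fst.
Qed.

Lemma mxcvg_row_free m n (U : 'M[R]_N * 'rV[R]_N -> 'M[R]_(m, n)) U0 :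
  mxcvg PFil U U0 -> row_free U0 -> \forall t \near PFil, row_free (U t).
Proof.
move=> hU; rewrite row_free_gram => U0u.
have : mxcvg PFil (fun t => U t *m (U t)^T) (U0 *m U0^T).
  by apply: mxcvgM => //; exact: mxcvg_tr.
by move/mxcvg_near_unit => /(_ U0u); apply: filterS => t; rewrite row_free_gram.
Qed.

Lemma mxcvg_proj_E0 :
  mxcvg PFil (fun t => orthogonal_proj <<E0 t.1>>%MS) (orthogonal_proj <<E0 Q>>%MS).
Proof.
rewrite (orthogonal_proj_gram E0_row_free (genmxE _)).
apply: (mxcvg_near (B := fun t => gram_proj (E0 t.1))).
  have : \forall t \near PFil, row_free (E0 t.1).
    by apply: mxcvg_row_free E0_row_free; exact: mxcvg_E.
  apply: filterS => t fr.
  exact: orthogonal_proj_gram fr (genmxE _).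
by apply: mxcvg_gram_proj; [exact: mxcvg_E|exact: E0_row_free].
Qed.

(* By (A2) the rank of [Delta Q' *m Phi] cannot exceed its value at [Q], so the
   rows of [E Q] chosen as a basis still give a basis of [E Q'] nearby. *)
Lemma mxcvg_proj_E :
  mxcvg PFil (fun t => orthogonal_proj <<E t.1>>%MS) (orthogonal_proj <<E Q>>%MS).
Proof.
pose f := maxrankfun (E Q).
pose B Q' := rowsub f (E Q').
have BQ : (<<E Q>> :=: B Q)%MS.
  by apply: eqmx_trans (genmxE _) _; apply: eqmx_sym; exact: eq_maxrowsub.
have fr : row_free (B Q) by exact: maxrowsub_free.
have cvB : mxcvg PFil (fun t => B t.1) (B Q).
  by apply: mxcvg_sub; exact: mxcvg_E.
rewrite (orthogonal_proj_gram fr BQ).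
apply: (mxcvg_near (B := fun t => gram_proj (B t.1))); last exact: mxcvg_gram_proj.
have near1 : \forall t \near PFil,
    t.1 *m const_mx 1 = const_mx 1 :> 'cV[R]_N /\ supp t.1 `<=` supp Q.
  by exists 1; [exact: ltr01|move=> t []].
apply: filterS2 (mxcvg_row_free cvB fr) near1 => t frt ht.
apply: orthogonal_proj_gram => //; apply: eqmx_trans (genmxE _) _.
apply: eqmx_sym; apply/eqmxP.
have sub : (B t.1 <= E t.1)%MS by exact: rowsub_sub.
rewrite -(geq_leqif (mxrank_leqif_eq sub)) (eqnP frt).
by rewrite /Defs.Im !mxrank_tr; apply: hA2.2; exists t.1.
Qed.

Lemma mxcvg_PF : mxcvg PFil (fun t => PF t.1) (PF Q).
Proof.
have PFE Q' : PF Q' = orthogonal_proj <<E Q'>>%MS - orthogonal_proj <<E0 Q'>>%MS.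
  exact: orthogonal_proj_nested (E0_sub_E Q').
rewrite PFE.
apply: (mxcvg_near (B := fun t => orthogonal_proj <<E t.1>>%MS - orthogonal_proj <<E0 t.1>>%MS)).
  by apply: nearW => t; rewrite PFE.
by apply: mxcvgB; [exact: mxcvg_proj_E|exact: mxcvg_proj_E0].
Qed.

Let gramE Q' : Phi0^T *m (Delta Q')^T *m Delta Q' *m Phi0 = E0 Q' *m (E0 Q')^T.
Proof. by rewrite /Defs.Im trmxK trmx_mul !mulmxA. Qed.

Lemma mxcvg_hat_p : mxcvg PFil (fun t => hat_p Phi0 p0 t.1) (hat_p Phi0 p0 Q).
Proof.
have cD : mxcvg PFil (fun t => Delta t.1) (Delta Q) by apply: mxcvg_Delta; exact: mxcvg_fst.
have cDt := mxcvg_tr cD.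
have cc m n (B : 'M[R]_(m, n)) : mxcvg PFil (fun=> B) B by exact: mxcvg_cst.
apply: mxcvgM => //; apply: mxcvgB => //.
apply: mxcvgM => //; apply: mxcvgM => //; apply: mxcvgM => //; apply: mxcvgM => //.
apply: mxcvgV; last by rewrite gramE -row_free_gram E0_row_free.
by apply: mxcvgM => //; apply: mxcvgM => //; apply: mxcvgM.
Qed.

(** Write [p0 = p + Phi0 x]: the operator [H] subtracted in [hat_p] fixes the image of [Phi0] and
    kills [p], so that [p0 - H p0 = p]. *)
Lemma hat_p_null p : M0 p -> Delta Q *m p = 0 -> hat_p Phi0 p0 Q = p.
Proof.
move=> M0p Dp; have [x ->] := (M0_affine M0p p0).1 hp0.
rewrite /hat_p; set Gm := Phi0^T *m _ *m _ *m Phi0.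
have Gu : Gm \in unitmx by rewrite /Gm gramE -row_free_gram E0_row_free.
set H := Phi0 *m invmx Gm *m Phi0^T *m (Delta Q)^T *m Delta Q.
have Hp : H *m p = 0 by rewrite /H -mulmxA Dp mulmx0.
have Hx : H *m (Phi0 *m x) = Phi0 *m x.
  rewrite (_ : H *m _ = Phi0 *m (invmx Gm *m Gm) *m x); last by rewrite /H /Gm !mulmxA.
  by rewrite mulVmx// mulmx1.
by rewrite mulmxBl mul1mx mulmxDr Hp Hx add0r addrK.
Qed.

Lemma mxcvg_Sigma : mxcvg PFil (fun t => Sigma t.2 t.1) (Sigma pi Q).
Proof.
move=> a c; pose i := (mxtens_unindex a).2; pose j := (mxtens_unindex a).1.
pose h := (mxtens_unindex c).2; pose l := (mxtens_unindex c).1.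
have SE (p : 'rV[R]_N) (S : 'M[R]_N) : Sigma p S a c =
    if (i == h) && (j == l) then S i j * (1 - S i j) / p 0 i
    else if i == h then - (S i j * S i l) / p 0 i else 0.
  by rewrite mxE /i /j /h /l; case: (mxtens_unindex a); case: (mxtens_unindex c).
rewrite SE; under eq_fun do rewrite SE.
have cpi : (fun t : 'M[R]_N * 'rV[R]_N => (t.2 0 i)^-1) @ PFil --> (pi 0 i)^-1.
  by apply: cvgV; [rewrite gt_eqF|exact: mxcvg_snd].
have cQ u v := @mxcvg_fst u v.
case: ifP => _.
  by apply: cvgM => //; apply: cvgM => //; apply: cvgB => //; exact: cvg_cst.
case: ifP => _; last exact: cvg_cst.
by apply: cvgM => //; apply: cvgN; apply: cvgM.
Qed.

Definition covariance_of (t : 'M[R]_N * 'rV[R]_N) : 'M[R]_(N * N) :=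
  W_ (F_space Phi Phi0 t.1) (unvec (hat_p Phi0 p0 t.1)) (Sigma t.2 t.1).

Lemma mxcvg_covariance : mxcvg PFil covariance_of (covariance_of (Q, pi)).
Proof.
have cD : mxcvg PFil (fun t => Delta (unvec (hat_p Phi0 p0 t.1))) (Delta (unvec (hat_p Phi0 p0 Q))).
  apply: mxcvg_Delta => i j; under eq_fun do rewrite mxE; rewrite mxE.
  exact: mxcvg_hat_p.
apply: mxcvgM; last exact: mxcvg_PF.
apply: mxcvgM; last exact: mxcvg_tr.
apply: mxcvgM; last exact: mxcvg_Sigma.
by apply: mxcvgM => //; exact: mxcvg_PF.
Qed.

(** The infimum over [M] is at most its value at the true [p], which tends to 0. The infimum over
    [M0] tends to the squared residual at [Q], which is attained in [M0] and hence positive. *)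
Lemma contrast_alternative p : M p -> Delta Q *m p = 0 ->
    (forall p', M0 p' -> Delta Q *m p' <> 0) ->
  exists2 c : R, 0 < c & \forall t \near PFil, c <= contrast t.1.
Proof.
move=> Mp Dp alt.
pose res Q' := Delta Q' *m p0 - orthogonal_proj <<E0 Q'>>%MS *m (Delta Q' *m p0).
have cD : mxcvg PFil (fun t => Delta t.1) (Delta Q) by apply: mxcvg_Delta; exact: mxcvg_fst.
have cc m n (B : 'M[R]_(m, n)) : mxcvg PFil (fun=> B) B by exact: mxcvg_cst.
have cres : mxcvg PFil (fun t => res t.1) (res Q).
  apply: mxcvgB; first exact: mxcvgM.
  by apply: mxcvgM; [exact: mxcvg_proj_E0|exact: mxcvgM].
have cDp : sqnorm (Delta t.1 *m p) @[t --> PFil] --> (0 : R).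
  rewrite (_ : 0 = sqnorm (Delta Q *m p)); first by apply: mxcvg_sqnorm; exact: mxcvgM.
  by rewrite Dp /sqnorm big1// => i _; rewrite mxE expr0n.
have res0 : 0 < sqnorm (res Q).
  rewrite lt0r sqnorm_ge0 andbT; apply/eqP => /sqnorm_eq0 r0.
  have [_ [v M0v Dv]] := inf_sqnorm_affine (Delta Q) (M0_affine hp0).
  by apply: (alt v M0v); rewrite Dv; exact: r0.
(* Nearby, the infimum over [M0] is at least two thirds of the limit and the one over [M] at most
   one third. *)
exists (sqnorm (res Q) / 3); first by rewrite divr_gt0.
have csq : sqnorm (res t.1) @[t --> PFil] --> sqnorm (res Q) by exact: mxcvg_sqnorm.
have /cvgrPdist_le/(_ (sqnorm (res Q) / 3)) := csq.
have /cvgrPdist_le/(_ (sqnorm (res Q) / 3)) := cDp.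
have e3 : 0 < sqnorm (res Q) / 3 by rewrite divr_gt0.
move=> /(_ e3) H1 /(_ e3) H2; apply: filterS2 H1 H2 => t.
rewrite sub0r normrN ger0_norm ?sqnorm_ge0// ler_norml => H1 /andP[_ H2].
rewrite /contrast; have [-> _] := inf_sqnorm_affine (Delta t.1) (M0_affine hp0).
have : inf [set euclidean_norm (Delta t.1 *m m) ^+ 2 | m in M] <= sqnorm (Delta t.1 *m p).
  apply: ge_inf; last by exists p => //; rewrite euclidean_norm_sqr.
  by exists 0 => _ [m _ <-]; exact: sqr_ge0.
rewrite -/(res t.1); lra.
Qed.

End contrast_statistic.

(** * Convergence in probability of the estimators *)

Section limit_in_probability.
Context {R : realType} (N : nat).
Variables (Q : 'M[R]_N) (nu : 'I_N -> R).
Hypothesis Q_ge0 : forall i j, 0 <= Q i j.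
Hypothesis Q_sum1 : forall i, \sum_j Q i j = 1.
Hypothesis nu_ge0 : forall i, 0 <= nu i.
Hypothesis nu_sum1 : \sum_i nu i = 1.

Local Notation E := (path_expectation Q nu).

Definition path_probability (n : nat) (A : set (nat -> 'I_N)) : R :=
  E n (fun y => `[< A y >]%:R).

Lemma path_probabilityS n (A B : set (nat -> 'I_N)) : A `<=` B ->
  path_probability n A <= path_probability n B.
Proof.
move=> AB; apply: le_path_expectation => // y.
by case: asboolP => [Ay|_]; [rewrite asboolT//; exact: AB|rewrite ler0n].
Qed.

Lemma path_probability_ge0 n A : 0 <= path_probability n A.
Proof.
rewrite -(path_expectation_cst Q_sum1 nu_sum1 n 0).
by apply: le_path_expectation => // y; rewrite ler0n.
Qed.

Lemma path_probabilityU n (A B C : set (nat -> 'I_N)) : A `<=` B `|` C ->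
  path_probability n A <= path_probability n B + path_probability n C.
Proof.
move=> ABC; rewrite -path_expectationD; apply: le_path_expectation => // y.
case: (asboolP (A y)) => [/ABC[By|Cy]|_]; last by rewrite addr_ge0// ler0n.
  by rewrite (asboolT By) lerDl ler0n.
by rewrite (asboolT Cy) lerDr ler0n.
Qed.

Lemma path_probabilityC n A : path_probability n (~` A) = 1 - path_probability n A.
Proof.
rewrite -[X in X - _](path_expectation_cst Q_sum1 nu_sum1 n) -path_expectationB.
apply: eq_path_expectation => y; rewrite (_ : `[< (~` A) y >] = ~~ `[< A y >]).
  by case: `[< A y >]; rewrite ?subrr ?subr0.
by rewrite -asbool_neg.
Qed.

(* Convergence along this filter is convergence in probability. *)
Definition with_high_probability : set_system (nat * (nat -> 'I_N)) :=
  [set A | path_probability n [set y | ~ A (n, y)] @[n --> \oo] --> (0 : R)].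

Local Notation WHP := with_high_probability.

Lemma whp_le (A : set (nat * (nat -> 'I_N))) (b : nat -> R) : b n @[n --> \oo] --> (0 : R) ->
  (\forall n \near \oo, path_probability n [set y | ~ A (n, y)] <= b n) -> WHP A.
Proof.
move=> b0 Ab; apply: (squeeze_cvgr _ (cvg_cst 0) b0).
by apply: filterS Ab => n ->; rewrite path_probability_ge0.
Qed.

Global Instance whp_filter : Filter WHP.
Proof.
split.
- rewrite /with_high_probability /= (_ : (fun n => _) = cst 0); first exact: cvg_cst.
  apply/funext => n; rewrite -[RHS](path_expectation_cst Q_sum1 nu_sum1 n).
  by apply: eq_path_expectation => y; rewrite asboolF//= => /(_ I).
- move=> A B PA PB; apply: (whp_le (b := fun n => path_probability n [set y | ~ A (n, y)] +
     path_probability n [set y | ~ B (n, y)])).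
    by rewrite -[X in _ --> X](addr0 (0 : R)); exact: cvgD.
  apply: nearW => n; apply: path_probabilityU => y /= /not_andP; tauto.
- move=> A B AB PA; apply: (whp_le PA); apply: nearW => n.
  by apply: path_probabilityS => y /=; apply: contra_not; exact: AB.
Qed.

Lemma whp_eventually (A : set nat) : (\forall n \near \oo, A n) -> WHP [set t | A t.1].
Proof.
move=> nA; apply: (whp_le (cvg_cst 0)); apply: filterS nA => n An.
rewrite -(path_expectation_cst Q_sum1 nu_sum1 n 0); apply: le_path_expectation => // y.
by rewrite asboolF//=; exact: contraPP.
Qed.

Lemma cvg_fst_whp : fst t @[t --> WHP] --> \oo.
Proof. by move=> A nA; exact: whp_eventually. Qed.

Lemma whp_limit (A : set (nat * (nat -> 'I_N))) : WHP A ->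
  path_probability n [set y | A (n, y)] @[n --> \oo] --> (1 : R).
Proof.
move=> PA; rewrite (_ : (fun n => _) = fun n => 1 - path_probability n [set y | ~ A (n, y)]).
  by rewrite -[X in _ --> X](subr0 (1 : R)); apply: cvgB => //; exact: cvg_cst.
apply/funext => n; rewrite -path_probabilityC; congr path_probability.
by apply/seteqP; split => y /=; rewrite notE.
Qed.

Lemma path_probability_markov n (A : set (nat -> 'I_N)) f a : 0 < a ->
    (forall y, 0 <= f y) -> (forall y, A y -> a <= f y) ->
  path_probability n A <= a^-1 * E n f.
Proof.
move=> a0 f0 Af.
apply: (@path_expectation_indic_markov _ _ Q nu Q_ge0 nu_ge0 n f a (fun y => `[< A y >])) => //.
by move=> y /asboolP; exact: Af.
Qed.

Lemma bounded_finite (g : 'I_N -> 'I_N -> R) : exists2 B : R, 0 <= B & forall i j, `|g i j| <= B.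
Proof.
exists (\sum_i \sum_j `|g i j|); first by apply: sumr_ge0 => i _; exact: sumr_ge0.
move=> i j; rewrite (bigD1 i)//= (bigD1 j)//= -addrA lerDl addr_ge0 ?sumr_ge0// => k _.
exact: sumr_ge0.
Qed.

Lemma cvg_invn0 : (n%:R : R)^-1 @[n --> \oo] --> (0 : R).
Proof.
by apply/gtr0_cvgV0; [near=> n; rewrite ltr0n; near: n; exact: nbhs_infty_gt|exact: cvgr_idn].
Unshelve. all: by end_near. Qed.

(** Chebyshev's inequality: orthogonality of the increments bounds the second moment of the
    normalized sum by [B^2 / n]. *)
Lemma path_sum_lln (g : 'I_N -> 'I_N -> R) : (forall i, \sum_j Q i j * g i j = 0) ->
  (t.1%:R : R)^-1 * path_sum g t.1 t.2 @[t --> WHP] --> (0 : R).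
Proof.
move=> g0; have [B B0 gB] := bounded_finite g.
apply/cvgrPdist_le => e e0.
apply: (whp_le (b := fun n => (e ^+ 2)^-1 * (B ^+ 2 * n%:R^-1))).
  rewrite -[X in _ --> X](mulr0 (e ^+ 2)^-1); apply: cvgMr.
  rewrite -[X in _ --> X](mulr0 (B ^+ 2)); apply: cvgMr; exact: cvg_invn0.
near=> n; have n0 : 0 < n%:R :> R by rewrite ltr0n; near: n; exact: nbhs_infty_gt.
apply: le_trans (path_probability_markov n (f := fun y => n%:R^-1 ^+ 2 * path_sum g n y ^+ 2)
   (a := e ^+ 2) _ _ _) _.
- exact: exprn_gt0.
- by move=> y; rewrite mulr_ge0 ?sqr_ge0.
- move=> y /= /negP; rewrite -ltNge sub0r normrN => ey.
  rewrite -exprMn -[leRHS]real_normK ?num_real//.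
  by rewrite lerXn2r ?nnegrE ?normr_ge0 ?ltW.
rewrite ler_wpM2l ?invr_ge0 ?sqr_ge0// path_expectationZ.
apply: le_trans (ler_wpM2l (sqr_ge0 _)
  (path_sum_second_moment Q_ge0 Q_sum1 nu_ge0 nu_sum1 n g0 gB)) _.
by rewrite expr2 mulrA -[_ * _ * n%:R]mulrA mulVf ?gt_eqF// mulr1 mulrC.
Unshelve. all: by end_near. Qed.

Variable (pi : 'rV[R]_N).
Hypothesis pi_sum1 : \sum_i pi 0 i = 1.
Hypothesis pi_gt0 : forall i, 0 < pi 0 i.
Hypothesis piQ : pi *m Q = pi.
Hypothesis kerQ : forall h : 'cV[R]_N, Q *m h = h -> exists a, h = const_mx a.

(** Counts the times from 1 to [n - 1], as the denominators of [hat_Q] do; [hat_pi] also counts time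
    [n], which changes the frequency by at most [1 / n]. *)
Definition visits (i : 'I_N) (n : nat) (y : nat -> 'I_N) : R := \sum_(1 <= k < n) (y k == i)%:R.

(** The Poisson equation writes the number of visits as a martingale sum, plus a bounded boundary
    term in [h], plus [(n - 1) pi 0 i]. *)
Lemma visits_lln i : (t.1%:R : R)^-1 * visits i t.1 t.2 @[t --> WHP] --> pi 0 i.
Proof.
have [h hE] := poisson_centered pi_sum1 piQ kerQ (fun j => (j == i)%:R).
have hE' j : h j - \sum_l Q j l * h l = (j == i)%:R - pi 0 i.
  rewrite hE (bigD1 i)//= eqxx mulr1 big1 ?addr0// => l /negbTE ->.
  by rewrite mulr0.
pose g a c := h c - \sum_l Q a l * h l.
have g0 a : \sum_c Q a c * g a c = 0.
  by under eq_bigr do rewrite mulrBr; rewrite sumrB -mulr_suml Q_sum1 mul1r subrr.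
pose B := \sum_j `|h j|.
have hB j : `|h j| <= B by rewrite /B (bigD1 j)//= lerDl sumr_ge0.
have B0 : 0 <= B by exact: sumr_ge0.
have vE n y : (0 < n)%N ->
    visits i n y = path_sum g n y + (h (y 1%N) - h (y n)) + (n%:R - 1) * pi 0 i.
  case: n => // n _; elim: n => [|n IH].
    by rewrite /visits path_sum_small// big_geq// !subrr !addr0 mul0r addr0.
  rewrite /visits big_nat_recr//= -/(visits i n.+1 y) IH /path_sum [in RHS]big_nat_recr//=.
  have := hE' (y n.+1); rewrite /g -[n.+2%:R]natr1; lra.
have cinv : (t.1%:R : R)^-1 @[t --> WHP] --> (0 : R).
  exact: (cvg_comp _ _ cvg_fst_whp cvg_invn0).
have cmain : (t.1%:R : R)^-1 * path_sum g t.1 t.2 + pi 0 i - t.1%:R^-1 * pi 0 i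
    @[t --> WHP] --> pi 0 i.
  rewrite -[X in _ --> X](subr0 (pi 0 i)) -[in X in _ --> X](add0r (pi 0 i)).
  rewrite -[X in _ --> _ - X](mul0r (pi 0 i)).
  apply: cvgB; last exact: cvgMl.
  by apply: cvgD; [exact: path_sum_lln|exact: cvg_cst].
apply: (cvg_sub0 _ cmain); apply/cvgrPdist_le => e e0.
have : \forall t \near WHP, `|0 - (2 * B) * (t.1%:R : R)^-1| <= e.
  have /cvgrPdist_le : (2 * B) * (t.1%:R : R)^-1 @[t --> WHP] --> (0 : R).
    by rewrite -[X in _ --> X](mulr0 (2 * B)); apply: cvgMr.
  exact.
have : \forall t \near WHP, (0 < t.1)%N.
  by apply: (@whp_eventually (fun n => (0 < n)%N)); exact: nbhs_infty_gt.
apply: filterS2 => -[n y] /= n0.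
rewrite !sub0r !normrN; apply: le_trans.
have nR : n%:R != 0 :> R by rewrite pnatr_eq0 -lt0n.
rewrite (_ : (_ - _) (n, y) = n%:R^-1 * (h (y 1%N) - h (y n))); last first.
  rewrite /GRing.sub_fun /=.
  rewrite -[LHS]/(n%:R^-1 * visits i n y -
    (n%:R^-1 * path_sum g n y + pi 0 i - n%:R^-1 * pi 0 i)) vE//; field; exact: nR.
rewrite normrM [leRHS]normrM mulrC ler_pM//.
apply: le_trans (ler_normB _ _) _; rewrite ger0_norm ?mulr_ge0//.
have := hB (y 1%N); have := hB (y n); lra.
Qed.

Definition centered_transition (i j : 'I_N) (a c : 'I_N) : R :=
  (a == i)%:R * ((c == j)%:R - Q i j).

Lemma centered_transition_sum0 i j a : \sum_c Q a c * centered_transition i j a c = 0.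
Proof.
rewrite /centered_transition; case: (eqVneq a i) => [->|_].
  under eq_bigr do rewrite mul1r mulrBr.
  rewrite sumrB -mulr_suml Q_sum1 mul1r (bigD1 j)//= eqxx mulr1 big1 ?addr0 ?subrr//.
  by move=> c /negbTE ->; rewrite mulr0.
by apply: big1 => c _; rewrite mul0r mulr0.
Qed.

Lemma hat_QE n y i j : visits i n y != 0 ->
  hat_Q n y i j - Q i j = path_sum (centered_transition i j) n y / visits i n y.
Proof.
move=> v0; rewrite mxE -/(visits i n y) -[X in _ - X](mulfK v0) -mulrBl; congr (_ / _).
rewrite /visits mulr_sumr -sumrB; apply: eq_bigr => k _.
rewrite /centered_transition; case: (y k == i) => /=; last by rewrite mulr0 subr0 mul0r.
by rewrite mulr1 mul1r.
Qed.

Lemma whp_visits_gt0 : \forall t \near WHP, forall i, 0 < visits i t.1 t.2.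
Proof.
apply: filter_forall => i.
have /cvgrPdist_lt/(_ (pi 0 i) (pi_gt0 i)) := @visits_lln i.
apply: (@filterS _ _ whp_filter) => -[n y] /=.
move=> H; have v0 : 0 <= visits i n y by apply: sumr_ge0 => k _; rewrite ler0n.
rewrite lt0r v0 andbT; apply: contraTneq H => ->.
by rewrite mulr0 subr0 ger0_norm ?ltxx// ltW.
Qed.

Lemma hat_Q_lln i j : hat_Q t.1 t.2 i j @[t --> WHP] --> Q i j.
Proof.
have c : Q i j + (t.1%:R^-1 * path_sum (centered_transition i j) t.1 t.2) *
     (t.1%:R^-1 * visits i t.1 t.2)^-1 @[t --> WHP] --> Q i j.
  rewrite -[X in _ --> X]addr0 -[X in _ --> _ + X](mul0r (pi 0 i)^-1).
  apply: cvgD; first exact: cvg_cst.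
  apply: cvgM; first by apply: path_sum_lln; exact: centered_transition_sum0.
  by apply: cvgV; [rewrite gt_eqF|exact: (@visits_lln i)].
apply: cvg_trans c; apply: near_eq_cvg.
have : \forall t \near WHP, (0 < t.1)%N.
  by apply: (@whp_eventually (fun n => (0 < n)%N)); exact: nbhs_infty_gt.
apply: filterS2 whp_visits_gt0 => -[n y] /= vi n0.
have v0 : visits i n y != 0 by rewrite gt_eqF.
have nR : n%:R != 0 :> R by rewrite pnatr_eq0 -lt0n.
rewrite -[RHS](subrK (Q i j)) addrC; congr (_ + _); rewrite (hat_QE _ v0).
by field; rewrite v0 nR.
Qed.

Lemma hat_pi_lln i : hat_pi t.1 t.2 0 i @[t --> WHP] --> pi 0 i.
Proof.
have main := @visits_lln i; apply: (cvg_sub0 _ main); apply/cvgrPdist_le => e e0.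
have cinv : (t.1%:R : R)^-1 @[t --> WHP] --> (0 : R).
  exact: (cvg_comp _ _ cvg_fst_whp cvg_invn0).
have : \forall t \near WHP, (0 < t.1)%N.
  by apply: (@whp_eventually (fun n => (0 < n)%N)); exact: nbhs_infty_gt.
have /cvgrPdist_le/(_ e e0) := cinv; apply: filterS2 => -[n y] /= H n0.
apply: le_trans H; rewrite !sub0r !normrN.
rewrite (_ : (_ - _) (n, y) = n%:R^-1 * (y n == i)%:R); last first.
  rewrite -[LHS]/(hat_pi n y 0 i - n%:R^-1 * visits i n y) mxE -mulrBr; congr (_ * _).
  by rewrite big_nat_recr//= /visits addrAC subrr add0r.
by rewrite normrM ler_piMr//; case: (_ == _); rewrite ?normr0 ?normr1.
Qed.

Let forbidden a c : R := (Q a c == 0)%:R.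

Lemma path_sum_forbidden n : E n (path_sum forbidden n) = 0.
Proof.
elim: n => [|[|n] IH].
- by under eq_path_expectation do rewrite path_sum_small//; exact: path_expectation_cst.
- by under eq_path_expectation do rewrite path_sum_small//; exact: path_expectation_cst.
rewrite path_expectationS -[RHS]IH; apply: eq_path_expectation => y.
under eq_bigr do rewrite path_sumS// mulrDr.
rewrite big_split /= -mulr_suml Q_sum1 mul1r big1 ?addr0// => c _.
by rewrite /forbidden; case: eqVneq => [->|_]; rewrite ?mul0r ?mulr0.
Qed.

(** An entry of [hat_Q] outside the support of [Q] requires a recorded transition of probability
    zero, and the expected number of such transitions is 0. *)
Lemma whp_supp : \forall t \near WHP, supp (hat_Q t.1 t.2 : 'M[R]_N) `<=` supp Q.
Proof.
apply: (whp_le (cvg_cst 0)); apply: nearW => n.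
apply: (@le_trans _ _ (1^-1 * E n (path_sum forbidden n))); last first.
  by rewrite path_sum_forbidden mulr0.
apply: path_probability_markov => //.
  by move=> y; apply: sumr_ge0 => k _; rewrite ler0n.
move=> y /= /existsNP[[i j]] /not_implyP[]; rewrite /supp /= => hq.
move=> /negP; rewrite negbK => /eqP q0.
have [k [k1 yk yk1]] : exists k, [/\ (1 <= k < n)%N, y k = i & y k.+1 = j].
  apply: contrapT => nk; move: hq; rewrite mxE big1_seq ?mul0r ?eqxx// => k /=.
  rewrite mem_index_iota => k1; case: (eqVneq (y k) i) => //= yk.
  case: (eqVneq (y k.+1) j) => //= yk1; exfalso; apply: nk; by exists k.
rewrite /path_sum (bigD1_seq k) ?mem_index_iota ?iota_uniq//= yk yk1 /forbidden q0 eqxx.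
by rewrite lerDl sumr_ge0// => l _; rewrite ler0n.
Qed.

Lemma hat_Q_sum1 n y : (forall i, 0 < visits i n y) ->
  hat_Q n y *m const_mx 1 = const_mx 1 :> 'cV[R]_N.
Proof.
move=> v0; apply/colP => i; rewrite !mxE; under eq_bigr do rewrite !mxE mulr1.
rewrite -mulr_suml exchange_big /= -/(visits i n y).
rewrite (_ : \sum_(1 <= k < n) _ = visits i n y) ?divff ?gt_eqF//.
apply: eq_bigr => k _; case: (y k == i) => /=; last by rewrite big1.
by rewrite (bigD1 (y k.+1))//= eqxx big1 ?addr0// => j /negbTE; rewrite eq_sym => ->.
Qed.

Lemma parameters_lln : (hat_Q t.1 t.2, hat_pi t.1 t.2) @[t --> WHP] --> parameter_filter Q pi.
Proof.
move=> A [dl dl0 dlA].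
have mQ : mxcvg WHP (fun t => hat_Q t.1 t.2) Q by move=> i j; exact: hat_Q_lln.
have mpi : mxcvg WHP (fun t => hat_pi t.1 t.2) pi.
  by move=> i j; rewrite (ord1 i); exact: hat_pi_lln.
have H1 : \forall t \near WHP, forall i j, `|hat_Q t.1 t.2 i j - Q i j| <= dl.
  by exact: mxcvg_near_bound.
have H2 : \forall t \near WHP, forall i j, `|hat_pi t.1 t.2 i j - pi i j| <= dl.
  by exact: mxcvg_near_bound.
change (WHP [set t | A (hat_Q t.1 t.2, hat_pi t.1 t.2)]).
have I4 := @filterI _ WHP whp_filter _ _ (@filterI _ WHP whp_filter _ _ H1 H2)
  (@filterI _ WHP whp_filter _ _ whp_visits_gt0 whp_supp).
apply: (@filterS _ WHP whp_filter _ _ _ I4) => t [[h1 h2] [h3 h4]]; apply: dlA; split => //=.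
exact: hat_Q_sum1.
Qed.

End limit_in_probability.

(** * Asymptotic law of the test statistic *)

Section path_expectation_integral.
Context {R : realType} (N : nat).
Variables (Q : 'M[R]_N) (nu : 'I_N -> R).
Hypothesis Q_ge0 : forall i j, 0 <= Q i j.
Hypothesis Q_sum1 : forall i, \sum_j Q i j = 1.
Context d (U : measurableType d) (mu : probability U R).

Lemma Rintegral_sum_bounded (I : Type) (s : seq I) (c : I -> R) (f : I -> U -> R) (B : R) :
    (forall i, measurable_fun setT (f i)) -> (forall i x, `|f i x| <= B) ->
  (\int[mu]_x (\sum_(i <- s) c i * f i x))%R = \sum_(i <- s) c i * (\int[mu]_x f i x)%R.
Proof.
move=> mf fB; elim: s => [|i s IH].
  rewrite big_nil; under eq_Rintegral do rewrite big_nil.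
  by rewrite Rintegral_cst// mul0r.
rewrite big_cons -IH -RintegralZl//; last exact: integrable_bounded (mf i) (fB i).
under eq_Rintegral do rewrite big_cons.
have mcf j : measurable_fun setT (fun x => c j * f j x) by exact: measurable_funM.
have cfB j x : `|c j * f j x| <= `|c j| * B by rewrite normrM ler_wpM2l.
rewrite RintegralD//; first exact: integrable_bounded (mcf i) (cfB i).
apply: (@integrable_bounded _ _ _ mu _ (\sum_(j <- s) `|c j| * B)).
  exact: measurable_sum.
by move=> x; apply: le_trans (ler_norm_sum _ _ _) _; apply: ler_sum => j _.
Qed.

(** Fubini's theorem between paths and an auxiliary measure; the average over paths being a finite
    sum, it reduces to linearity of the integral. *)
Lemma path_expectation_Rintegral n (h : (nat -> 'I_N) -> U -> R) (B : R) :
    (forall y, measurable_fun setT (h y)) -> (forall y x, `|h y x| <= B) ->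
  measurable_fun setT (fun x => path_expectation Q nu n (h ^~ x)) /\
  path_expectation Q nu n (fun y => \int[mu]_x h y x)%R =
    (\int[mu]_x path_expectation Q nu n (h ^~ x))%R.
Proof.
elim: n h => [|n IH] h mh hB.
  split.
    by rewrite /path_expectation /=; apply: measurable_sum => i; exact: measurable_funM.
  by rewrite [RHS](Rintegral_sum_bounded _ _ (fun i => mh _) (fun i => hB _)).
pose h' z x := \sum_j Q (z n) j * h (extend_path z n j) x.
have mh' z : measurable_fun setT (h' z) by apply: measurable_sum => j; exact: measurable_funM.
have h'B z x : `|h' z x| <= B.
  apply: le_trans (ler_norm_sum _ _ _) _; rewrite -[leRHS]mul1r -(Q_sum1 (z n)) mulr_suml.
  by apply: ler_sum => j _; rewrite normrM ger0_norm// ler_wpM2l.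
have [m' e'] := IH h' mh' h'B.
rewrite (_ : (fun x => _) = (fun x => path_expectation Q nu n (h' ^~ x))); last first.
  by apply/funext => x; rewrite path_expectationS.
split=> //; rewrite path_expectationS.
rewrite -[RHS]e'; apply: eq_path_expectation => z.
by rewrite -(Rintegral_sum_bounded _ _ (fun j => mh _) (fun j => hB _)).
Qed.

End path_expectation_integral.

Lemma quadratic_form_conj {R : realType} m n (L : 'M[R]_(m, n)) (V : 'M[R]_n)
    (x : m.-tuple (measurableTypeR R)) :
  let w c := \sum_a tnth x a * L a c in
  quadratic_form (L *m V *m L^T) x = \sum_c \sum_c' w c * w c' * V c c'.
Proof.
rewrite /quadratic_form /=; set e := \col_i _.
rewrite (_ : e^T *m _ *m e = (e^T *m L) *m V *m (e^T *m L)^T); last first.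
  by rewrite trmx_mul trmxK !mulmxA.
have uE c : (e^T *m L) 0 c = \sum_a tnth x a * L a c.
  by rewrite mxE; apply: eq_bigr => a _; rewrite !mxE.
rewrite mxE exchange_big /=; apply: eq_bigr => c' _; rewrite mxE mulr_suml.
by apply: eq_bigr => c _; rewrite [_^T _ _]mxE !uE mulrAC.
Qed.

Section laplace_limit.
Context {R : realType} (N : nat).
Variables (Q : 'M[R]_N) (nu : 'I_N -> R).
Hypothesis Q_ge0 : forall i j, 0 <= Q i j.
Hypothesis Q_sum1 : forall i, \sum_j Q i j = 1.
Hypothesis nu_ge0 : forall i, 0 <= nu i.
Hypothesis nu_sum1 : \sum_i nu i = 1.
Variable (pi : 'rV[R]_N).
Hypothesis pi_sum1 : \sum_i pi 0 i = 1.
Hypothesis pi_gt0 : forall i, 0 < pi 0 i.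
Hypothesis piQ : pi *m Q = pi.
Hypothesis kerQ : forall h : 'cV[R]_N, Q *m h = h -> exists a, h = const_mx a.

Local Notation E := (path_expectation Q nu).

(* The linear part of [vec hat_Q - vec Q]: the denominators are replaced by
   their limits. *)
Definition scaled_transition (c : 'I_(N * N)) (a b : 'I_N) : R :=
  centered_transition Q (mxtens_unindex c).2 (mxtens_unindex c).1 a b / pi 0 (mxtens_unindex c).2.

Definition fluctuation n (y : nat -> 'I_N) : 'cV[R]_(N * N) :=
  \col_c ((Num.sqrt n%:R)^-1 * path_sum (scaled_transition c) n y).

Lemma fluctuation_combination (w : 'I_(N * N) -> R) n y :
  \sum_c w c * fluctuation n y c 0 =
  (Num.sqrt n%:R)^-1 * path_sum (fun a b => \sum_c w c * scaled_transition c a b) n y.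
Proof.
rewrite /path_sum exchange_big mulr_sumr; apply: eq_bigr => c _ /=.
by rewrite mxE mulrCA -mulr_sumr.
Qed.

Lemma scaled_transition_sum0 c a : \sum_b Q a b * scaled_transition c a b = 0.
Proof.
rewrite /scaled_transition; under eq_bigr do rewrite mulrA.
by rewrite -mulr_suml centered_transition_sum0// mul0r.
Qed.

Lemma sum_indicator (f : 'I_N -> R) j : \sum_b f b * (b == j)%:R = f j.
Proof.
rewrite (bigD1 j)//= eqxx mulr1 big1 ?addr0// => b /negbTE ->.
by rewrite mulr0.
Qed.

(** This is where [Sigma] comes from: it is the covariance matrix, in the stationary regime, of the
    increments for a single transition. *)
Lemma asymptotic_covariance_entry c c' :
  \sum_a pi 0 a * \sum_b Q a b * (scaled_transition c a b * scaled_transition c' a b) =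
  Sigma pi Q c c'.
Proof.
case: (mxtens_indexP c) => j i; case: (mxtens_indexP c') => l k.
rewrite mxE /scaled_transition !mxtens_indexK /= /centered_transition.
rewrite (bigD1 i)//= [X in _ + X]big1 ?addr0; last first.
  move=> a /negbTE ai; rewrite big1 ?mulr0// => b _.
  by rewrite ai !mul0r mulr0.
case: (eqVneq i k) => /= [<-|ik]; last first.
  by rewrite big1 ?mulr0// => b _; rewrite !mul0r !mulr0.
have pi0 : pi 0 i != 0 by rewrite gt_eqF.
under eq_bigr do rewrite eqxx !mul1r.
rewrite (_ : \sum_b _ = ((j == l)%:R * Q i j - Q i j * Q i l) / pi 0 i ^+ 2).
  by case: (eqVneq j l) => [<-|_]; rewrite ?mul1r ?mul0r; field.
transitivity ((\sum_b Q i b * (b == j)%:R * (b == l)%:R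
   - Q i l * \sum_b Q i b * (b == j)%:R - Q i j * \sum_b Q i b * (b == l)%:R
   + Q i j * Q i l * \sum_b Q i b) / pi 0 i ^+ 2).
  rewrite !mulr_sumr -!sumrB -big_split /= mulr_suml; apply: eq_bigr => b _.
  by field.
rewrite (sum_indicator (fun b => Q i b * (b == j)%:R)) !(sum_indicator (Q i)) Q_sum1 mulr1.
by congr (_ / _); case: (eqVneq j l) => [->|_] /=; ring.
Qed.

Lemma asymptotic_variance_combination (w : 'I_(N * N) -> R) :
  asymptotic_variance Q pi (fun a b => \sum_c w c * scaled_transition c a b) =
  \sum_c \sum_c' w c * w c' * Sigma pi Q c c'.
Proof.
pose g := scaled_transition.
transitivity (\sum_a \sum_b \sum_c \sum_c'
    w c * w c' * (pi 0 a * (Q a b * (g c a b * g c' a b)))).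
  apply: eq_bigr => a _; rewrite mulr_sumr; apply: eq_bigr => b _.
  rewrite expr2 big_distrlr /= !mulr_sumr; apply: eq_bigr => c _.
  by rewrite !mulr_sumr; apply: eq_bigr => c' _; rewrite /g; ring.
under eq_bigr do rewrite exchange_big /=.
rewrite exchange_big /=; apply: eq_bigr => c _.
under eq_bigr do rewrite exchange_big /=.
rewrite exchange_big /=; apply: eq_bigr => c' _.
rewrite -asymptotic_covariance_entry mulr_sumr; apply: eq_bigr => a _.
by rewrite !mulr_sumr.
Qed.

Variables (m : nat) (L : 'M[R]_(m, N * N)).

Local Notation q := (quadratic_form (L *m Sigma pi Q *m L^T)).

(** The quadratic form is the asymptotic variance of a linear combination of scaled transitions. *)
Lemma quadratic_form_covariance_ge0 x : 0 <= q x.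
Proof.
rewrite quadratic_form_conj -asymptotic_variance_combination.
by apply: asymptotic_variance_ge0 => // i; exact: ltW.
Qed.

(* [exp (- la |L z|^2)] is a Gaussian average of cosines of linear functions of
   [z], so its limit follows from that of the characteristic functions. *)
Lemma fluctuation_laplace_cvg (la : R) : 0 <= la ->
  E n (fun y => expR (- (la * sqnorm (L *m fluctuation n y)))) @[n --> \oo] -->
  (\int[standard_gaussian m]_x expR (- (la * q x)))%R.
Proof.
move=> la0; pose s := Num.sqrt (2 * la).
have s2 : s ^+ 2 = 2 * la by rewrite sqr_sqrtr// mulr_ge0.
pose h n y (x : m.-tuple (measurableTypeR R)) :=
  cos (\sum_a (s * (L *m fluctuation n y) a 0) * tnth x a).
have mh n y : measurable_fun setT (h n y).
  apply: (measurableT_comp (f := @cos R)); first exact: measurable_cos.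
  exact: measurable_linear_form.
have hB n y x : `|h n y x| <= 1 by exact: cos_norm_le1.
have e1 n y : expR (- (la * sqnorm (L *m fluctuation n y))) = 
    (\int[standard_gaussian m]_x h n y x)%R.
  rewrite /Rintegral.
  under eq_integral do rewrite /h -[X in cos X]add0r.
  rewrite integral_cos_standard_gaussian cos0 mul1r /=; congr expR.
  rewrite mulNr; congr (- _).
  under eq_bigr do rewrite exprMn s2.
  rewrite -mulr_sumr -/(sqnorm _).
  by field.
have [mE e2] : (forall n, measurable_fun setT (fun x => E n (h n ^~ x))) /\
   forall n, E n (fun y => expR (- (la * sqnorm (L *m fluctuation n y)))) =
     (\int[standard_gaussian m]_x E n (h n ^~ x))%R.
  split => k; have [m1 m2] :=
    path_expectation_Rintegral nu Q_ge0 Q_sum1 (standard_gaussian m) k (mh k) (hB k).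
    exact: m1.
  by rewrite -m2; apply: eq_path_expectation => y.
under eq_fun do rewrite e2.
(* For a fixed Gaussian vector [x], the mean of the cosine is the characteristic function of a
   scalar martingale. The integral over [x] is then passed to the limit by dominated convergence,
   with bound 1. *)
have pw x : E n (h n ^~ x) @[n --> \oo] --> expR (- (la * q x)).
  pose w c := s * \sum_a tnth x a * L a c.
  have hE n y : h n y x = cos ((Num.sqrt n%:R)^-1 *
      path_sum (fun a b => \sum_c w c * scaled_transition c a b) n y).
    rewrite -fluctuation_combination /h; congr cos; rewrite /w.
    under [RHS]eq_bigr do rewrite mulr_sumr mulr_suml.
    rewrite exchange_big /=; apply: eq_bigr => a _; rewrite mxE mulr_sumr mulr_suml.
    by apply: eq_bigr => c _; ring.
  have qE : la * q x =
      asymptotic_variance Q pi (fun a b => \sum_c w c * scaled_transition c a b) / 2.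
    rewrite asymptotic_variance_combination quadratic_form_conj mulr_sumr mulr_suml.
    apply: eq_bigr => c _; rewrite mulr_sumr mulr_suml; apply: eq_bigr => c' _.
    rewrite /w; move: s2; set u := \sum_a _; set v := \sum_a _ => s2.
    rewrite (_ : s * u * (s * v) * _ = s ^+ 2 * (u * v * Sigma pi Q c c')); last by ring.
    by rewrite s2; field.
  rewrite qE -mulNr (_ : (fun n => _) = fun n => E n (fun y => cos ((Num.sqrt n%:R)^-1 *
      path_sum (fun a b => \sum_c w c * scaled_transition c a b) n y))); last first.
    by apply/funext => n; apply: eq_path_expectation => y.
  apply: path_expectation_cos_cvg => // [i|i]; first exact: ltW.
  under eq_bigr do rewrite mulr_sumr; rewrite exchange_big big1//= => c _.
  under eq_bigr do rewrite mulrCA; by rewrite -mulr_sumr scaled_transition_sum0 mulr0.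
have EB n x : `|E n (h n ^~ x)| <= 1.
  apply: le_trans (norm_path_expectation Q_ge0 nu_ge0 _ _) _.
  rewrite -[leRHS](path_expectation_cst Q_sum1 nu_sum1 n).
  exact: le_path_expectation.
have mq : measurable_fun setT (fun x => expR (- (la * q x))).
  apply: (measurableT_comp (f := @expR R)); first exact: measurable_expR.
  under eq_fun do rewrite -mulNr.
  apply: measurable_funM => //.
  exact: measurable_quadratic_form.
have pwE x : (E n (h n ^~ x))%:E @[n --> \oo] --> (expR (- (la * q x)))%:E.
  by apply: cvg_EFin; [exact: nearW|exact: pw].
have [_ _] := @dominated_convergence _ _ _ (standard_gaussian m) setT measurableT
  (fun n x => (E n (h n ^~ x))%:E) (fun x => (expR (- (la * q x)))%:E) (fun=> 1%:E)
  (fun n => (measurable_EFinP _ _).2 (mE n)) ((measurable_EFinP _ _).2 mq)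
  (aeW _ (fun x _ => pwE x)) (finite_measure_integrable_cst _ 1 measurableT)
  (aeW _ (fun x n _ => EB n x)).
have fin : (\int[standard_gaussian m]_x (expR (- (la * q x)))%:E)%E \is a fin_num.
  apply: integrable_fin_num => //; apply: (@integrable_bounded _ _ _ _ _ 1) => // x.
  by rewrite ger0_norm ?expR_ge0// expR_le1 oppr_le0 mulr_ge0// quadratic_form_covariance_ge0.
by move=> H; apply: fine_cvg; rewrite fineK.
Qed.

End laplace_limit.

Section tightness.
Context {R : realType} (N : nat).
Variables (Q : 'M[R]_N) (nu : 'I_N -> R).
Hypothesis Q_ge0 : forall i j, 0 <= Q i j.
Hypothesis Q_sum1 : forall i, \sum_j Q i j = 1.
Hypothesis nu_ge0 : forall i, 0 <= nu i.
Hypothesis nu_sum1 : \sum_i nu i = 1.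

Local Notation E := (path_expectation Q nu).
Local Notation WHP := (with_high_probability Q nu).

Let whp_F : Filter WHP := whp_filter Q_ge0 Q_sum1 nu_ge0 nu_sum1.
#[local] Existing Instance whp_F.

Lemma path_expectation_sum n (I : Type) (s : seq I) (f : I -> (nat -> 'I_N) -> R) :
  E n (fun y => \sum_(i <- s) f i y) = \sum_(i <- s) E n (f i).
Proof.
elim: s => [|i s IH].
  rewrite big_nil -[RHS](path_expectation_cst Q_sum1 nu_sum1 n).
  by apply: eq_path_expectation => y; rewrite big_nil.
rewrite big_cons -IH -path_expectationD; apply: eq_path_expectation => y.
by rewrite big_cons.
Qed.

(** Slutsky's principle: a factor tending to 0 in probability absorbs one with bounded mean, which
    Markov's inequality makes tight. *)
Lemma whp_mul_tight (f X : nat * (nat -> 'I_N) -> R) (K : R) :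
    (forall t, 0 <= X t) -> (forall n, E n (fun y => X (n, y)) <= K) ->
    f t @[t --> WHP] --> (0 : R) ->
  f t * X t @[t --> WHP] --> (0 : R).
Proof.
move=> X0 XK f0; apply/cvgrPdist_le => e e0.
apply/cvgrPdist_le => eta eta0.
have K0 : 0 <= K.
  apply: le_trans (XK 0%N); rewrite -(path_expectation_cst Q_sum1 nu_sum1 0 0).
  exact: le_path_expectation.
(* Markov's inequality gives [X >= a] probability at most [K / a <= eta / 2]; [K + 1] keeps [a]
   positive when [K = 0]. *)
pose a := 2 * (K + 1) / eta.
have a0 : 0 < a by rewrite divr_gt0// mulr_gt0// ltr_pwDr.
have /cvgrPdist_le/(_ (e / a) (divr_gt0 e0 a0)) := f0.
rewrite /prop_near1 /= => /cvgrPdist_le/(_ (eta / 2)).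
have eta2 : 0 < eta / 2 by rewrite divr_gt0.
move=> /(_ eta2); apply: filterS => n.
rewrite !sub0r !normrN => H.
rewrite ger0_norm; last exact: path_probability_ge0.
move: H; rewrite ger0_norm; last exact: path_probability_ge0.
move=> H.
apply: le_trans (path_probabilityU Q_ge0 nu_ge0 (B := [set y | ~ (`|0 - f (n, y)| <= e / a)])
  (C := [set y | a <= X (n, y)]) _ _) _.
  move=> y /= Hy; apply: contrapT => /not_orP[/contrapT H1 /negP]; rewrite -ltNge => H2.
  apply: Hy; rewrite sub0r normrN normrM (ger0_norm (X0 _)).
  apply: (@le_trans _ _ (e / a * a)); last by rewrite divfK ?gt_eqF.
  by apply: ler_pM => //; [rewrite -normrN -sub0r|exact: ltW].
rewrite [leRHS](splitr eta); apply: lerD => //.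
apply: le_trans (path_probability_markov Q_ge0 nu_ge0 (f := fun y => X (n, y)) n a0 _ _) _ => //.
apply: le_trans (ler_wpM2l _ (XK n)) _; first by rewrite invr_ge0 ltW.
rewrite mulrC ler_pdivrMr// /a (_ : eta / 2 * (2 * (K + 1) / eta) = K + 1) ?lerDl//.
by field; rewrite gt_eqF.
Qed.

Variable (pi : 'rV[R]_N).
Hypothesis pi_gt0 : forall i, 0 < pi 0 i.

Lemma fluctuation_second_moment :
  exists K : R, forall n, E n (fun y => sqnorm (fluctuation Q pi n y)) <= K.
Proof.
have /fin_all_exists2[B B0 gB] : forall c : 'I_(N * N), exists2 B : R, 0 <= B &
    forall a b, `|scaled_transition Q pi c a b| <= B.
  by move=> c; exact: bounded_finite.
exists (\sum_c B c ^+ 2) => n; rewrite path_expectation_sum; apply: ler_sum => c _.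
under eq_path_expectation do rewrite mxE exprMn; rewrite path_expectationZ.
have := path_sum_second_moment Q_ge0 Q_sum1 nu_ge0 nu_sum1 n
  (scaled_transition_sum0 Q_sum1 pi c) (gB c).
move/(ler_wpM2l (sqr_ge0 (Num.sqrt n%:R)^-1)) => /le_trans; apply.
rewrite exprVn sqr_sqrtr ?ler0n// mulrA.
have [->|n0] := posnP n; first by rewrite mulr0 mul0r sqr_ge0.
by rewrite mulVf ?mul1r// pnatr_eq0 -lt0n.
Qed.

End tightness.

Lemma sqnorm_mulmx_diff {R : realType} m n (A B : 'M[R]_(m, n)) (z : 'cV[R]_n) (C : R) :
    (forall i j, `|(A^T *m A - B^T *m B) i j| <= C) ->
  `|sqnorm (A *m z) - sqnorm (B *m z)| <= C * n%:R * sqnorm z.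
Proof.
move=> AB; pose x : n.-tuple (measurableTypeR R) := [tuple z i 0 | i < n].
have xE : \col_i tnth x i = z by apply/colP => i; rewrite mxE tnth_mktuple.
have := quadratic_form_bound x AB.
rewrite /sqr_norm (_ : \sum_i _ = sqnorm z); last first.
  by apply: eq_bigr => i _; rewrite tnth_mktuple.
rewrite /quadratic_form xE mulmxBr mulmxBl [X in `|X|]mxE [X in _ + X]mxE.
by rewrite !sqnormE !trmx_mul !mulmxA.
Qed.

Lemma tail_chi2G {R : realType} n (V : 'M[R]_n) t :
  fine (standard_gaussian n [set x | t < quadratic_form V x]) = 1 - chi2G_cdf V t.
Proof.
have mV : measurable [set x | quadratic_form V x <= t].
  have : measurable (setT `&` quadratic_form V @^-1` `]-oo, t]).
    by apply: measurable_quadratic_form.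
  by rewrite setTI; congr measurable; apply/seteqP; split => x /=; rewrite in_itv.
rewrite (_ : [set x | t < _] = ~` [set x | quadratic_form V x <= t]); last first.
  by apply/seteqP; split => x /=; rewrite ltNge => /negP.
by rewrite probability_setC// /chi2G_cdf fineB//= fin_num_measure.
Qed.

Lemma orthogonal_proj_tr {R : realType} n (F : 'M[R]_n) :
  (orthogonal_proj F)^T = orthogonal_proj F.
Proof.
rewrite (@orthogonal_proj_gram _ _ _ (row_base F)); last 2 first.
- exact: row_base_free.
- by apply: eqmx_sym; exact: eq_row_base.
by move: (row_base F) => U; rewrite /gram_proj 2!trmx_mul trmxK trmx_inv trmx_mul trmxK mulmxA.
Qed.

(** * Level and power of the test *)

Section test_statistic.
Context {R : realType} (N : nat).
Variables (Q : 'M[R]_N) (nu : 'I_N -> R).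
Hypothesis Q_ge0 : forall i j, 0 <= Q i j.
Hypothesis Q_sum1 : forall i, \sum_j Q i j = 1.
Hypothesis nu_ge0 : forall i, 0 <= nu i.
Hypothesis nu_sum1 : \sum_i nu i = 1.
Variable (pi : 'rV[R]_N).
Hypothesis pi_sum1 : \sum_i pi 0 i = 1.
Hypothesis pi_gt0 : forall i, 0 < pi 0 i.
Hypothesis piQ : pi *m Q = pi.
Hypothesis kerQ : forall h : 'cV[R]_N, Q *m h = h -> exists a, h = const_mx a.
Variables (r k d : nat).
Variables (A : 'M[R]_(r, N * N)) (b : 'cV[R]_r) (A0 : 'M[R]_(k, N * N)) (b0 : 'cV[R]_k).
Variables (M M0 : set 'cV[R]_(N * N)) (p0 : 'cV[R]_(N * N)).
Variables (Phi0 : 'M[R]_(N * N, d - k)) (Phi1 : 'M[R]_(N * N, k)) (Phi : 'M[R]_(N * N, d - k + k)).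
Hypothesis hM : M = [set m | A *m m = b].
Hypothesis hM0 : M0 = [set m | A *m m = b /\ A0 *m m = b0].
Hypothesis hp0 : M0 p0.
Hypothesis hPhi0 : is_basis Phi0 (Ker A :&: Ker A0)%MS.
Hypothesis hPhi : Phi = row_mx Phi0 Phi1.
Hypothesis hPhi_basis : is_basis Phi (Ker A).
Hypothesis hA1 : Com Q `&` [set m | A *m m = 0] `&` [set m | A0 *m m = 0] = [set 0].
Hypothesis hA2 : is_max
    [set \rank (Delta Q' *m Phi) | Q' in
       [set Q' : 'M[R]_N | Q' *m const_mx 1 = const_mx 1 :> 'cV[R]_N /\
                           supp Q' `<=` supp Q]]
    (\rank (Delta Q *m Phi)).
Variable P : 'M[R]_N.
Hypothesis PQ : P *m Q = Q *m P.
Hypothesis hPM : M (vec P).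

Local Notation E := (path_expectation Q nu).
Local Notation prob := (path_probability Q nu).
Local Notation WHP := (with_high_probability Q nu).
Local Notation PF Q' := (orthogonal_proj (F_space Phi Phi0 Q')).
Local Notation S := (S_stat M0 M).
Local Notation hat_V n y := (hat_W Phi Phi0 p0 n y).

Let whp_F : Filter WHP := whp_filter Q_ge0 Q_sum1 nu_ge0 nu_sum1.
#[local] Existing Instance whp_F.

Let params : (hat_Q t.1 t.2, hat_pi t.1 t.2) @[t --> WHP] --> parameter_filter Q pi :=
  parameters_lln Q_ge0 Q_sum1 nu_ge0 nu_sum1 pi_sum1 pi_gt0 piQ kerQ.

Let L := PF Q *m Delta P.
Let T n y := sqnorm (L *m fluctuation Q pi n y).

(** This diagonal matrix restores the random denominators: [sqrt n * vec (hat_Q - Q)] equals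
    [correction n y *m fluctuation Q pi n y] when all states are visited, and by the law of large
    numbers it tends to the identity. *)
Let correction n y : 'M[R]_(N * N) :=
  diag_mx (\row_c (pi 0 (mxtens_unindex c).2 / (n%:R^-1 * visits (mxtens_unindex c).2 n y))).

Lemma S_stat_null n y : M0 (vec P) -> (0 < n)%N -> (forall i, (0 : R) < visits i n y) ->
  S n y = sqnorm (PF (hat_Q n y) *m Delta P *m correction n y *m fluctuation Q pi n y).
Proof.
move=> M0P n0 v0; have nR : 0 < n%:R :> R by rewrite ltr0n.
rewrite -[LHS]/(n%:R * contrast M M0 (hat_Q n y)).
rewrite (contrast_null hM hM0 hPhi0 hPhi hPhi_basis _ hPM M0P).
rewrite (Delta_commuting _ PQ) mulmxN sqnormN -{1}(sqr_sqrtr (ltW nR)) -sqnormZ.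
congr sqnorm; rewrite -!mulmxA !scalemxAr; congr (_ *m (_ *m _)).
apply/colP => c; case: (mxtens_indexP c) => j i.
have vE : vec (hat_Q n y - Q) (mxtens_index (j, i)) 0 = hat_Q n y i j - Q i j.
  by rewrite [LHS]mxE mxtens_indexK /= [LHS]mxE [X in _ + X]mxE.
rewrite [LHS]mxE vE hat_QE ?gt_eqF// mul_diag_mx !mxE !mxtens_indexK /=.
rewrite /path_sum /scaled_transition mxtens_indexK /= -mulr_suml.
have sn : Num.sqrt n%:R != 0 :> R by rewrite gt_eqF// sqrtr_gt0.
have nE : n%:R = Num.sqrt n%:R ^+ 2 :> R by rewrite sqr_sqrtr// ltW.
have vi : visits i n y != 0 :> R by rewrite gt_eqF.
have pi0 : pi 0 i != 0 by rewrite gt_eqF.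
move: (Num.sqrt n%:R) (visits i n y) (\sum_(1 <= l < n) _) sn nE vi => s v x s0 -> v0'.
by field; rewrite pi0 v0' s0.
Qed.

(** Both statistics are squared norms of linear images of the same fluctuation. Their difference is
    controlled by the entries of [hL^T hL - L^T L], which tend to 0, times the squared norm of the
    fluctuation, which has bounded mean. *)
Lemma S_stat_approx : M0 (vec P) -> S t.1 t.2 - T t.1 t.2 @[t --> WHP] --> (0 : R).
Proof.
move=> M0P.
have cPF : mxcvg WHP (fun t => PF (hat_Q t.1 t.2)) (PF Q).
  by move=> i j; have := cvg_comp _ _ params (((mxcvg_PF hPhi0 hPhi hA1 hA2 pi) : mxcvg _ _ _) i j).
have cD : mxcvg WHP (fun t => correction t.1 t.2) 1%:M.
  move=> i j; rewrite mxE.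
  have [<-|ij] := eqVneq i j; last first.
    rewrite (_ : (fun t => _) = cst 0); first exact: cvg_cst.
    by apply/funext => t; rewrite /correction !mxE (negbTE ij).
  rewrite (_ : (fun t => _) = fun t => pi 0 (mxtens_unindex i).2 /
      (t.1%:R^-1 * visits (mxtens_unindex i).2 t.1 t.2)); last first.
    by apply/funext => t; rewrite /correction !mxE eqxx.
  rewrite -[X in _ --> X](divff (_ : pi 0 (mxtens_unindex i).2 != 0)) ?gt_eqF//.
  apply: cvgM; first exact: cvg_cst.
  apply: cvgV; first by rewrite gt_eqF.
  exact: (visits_lln Q_ge0 Q_sum1 nu_ge0 nu_sum1 pi_sum1 piQ kerQ).
pose hL t := PF (hat_Q t.1 t.2) *m Delta P *m correction t.1 t.2.
have cL : mxcvg WHP hL L.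
  rewrite -[L]mulmx1; apply: mxcvgM => //; apply: mxcvgM => //; exact: mxcvg_cst.
pose G t := \sum_i \sum_j `|((hL t)^T *m hL t - L^T *m L) i j|.
have cG : G t @[t --> WHP] --> (0 : R).
  have cGm : mxcvg WHP (fun t => (hL t)^T *m hL t - L^T *m L) 0.
    rewrite -(subrr (L^T *m L)); apply: mxcvgB; last exact: mxcvg_cst.
    by apply: mxcvgM => //; exact: mxcvg_tr.
  rewrite -[X in _ --> X](_ : \sum_(i < N * N) \sum_(j < N * N) `|(0 : 'M[R]_(N * N)) i j| = 0).
    apply: cvg_big => [|i _]; first exact: add_continuous.
    apply: cvg_big => [|j _]; first exact: add_continuous.
    apply: cvg_norm; exact: cGm.
  by rewrite big1// => i _; rewrite big1// => j _; rewrite mxE normr0.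
have [K zK] := fluctuation_second_moment Q_ge0 Q_sum1 nu_ge0 nu_sum1 pi.
have cGz : G t * (N * N)%:R * sqnorm (fluctuation Q pi t.1 t.2) @[t --> WHP] --> (0 : R).
  apply: (@whp_mul_tight _ _ Q nu Q_ge0 Q_sum1 nu_ge0 nu_sum1 _ _ K) => [t|n|].
    exact: sqnorm_ge0.
    exact: zK.
  by rewrite -[X in _ --> X](mul0r (N * N)%:R); apply: cvgM => //; exact: cvg_cst.
apply/norm_cvg0P; apply: (squeeze_cvgr _ (cvg_cst 0) cGz).
have n0 : \forall t \near WHP, (0 < t.1)%N.
  by apply: (@whp_eventually _ _ Q nu Q_ge0 Q_sum1 nu_ge0 nu_sum1 (fun n => (0 < n)%N));
    exact: nbhs_infty_gt.
have v0 := whp_visits_gt0 Q_ge0 Q_sum1 nu_ge0 nu_sum1 pi_sum1 pi_gt0 piQ kerQ.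
apply: filterS2 n0 v0 => -[n y] /= n0 v0; rewrite normr_ge0 /= S_stat_null//.
apply: sqnorm_mulmx_diff => i j.
rewrite /G (bigD1 i)//= (bigD1 j)//= -addrA lerDl addr_ge0 ?sumr_ge0// => l _.
exact: sumr_ge0.
Qed.

Let W := W_ (F_space Phi Phi0 Q) P (Sigma pi Q).

Lemma Sigma_tr : (Sigma pi Q)^T = Sigma pi Q.
Proof.
apply/matrixP => c c'; rewrite mxE -!asymptotic_covariance_entry//.
by apply: eq_bigr => a _; congr (_ * _); apply: eq_bigr => e _; rewrite [X in _ * X]mulrC.
Qed.

Lemma W_conj : W = L *m Sigma pi Q *m L^T.
Proof. by rewrite /W /W_ /L trmx_mul orthogonal_proj_tr !mulmxA. Qed.

Lemma W_tr : W^T = W.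
Proof. by rewrite W_conj; move: (L) => L'; rewrite !trmx_mul trmxK Sigma_tr mulmxA. Qed.

Lemma quadratic_form_W_ge0 x : 0 <= quadratic_form W x.
Proof. by rewrite W_conj; exact: quadratic_form_covariance_ge0. Qed.

Let mQ : mxcvg WHP (fun t => hat_V t.1 t.2) (covariance_of p0 Phi0 Phi (Q, pi)).
Proof.
by move=> i j; exact: cvg_comp _ _ params
  (((mxcvg_covariance hPhi0 hPhi hA1 hA2 pi_gt0) : mxcvg _ _ _) i j).
Qed.

Let E_lin n (f g : (nat -> 'I_N) -> R) (a : R) :
  E n (fun y => f y + a * g y) = E n f + a * E n g.
Proof. by rewrite path_expectationD path_expectationZ. Qed.

Let prob_lt u n : prob n [set y | u < T n y] = E n (fun y => (u < T n y)%R%:R).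
Proof. by apply: eq_path_expectation => y; rewrite asboolb. Qed.

Lemma T_tail_le (t u eta : R) : 0 <= t -> t < u -> 0 < eta ->
  \forall n \near \oo, prob n [set y | u < T n y] <= 1 - chi2G_cdf W t + eta.
Proof.
move=> t0 tu eta0; rewrite -tail_chi2G W_conj; under eq_near do rewrite prob_lt.
apply: (laplace_tail_le (E := E)) => //.
- exact: le_path_expectation.
- exact: path_expectation_cst.
- exact: measurable_quadratic_form.
- exact: quadratic_form_covariance_ge0.
- by move=> n y; exact: sqnorm_ge0.
- exact: fluctuation_laplace_cvg.
Qed.

Lemma T_tail_ge (t u eta : R) : 0 <= t -> t < u -> 0 < eta ->
  \forall n \near \oo, 1 - chi2G_cdf W u - eta <= prob n [set y | t < T n y].
Proof.
move=> t0 tu eta0; rewrite -tail_chi2G W_conj; under eq_near do rewrite prob_lt.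
apply: (laplace_tail_ge (E := E)) => //.
- exact: le_path_expectation.
- exact: path_expectation_cst.
- exact: measurable_quadratic_form.
- exact: quadratic_form_covariance_ge0.
- by move=> n y; exact: sqnorm_ge0.
- exact: fluctuation_laplace_cvg.
Qed.

Lemma chi2G_cdf_W_lt0 t : t < 0 -> chi2G_cdf W t = 0.
Proof.
move=> t0; rewrite /chi2G_cdf (_ : [set x | _] = set0) ?measure0//.
apply/seteqP; split => // x /= xt; have := quadratic_form_W_ge0 x.
by rewrite leNgt (le_lt_trans xt).
Qed.

Let Delta_p : Delta Q *m vec P = 0.
Proof. by rewrite Delta_vec PQ subrr; apply/colP => c; rewrite !mxE. Qed.

Lemma level_of_test (alpha : R) : 0 < alpha < 1 -> W <> 0 -> M0 (vec P) ->
  prob n [set y | quantile (chi2G (hat_V n y)) (1 - alpha) < S n y] @[n --> \oo] --> alpha.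
Proof.
move=> /andP[al0 al1] /eqP W0 M0P.
have WE : covariance_of p0 Phi0 Phi (Q, pi) = W.
  by rewrite /covariance_of /= (hat_p_null hM0 hp0 hPhi0 hA1 M0P Delta_p) vecK.
apply/cvgrPdist_le => e e0.
(* The outermost levels miss [1 - alpha] by [4 eta]; the tail limit and the exceptional event each
   cost another [eta], for a total of [6 eta <= e]. The second bound keeps all levels strictly
   between 0 and 1. *)
pose eta := Num.min (e / 6) (Num.min alpha (1 - alpha) / 5).
have eta0 : 0 < eta by rewrite lt_min !divr_gt0// lt_min al0 subr_gt0.
have etae : 6 * eta <= e.
  have : eta <= e / 6 by rewrite ge_min lexx.
  lra.
have [eta1 eta2] : 5 * eta <= alpha /\ 5 * eta <= 1 - alpha.
  have : eta <= Num.min alpha (1 - alpha) / 5 by rewrite /eta ge_min lexx orbT.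
  have : Num.min alpha (1 - alpha) <= alpha by rewrite ge_min lexx.
  have : Num.min alpha (1 - alpha) <= 1 - alpha by rewrite ge_min lexx orbT.
  by move: (Num.min alpha _) => x; lra.
have lev p : 0 < p < 1 -> exists t, chi2G_cdf W t = p by exact: chi2G_cdf_surj W_tr W0.
have ord s t : chi2G_cdf W s < chi2G_cdf W t -> s < t.
  by rewrite !ltNge; apply: contra; exact: chi2G_cdf_mono.
(* On each side, the passage from index 1 to 2 allows for the perturbation of [W] into [hat_W], from
   2 to 3 for the difference between [S] and [T], and from 3 to 4 for the convergence of the tails
   of [T]. *)
have [a4 a4E] : exists t, chi2G_cdf W t = 1 - alpha - 4 * eta by apply: lev; lra.
have [a3 a3E] : exists t, chi2G_cdf W t = 1 - alpha - 3 * eta by apply: lev; lra.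
have [a2 a2E] : exists t, chi2G_cdf W t = 1 - alpha - 2 * eta by apply: lev; lra.
have [a1 a1E] : exists t, chi2G_cdf W t = 1 - alpha - eta by apply: lev; lra.
have [b1 b1E] : exists t, chi2G_cdf W t = 1 - alpha + eta by apply: lev; lra.
have [b2 b2E] : exists t, chi2G_cdf W t = 1 - alpha + 2 * eta by apply: lev; lra.
have [b3 b3E] : exists t, chi2G_cdf W t = 1 - alpha + 3 * eta by apply: lev; lra.
have [b4 b4E] : exists t, chi2G_cdf W t = 1 - alpha + 4 * eta by apply: lev; lra.
have a43 : a4 < a3 by apply: ord; lra.
have a32 : a3 < a2 by apply: ord; lra.
have a21 : a2 < a1 by apply: ord; lra.
have b12 : b1 < b2 by apply: ord; lra.
have b23 : b2 < b3 by apply: ord; lra.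
have b34 : b3 < b4 by apply: ord; lra.
have a4b3 : a4 < b3 by apply: ord; lra.
(* The tail bounds are available for nonnegative thresholds only; the distribution function vanishes
   on negative numbers, whereas its value at [a4] is positive. *)
have a40 : 0 <= a4.
  by rewrite leNgt; apply/negP => /chi2G_cdf_W_lt0; lra.
(* Half of [eta] on this side, because locating the quantile from below requires a strict
   inequality. *)
have [dla dla0 da] := @chi2G_cdf_perturb _ _ W a2 a1 (eta / 2) a21 (divr_gt0 eta0 (ltr0n _ 2)).
have [dlb dlb0 db] := @chi2G_cdf_perturb _ _ W b1 b2 eta b12 eta0.
pose dl := Num.min dla dlb; pose g := Num.min (a2 - a3) (b3 - b2).
have dl0 : 0 < dl by rewrite lt_min dla0.
have g0 : 0 < g by rewrite lt_min !subr_gt0 a32.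
have quant (V : 'M[R]_(N * N)) : (forall i j, `|V i j - W i j| <= dl) ->
    a2 <= quantile (chi2G V) (1 - alpha) <= b2.
  move=> VW.
  have VWa i j : `|V i j - W i j| <= dla by rewrite (le_trans (VW i j))// ge_min lexx.
  have VWb i j : `|V i j - W i j| <= dlb by rewrite (le_trans (VW i j))// ge_min lexx orbT.
  have [_ ha] := da _ VWa; have [hb _] := db _ VWb.
  apply: quantile_chi2G_itv; [apply: le_lt_trans ha _|apply: le_trans hb].
    by rewrite a1E; lra.
  by rewrite b1E addrK.
pose u n y := quantile (chi2G (hat_V n y)) (1 - alpha).
have whpG : \forall t \near WHP, a2 <= u t.1 t.2 <= b2 /\ `|S t.1 t.2 - T t.1 t.2| <= g.
  have near1 : \forall t \near WHP, forall i j, `|hat_V t.1 t.2 i j - W i j| <= dl.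
    by rewrite -WE; exact: mxcvg_near_bound.
  have /cvgrPdist_le/(_ g g0) := S_stat_approx M0P.
  apply: filterS2 near1 => -[n y] /= VW; rewrite sub0r normrN => ST; split=> //.
  exact: quant.
have /cvgrPdist_le/(_ eta eta0) : prob n [set y | ~ (a2 <= u n y <= b2 /\ `|S n y - T n y| <= g)]
  @[n --> \oo] --> (0 : R) by exact: whpG.
move=> nearG; near=> n.
have G : prob n [set y | ~ (a2 <= u n y <= b2 /\ `|S n y - T n y| <= g)] <= eta.
  apply: le_trans (ler_norm _) _; rewrite -normrN -sub0r; near: n; exact: nearG.
have H1 : prob n [set y | a3 < T n y] <= 1 - chi2G_cdf W a4 + eta.
  by near: n; exact: T_tail_le.
have H2 : 1 - chi2G_cdf W b4 - eta <= prob n [set y | b3 < T n y].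
  by near: n; apply: T_tail_ge => //; rewrite (le_trans a40)// ltW.
have H3 : prob n [set y | u n y < S n y] <= prob n [set y | a3 < T n y] +
    prob n [set y | ~ (a2 <= u n y <= b2 /\ `|S n y - T n y| <= g)].
  apply: path_probabilityU => // y /= uS; apply: contrapT => /not_orP[n1 /contrapT[/andP[ua _]]].
  rewrite ler_norml => /andP[_ gT]; apply: n1.
  have : g <= a2 - a3 by rewrite ge_min lexx.
  move: uS ua gT; move: (u n y) (S n y) (T n y) (g) => u' s' t' g'; clear G H1 H2; lra.
have H4 : prob n [set y | b3 < T n y] <= prob n [set y | u n y < S n y] +
    prob n [set y | ~ (a2 <= u n y <= b2 /\ `|S n y - T n y| <= g)].
  apply: path_probabilityU => // y /= bT; apply: contrapT => /not_orP[n1 /contrapT[/andP[_ ub]]].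
  rewrite ler_norml => /andP[gT _]; apply: n1.
  have : g <= b3 - b2 by rewrite ge_min lexx orbT.
  move: bT ub gT; move: (u n y) (S n y) (T n y) (g) => u' s' t' g'; clear G H1 H2 H3; lra.
move: G H1 H2 H3 H4; rewrite a4E b4E ler_norml.
set x1 := prob n _; set x2 := prob n _; set x3 := prob n _; set x4 := prob n _.
lra.
Unshelve. all: by end_near. Qed.

Lemma power_of_test (alpha : R) : 0 < alpha < 1 ->
    (forall p', M0 p' -> Delta Q *m p' <> 0) ->
  prob n [set y | quantile (chi2G (hat_V n y)) (1 - alpha) < S n y] @[n --> \oo] --> (1 : R).
Proof.
move=> /andP[al0 al1] alt; 
suff H : \forall t \near WHP, quantile (chi2G (hat_V t.1 t.2)) (1 - alpha) < S t.1 t.2.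
  exact: whp_limit H.
have [c c0 hc] := contrast_alternative hM0 hp0 hPhi0 hA1 pi hPM Delta_p alt.
have near1 : \forall t \near WHP, c <= contrast M M0 (hat_Q t.1 t.2) by exact: params hc.
pose V0 := covariance_of p0 Phi0 Phi (Q, pi).
pose C := \sum_i \sum_j `|V0 i j| + 1.
have V0C i j : `|V0 i j| <= C - 1.
  rewrite /C addrK (bigD1 i)//= (bigD1 j)//= -addrA lerDl addr_ge0 ?sumr_ge0// => l _.
  exact: sumr_ge0.
have C0 : 0 <= C.
  by rewrite addr_ge0// sumr_ge0// => i _; exact: sumr_ge0.
have near2 : \forall t \near WHP, forall i j, `|hat_V t.1 t.2 i j - V0 i j| <= 1.
  exact: mxcvg_near_bound.
(* Half of the minimum gives [eta <= alpha], for the upper bound on the quantile, and the strict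
   [eta < 1 - alpha], for the lower one. *)
pose eta := Num.min alpha (1 - alpha) / 2.
have m0 : 0 < Num.min alpha (1 - alpha) by rewrite lt_min al0 subr_gt0.
have m1 : Num.min alpha (1 - alpha) <= alpha by rewrite ge_min lexx.
have m2 : Num.min alpha (1 - alpha) <= 1 - alpha by rewrite ge_min lexx orbT.
have eta0 : 0 < eta by rewrite divr_gt0.
have [B B0 hB] := @chi2G_cdf_bounded R (N * N) C eta eta0 C0.
have near3 : \forall t \near WHP, B / c < t.1%:R.
  by apply: (@whp_eventually _ _ Q nu Q_ge0 Q_sum1 nu_ge0 nu_sum1 (fun n => B / c < n%:R));
    exact: nbhs_infty_gtr.
apply: filterS3 near1 near2 near3 => -[n y] /= h1 h2 h3.
have VC i j : `|hat_V n y i j| <= C.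
  rewrite -[hat_V n y i j](subrK (V0 i j)); apply: le_trans (ler_normD _ _) _.
  have := h2 i j; have := V0C i j.
  by move: `|V0 i j| `|_ - _| => x z; lra.
have [hb ha] := hB _ VC.
have /andP[_ uB] : - B - 1 <= quantile (chi2G (hat_V n y)) (1 - alpha) <= B.
  by apply: quantile_chi2G_itv; [apply: le_lt_trans ha _; clear hb|apply: le_trans hb; clear ha];
     rewrite /eta; move: (Num.min _ _) m0 m1 m2 => x; lra.
apply: le_lt_trans uB _; rewrite -[ltRHS]/(n%:R * contrast M M0 (hat_Q n y)).
apply: (@lt_le_trans _ _ (n%:R * c)); first by rewrite -ltr_pdivrMr.
by rewrite ler_wpM2l.
Qed.

End test_statistic.

(** * From path expectations back to the probability space *)

Lemma eq_hat_Q {R : realType} (N : nat) n (y z : nat -> 'I_N) :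
  (forall l, (l <= n)%N -> y l = z l) -> hat_Q n y = hat_Q n z :> 'M[R]_N.
Proof.
move=> yz; apply/matrixP => i j; rewrite !mxE.
by congr (_ / _); apply: eq_big_nat => k /andP[_ kn]; rewrite ?(yz k (ltnW kn)) ?(yz k.+1 kn).
Qed.

Lemma eq_hat_pi {R : realType} (N : nat) n (y z : nat -> 'I_N) :
  (forall l, (l <= n)%N -> y l = z l) -> hat_pi n y = hat_pi n z :> 'rV[R]_N.
Proof.
move=> yz; apply/rowP => i; rewrite !mxE.
by congr (_ * _); apply: eq_big_nat => k /andP[_ kn]; rewrite yz.
Qed.

Theorem corollary3p2 (R : realType) (N : nat) (hN : (3 <= N)%N)
  (P : 'M[R]_N) (hP : stochastic P)
  (hP_irr : irreducible P) (hP_aper : aperiodic P)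
  (pi : 'rV[R]_N) (hpi : invariant_distribution P pi)
  (disp : measure_display) (Omega : measurableType disp)
  (Pr : probability Omega R)
  (X : nat -> Omega -> 'I_N) (hX : markov_chain Pr P X)
  (mu : probability nat R) (hmu : exists B : set nat, mu B <> \d_0%N B)
  (tau : nat -> {RV Pr >-> nat})
  (htau_indep : mutually_independent tau)
  (htau_law : identically_distributed tau mu)
  (hXtau : independent_of_gaps X tau)
  (Q : 'M[R]_N) (hQ : Q = G_ mu P)
  (r k d : nat)
  (A : 'M[R]_(r, N * N)) (hA : \rank A = r) (b : 'cV[R]_r)
  (hd : d = (N * N - r)%N)
  (hPM : A *m vec P = b)
  (hk : (1 <= k)%N)
  (A0 : 'M[R]_(k, N * N)) (hA0 : \rank A0 = k) (b0 : 'cV[R]_k)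
  (M : set 'cV[R]_(N * N)) (hM : M = [set m | A *m m = b])
  (M0 : set 'cV[R]_(N * N)) (hM0 : M0 = [set m | A *m m = b /\ A0 *m m = b0])
  (hkd : (k <= d)%N) (hM0_dim : \rank (Ker A :&: Ker A0)%MS = (d - k)%N)
  (p0 : 'cV[R]_(N * N)) (hp0 : M0 p0)
  (Phi0 : 'M[R]_(N * N, d - k)) (hPhi0 : is_basis Phi0 (Ker A :&: Ker A0)%MS)
  (Phi1 : 'M[R]_(N * N, k)) (Phi : 'M[R]_(N * N, d - k + k))
  (hPhi : Phi = row_mx Phi0 Phi1) (hPhi_basis : is_basis Phi (Ker A))
  (hA1 : Com Q `&` [set m | A *m m = 0] `&` [set m | A0 *m m = 0] = [set 0])
  (hA2 : is_max
    [set \rank (Delta Q' *m Phi) | Q' in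
       [set Q' : 'M[R]_N | Q' *m const_mx 1 = const_mx 1 :> 'cV[R]_N /\
                           supp Q' `<=` supp Q]]
    (\rank (Delta Q *m Phi)))
  (alpha : R) (halpha : 0 < alpha < 1) :
  let Y w := observed X (fun j => tau j) w in
  let S n w := S_stat M0 M n (Y w) in
  let hat_u n w := quantile (chi2G (hat_W Phi Phi0 p0 n (Y w))) (1 - alpha) in
  let W := W_ (F_space Phi Phi0 Q) P (Sigma pi Q) in
  (W <> 0 -> A0 *m vec P = b0 ->
     Pr [set w | hat_u n w < S n w] @[n --> \oo] --> alpha%:E) /\
  ((forall p', M0 p' -> Delta Q *m p' <> 0) ->
     Pr [set w | hat_u n w < S n w] @[n --> \oo] --> 1%:E).
Proof.
move=> Y S hat_u W.
have [pi_ge0 pi_sum1 piP] := hpi.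
have YQ : markov_chain Pr Q (fun k w => Y w k) by rewrite hQ; exact: observed_markov_chain.
have [Q_ge0 Q_sum1] : stochastic Q by rewrite hQ; exact: stochastic_G.
have pi_gt0 := invariant_gt0 hP hP_irr hpi.
have piQ : pi *m Q = pi by rewrite hQ; exact: invariant_G.
have kerQ (h : 'cV[R]_N) : Q *m h = h -> exists a, h = const_mx a.
  by rewrite hQ; exact: harmonic_G_cst.
have PQ : P *m Q = Q *m P by rewrite hQ; exact: G_comm.
have MP : M (vec P) by rewrite hM.
pose nu i := fine (Pr ((fun w => Y w 0%N) @^-1` [set i])).
have nu_ge0 i : 0 <= nu i by rewrite /nu fine_ge0.
have nu_sum1 : \sum_i nu i = 1 by exact: initial_law_sum1 YQ.
pose rejection n := [set y |
  quantile (chi2G (hat_W Phi Phi0 p0 n y)) (1 - alpha) < S_stat M0 M n y].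
(* The estimators read the path up to time [n] only, so the rejection probability is a finite sum
   over observed paths, started from the law [nu] of the first state. *)
have PrE n : Pr [set w | hat_u n w < S n w] = (path_probability Q nu n (rejection n))%:E.
  have dep : depends_upto (rejection n) n.
    move=> y z yz; rewrite /rejection /= /S_stat /hat_W.
    by rewrite (eq_hat_Q yz) (eq_hat_pi yz).
  by have [_ ->] := probability_path_event YQ dep.
split=> [W0 A0p|alt]; under eq_fun do rewrite PrE; apply: cvg_EFin; try exact: nearW.
- have M0P : M0 (vec P) by rewrite hM0.
  exact: (level_of_test Q_ge0 Q_sum1 nu_ge0 nu_sum1 pi_sum1 pi_gt0 piQ kerQ
    hM hM0 hp0 hPhi0 hPhi hPhi_basis hA1 hA2 PQ MP halpha W0 M0P).
- exact: (power_of_test Q_ge0 Q_sum1 nu_ge0 nu_sum1 pi_sum1 pi_gt0 piQ kerQ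
    hM0 hp0 hPhi0 hPhi hA1 hA2 PQ MP halpha alt).
Qed.
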